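(* Let $\mathcal{C}$ be a (strict) Markov category with conditionals. There exists a symmetric monoidal $x$-semi triple category $Arena^{\mathrm{Moore}}_{\mathcal{C}}$ with the following properties. 1. Objects are pairs $\begin{pmatrix} a \\ c\end{pmatrix}$, where $a$ and $c$ are objects of $\mathcal{C}$. 2. An $x$-morphism $\begin{pmatrix} a_1 \\ c_1\end{pmatrix} \rightrightarrows \begin{pmatrix} a_2 \\ c_2\end{pmatrix}$ is given by a pair of objects $\begin{pmatrix} a_{12} \\ c_{12}\end{pmatrix}$ and a pair of morphisms of $\mathcal{C}$, $f_{12}: c_1 \to c_{12}\otimes c_2$ and $f_{12}^{\flat}: c_1\otimes a_1 \to c_{12}\otimes c_2\otimes a_{12}\otimes a_2$, such that $f_{12}^{\flat};\pi_{c_{12}\otimes c_2} = \pi_{c_1}; f_{12}$. The $x$-morphisms compose using copy-composition (formula (X) of the context). 3. The $y$-morphisms are deterministic lenses $\begin{pmatrix} a_1 \\ c_1\end{pmatrix} \leftrightarrows \begin{pmatrix} a_2 \\ c_2\end{pmatrix}$, i.e. pairs of deterministic morphisms $f: c_1\to c_2$, $f^{\sharp}: c_1\otimes a_2\to a_1$. 4. The $z$-morphisms $\begin{pmatrix} a_1 \\ c_1\end{pmatrix} \rightrightarrows \begin{pmatrix} a_2 \\ c_2\end{pmatrix}$ are pairs of deterministic morphisms $f: c_1\to c_2$, $g: a_1\to a_2$ in $\mathcal{C}$. 5. The $xy$-squares with top $x$-morphism $(a_{12},c_{12},f_{12},f_{12}^{\flat}):\begin{pmatrix} a_1 \\ c_1\end{pmatrix}\rightrightarrows\begin{pmatrix}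 a_2 \\ c_2\end{pmatrix}$, bottom $x$-morphism $(a_{34},c_{34},f_{34},f_{34}^{\flat}):\begin{pmatrix} a_3 \\ c_3\end{pmatrix}\rightrightarrows\begin{pmatrix} a_4 \\ c_4\end{pmatrix}$, left $y$-morphism $(f_{13},f_{13}^{\sharp}):\begin{pmatrix} a_1 \\ c_1\end{pmatrix}\leftrightarrows\begin{pmatrix} a_3 \\ c_3\end{pmatrix}$ and right $y$-morphism $(f_{24},f_{24}^{\sharp}):\begin{pmatrix} a_2 \\ c_2\end{pmatrix}\leftrightarrows\begin{pmatrix} a_4 \\ c_4\end{pmatrix}$ are given by a $y$-morphism $(f_{1234},f_{1234}^{\sharp}):\begin{pmatrix} a_{12} \\ c_{12}\end{pmatrix}\leftrightarrows\begin{pmatrix} a_{34} \\ c_{34}\end{pmatrix}$ along with a morphism $s: c_1\otimes a_3\to c_{12}\otimes c_2\otimes a_{34}\otimes a_4$ of $\mathcal{C}$ such that (a) $f_{12};(f_{1234}\otimes f_{24}) = f_{13};f_{34}$; (b) $s;(f_{1234}\otimes f_{24}\otimes a_{34}\otimes a_4) = (f_{13}\otimes a_3);f_{34}^{\flat}$; (c) $(copy_{c_1}\otimes a_3);(c_1\otimes f_{13}^{\sharp});f_{12}^{\flat} = s;copy_{c_{12}\otimes c_2};\sigma;(c_{12}\otimes c_2\otimes f_{1234}^{\sharp}\otimes f_{24}^{\sharp})$. Composition in the $x$-direction is copy-composition in $\mathcal{C}$ (formula (XY-x) of the context), and composition in the $y$-direction uses conditional products in $\mathcal{C}$ (formula (XY-y)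 of the context). 6. The $yz$-squares with left and right $y$-morphisms $(f_{13},f_{13}^{\sharp}):\begin{pmatrix} a_1 \\ c_1\end{pmatrix}\leftrightarrows\begin{pmatrix} a_3 \\ c_3\end{pmatrix}$, $(f_{24},f_{24}^{\sharp}):\begin{pmatrix} a_2 \\ c_2\end{pmatrix}\leftrightarrows\begin{pmatrix} a_4 \\ c_4\end{pmatrix}$ and top and bottom $z$-morphisms $(f_{12},g_{12}):\begin{pmatrix} a_1 \\ c_1\end{pmatrix}\rightrightarrows\begin{pmatrix} a_2 \\ c_2\end{pmatrix}$, $(f_{34},g_{34}):\begin{pmatrix} a_3 \\ c_3\end{pmatrix}\rightrightarrows\begin{pmatrix} a_4 \\ c_4\end{pmatrix}$ are given by the equation $f_{13};f_{34}=f_{12};f_{24}$ (one square if it holds, none otherwise). Compositions are concatenations of commuting squares in $\mathcal{C}_{det}$. 7. The $xz$-squares with top and bottom $x$-morphisms $(a_{12},c_{12},f_{12},f_{12}^{\flat}):\begin{pmatrix} a_1 \\ c_1\end{pmatrix}\rightrightarrows\begin{pmatrix} a_2 \\ c_2\end{pmatrix}$, $(a_{34},c_{34},f_{34},f_{34}^{\flat}):\begin{pmatrix} a_3 \\ c_3\end{pmatrix}\rightrightarrows\begin{pmatrix} a_4 \\ c_4\end{pmatrix}$ and left and right $z$-morphisms $(f_{13},g_{13}):\begin{pmatrix} a_1 \\ c_1\end{pmatrix}\rightrightarrows\begin{pmatrix} a_3 \\ c_3\end{pmatrix}$, $(f_{24},g_{24}):\begin{pmatrix} a_2 \\ c_2\end{pmatrix}\rightrightarrows\begin{pmatrix}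 a_4 \\ c_4\end{pmatrix}$ are given by pairs of deterministic morphisms $f_{1234}:c_{12}\to c_{34}$, $g_{1234}:a_{12}\to a_{34}$ such that $f_{12};(f_{1234}\otimes f_{24})=f_{13};f_{34}$ and $f_{12}^{\flat};(f_{1234}\otimes f_{24}\otimes g_{1234}\otimes g_{24})=(f_{13}\otimes g_{13});f_{34}^{\flat}$. 8. There is exactly one $xyz$-morphism, i.e. cube, for each boundary.
   Context: **Conventions.** $f;g$ means $g\circ f$. An object written in place of a morphism denotes its identity. $\otimes$ may be omitted. $\sigma$ denotes a suitable symmetry isomorphism permuting tensor factors, and $\pi_X$ denotes a projection onto $X$ (deleting the other factors). **Markov categories.** A Markov category is a symmetric monoidal category whose unit is terminal and in which each object $X$ carries a commutative comonoid structure $copy_X:X\to X\otimes X$, $del_X:X\to 1$, uniformly with respect to $\otimes$. All Markov categories are assumed strict. A morphism is deterministic if it commutes with the $copy$ maps; $\mathcal{C}_{det}$ is the (cartesian) wide subcategory of deterministic morphisms. $\mathcal{C}$ has conditionals if for every $\phi:A\to X\otimes Y$ there is $\phi|X:A\otimes X\to Y$ such that $\phi$ is obtained by copying $A$, applying the marginal $\phi;\pi_X$ to one copy, copying the resulting $X$, and applying $\phi|X$ to the other copy of $A$ and one copy of $X$. If $f:A\to X\otimes Y$ and $g:A\to Y\otimes Z$ have the same marginal $h:A\to Y$, their conditional product over $Y$ is $f\otimes_Y g:A\to X\otimes Y\otimes Z$ obtained by copying $A$, applying $h$ to one copy, copying $Y$, and applying conditionals $f|Y:A\otimes Y\to X$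 and $g|Y:A\otimes Y\to Z$ to the other copies; it does not depend on the choice of conditionals and has marginals $f$ and $g$. **Semi triple categories.** A semicategory is a category without the requirement of identities. An $x$-semi double category (directions $x,y$) is a category strictly internal to semicategories: it has objects, a semicategory of $x$-morphisms, a category of $y$-morphisms, and squares with strictly associative $x$- and $y$-compositions satisfying interchange, with identity squares (for $y$-composition) on all $x$-morphisms; no $x$-identities are required. An $x$-semi double functor is an internal functor of these. An $x$-semi triple category is a category strictly internal to $x$-semi double categories: it has objects, a semicategory of $x$-morphisms, categories of $y$- and $z$-morphisms, $xy$-, $xz$-, $yz$-squares and $xyz$-cubes, with strictly associative compositions of squares and cubes in each of their directions, all interchange laws, and identities for $y$- and $z$-compositions (but not necessarily $x$-compositions). A boundary of a cube is a compatible family of six squares. **Symmetric monoidal structure.** It is the one given componentwise by the tensor product of $\mathcal{C}$ (which restricts to the cartesian product of $\mathcal{C}_{det}$) on objects, morphisms and squares, compatibly with sources, targets, compositions and existing identities, with unit and symmetry coming from $\mathcal{C}$. **Compositions.** $z$-morphisms compose componentwise. $y$-morphisms compose as lenses: the composite of $(f,f^\sharp):\begin{pmatrix} a_1 \\ c_1\end{pmatrix}\leftrightarrows\begin{pmatrix} a_2 \\ c_2\end{pmatrix}$ and $(g,g^\sharp):\begin{pmatrix} a_2 \\ c_2\end{pmatrix}\leftrightarrows\begin{pmatrix} a_3 \\ c_3\end{pmatrix}$ is $f;g$ together with $c_1a_3\xrightarrow{copy_{c_1}}c_1c_1a_3\xrightarrow{c_1\otimes f\otimes a_3}c_1c_2a_3\xrightarrow{c_1\otimes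 g^\sharp}c_1a_2\xrightarrow{f^\sharp}a_1$. (X) The composite of $(a_{12},c_{12},f_{12},f_{12}^\flat)$ and $(a_{23},c_{23},f_{23},f_{23}^\flat)$ has parameter objects $\begin{pmatrix} a_{12} a_2 a_{23} \\ c_{12} c_2 c_{23}\end{pmatrix}$, first map $f_{12};(c_{12}\otimes copy_{c_2});(c_{12}c_2\otimes f_{23})$, and second map: apply $f_{12}^\flat$, copy $c_2\otimes a_2$, apply $f_{23}^\flat$ to the second copy of $c_2\otimes a_2$, and permute the factors to $c_{12}c_2c_{23}c_3a_{12}a_2a_{23}a_3$. (XY-x) Let $s:c_1a_4\to c_{12}c_2a_{45}a_5$ and $t:c_2a_5\to c_{23}c_3a_{56}a_6$ be (the morphisms of) $x$-adjacent $xy$-squares, with tops $1\to2\to3$, bottoms $4\to5\to6$. Their $x$-composite has as $y$-morphism component the tensor product of the lenses $(f_{1245},f_{1245}^\sharp)$, $(f_{25},f_{25}^\sharp)$, $(f_{2356},f_{2356}^\sharp)$, and as morphism: apply $s$, copy $c_2\otimes a_5$, apply $t$ to the second copy, permute to $c_{12}c_2c_{23}c_3a_{45}a_5a_{56}a_6$. (XY-y) Let $s:c_1a_3\to c_{12}c_2a_{34}a_4$ and $t:c_3a_5\to c_{34}c_4a_{56}a_6$ be $y$-adjacent $xy$-squares (rows $1\to2$, $3\to4$, $5\to6$). The $y$-morphism component of the $y$-composite is the composite lens $\begin{pmatrix} a_{12} \\ c_{12}\end{pmatrix}\leftrightarrows\begin{pmatrix} a_{34} \\ c_{34}\end{pmatrix}\leftrightarrows\begin{pmatrix}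 a_{56} \\ c_{56}\end{pmatrix}$. Its morphism $c_1a_5\to c_{12}c_2a_{56}a_6$ is the marginal, deleting $c_{34}c_4a_{34}a_4$, of the conditional product over $c_{34}c_4a_{34}a_4$ of the following two morphisms: (i) $c_1a_5\to c_1c_3a_5$ (copy $c_1$, apply $f_{13}$), then $c_1\otimes f_{35}^\sharp$, then $s$, then copy $c_{12}c_2$ and apply $f_{1234}\otimes f_{24}$ to one copy, giving $c_1a_5\to c_{12}c_2\otimes c_{34}c_4a_{34}a_4$; (ii) $f_{13}\otimes a_5$, then $t$, then copy $c_{34}c_4a_{56}a_6$ and apply $f_{3456}^\sharp:c_{34}a_{56}\to a_{34}$ and $f_{46}^\sharp:c_4a_6\to a_4$ to one copy, giving $c_1a_5\to c_{34}c_4a_{34}a_4\otimes a_{56}a_6$. $xz$-squares compose in the $z$-direction by composing in $\mathcal{C}_{det}$, and in the $x$-direction by $f_{1346}=f_{1245}\otimes f_{25}\otimes f_{2356}$, $g_{1346}=g_{1245}\otimes g_{25}\otimes g_{2356}$ (tops $1\to2\to3$, bottoms $4\to5\to6$, vertical $z$-morphisms). *)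

(* Defs.v *)
From Stdlib Require Import List.
Import ListNotations.

Set Implicit Arguments.
Unset Strict Implicit.
Unset Printing Implicit Defensive.

(** * Strict Markov categories *)

Record category := Category {
  ob :> Type;
  hom : ob -> ob -> Type;
  idm : forall a, hom a a;
  comp : forall a b c, hom a b -> hom b c -> hom a c;  (* diagrammatic order *)
  comp_idl : forall a b (f : hom a b), comp (idm a) f = f;
  comp_idr : forall a b (f : hom a b), comp f (idm b) = f;
  compA : forall a b c d (f : hom a b) (g : hom b c) (h : hom c d),
    comp (comp f g) h = comp f (comp g h)
}.
Arguments idm {_} a.

Declare Scope hom_scope.
Delimit Scope hom_scope with hom.
Notation "f >> g" := (comp f g) (at level 50, left associativity) : hom_scope.
Local Open Scope hom_scope.

(* The identity of [a], with target rewritten along an equality of objects.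
   Strict associativity and unitality are equalities of objects, so in a typed
   presentation the (identity) coherence morphisms appear as [eqhom]s. *)
Definition eqhom {C : category} {a b : C} (e : a = b) : hom a b :=
  match e in _ = b' return hom a b' with eq_refl => idm a end.

Record strict_monoidal_category := StrictMonoidal {
  mon_cat :> category;
  one : mon_cat;
  ten : mon_cat -> mon_cat -> mon_cat;
  tenm : forall a b a' b' : mon_cat,
    hom a b -> hom a' b' -> hom (ten a a') (ten b b');
  tenm_id : forall a a', tenm (idm a) (idm a') = idm (ten a a');
  tenm_comp : forall a b c a' b' c' (f : hom a b) (g : hom b c)
      (f' : hom a' b') (g' : hom b' c'),
    tenm (f >> g) (f' >> g') = tenm f f' >> tenm g g';
  tenA : forall a b c, ten (ten a b) c = ten a (ten b c);
  ten1l : forall a, ten one a = a;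
  ten1r : forall a, ten a one = a;
  tenmA : forall a a' b b' c c' (f : hom a a') (g : hom b b') (h : hom c c'),
    tenm (tenm f g) h >> eqhom (tenA a' b' c')
    = eqhom (tenA a b c) >> tenm f (tenm g h);
  tenm1l : forall a b (f : hom a b),
    tenm (idm one) f >> eqhom (ten1l b) = eqhom (ten1l a) >> f;
  tenm1r : forall a b (f : hom a b),
    tenm f (idm one) >> eqhom (ten1r b) = eqhom (ten1r a) >> f
}.
Arguments one {_}.
Notation "a ⊗ b" := (ten a b) (at level 40, left associativity).

Lemma ten_mid4 (C : strict_monoidal_category) (a b c d : C) :
  (a ⊗ b) ⊗ (c ⊗ d) = a ⊗ ((b ⊗ c) ⊗ d).
Proof. now rewrite !tenA. Qed.

Record symmetric_monoidal_category := SymMonoidal {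
  sym_mon :> strict_monoidal_category;
  swap : forall a b : sym_mon, hom (a ⊗ b) (b ⊗ a);
  swap_nat : forall (a b a' b' : sym_mon) (f : hom a b) (f' : hom a' b'),
    tenm f f' >> swap b b' = swap a a' >> tenm f' f;
  swapK : forall a b, swap a b >> swap b a = idm (a ⊗ b);
  swap_hexagon : forall a b c,
    swap a (b ⊗ c)
    = eqhom (eq_sym (tenA a b c)) >> tenm (swap a b) (idm c)
      >> eqhom (tenA b a c) >> tenm (idm b) (swap a c)
      >> eqhom (eq_sym (tenA b c a))
}.

Record markov_category := Markov {
  mk_sym :> symmetric_monoidal_category;
  copy : forall a : mk_sym, hom a (a ⊗ a);
  del : forall a : mk_sym, hom a one;
  del_terminal : forall (a : mk_sym) (f : hom a one), f = del a;
  copy_coassoc : forall a,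
    copy a >> tenm (copy a) (idm a) >> eqhom (tenA a a a)
    = copy a >> tenm (idm a) (copy a);
  copy_del : forall a, copy a >> tenm (del a) (idm a) >> eqhom (ten1l a) = idm a;
  copy_swap : forall a, copy a >> swap a a = copy a;
  copy_one : copy one = eqhom (eq_sym (ten1l one));
  copy_ten : forall a b,
    copy (a ⊗ b)
    = tenm (copy a) (copy b) >> eqhom (ten_mid4 a a b b)
      >> tenm (idm a) (tenm (swap a b) (idm b))
      >> eqhom (eq_sym (ten_mid4 a b a b))
}.

Definition deterministic {C : markov_category} {a b : C} (f : hom a b) : Prop :=
  f >> copy b = copy a >> tenm f f.

(** * String-diagram calculus on lists of wires *)

(* [mor [a1; ..; am] [b1; ..; bn]] is the type of morphisms
   a1 ⊗ .. ⊗ am -> b1 ⊗ .. ⊗ bn; on explicit lists concatenation computes,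
   so that no associativity has to be inserted by hand. *)
Fixpoint tens {C : strict_monoidal_category} (l : list C) : C :=
  match l with
  | [] => one
  | a :: l' => match l' with [] => a | _ :: _ => a ⊗ tens l' end
  end.

Section Wires.
Context {C : markov_category}.
Implicit Types (a : C) (l m : list C).

Lemma tens_cons a l : tens (a :: l) = a ⊗ tens l.
Proof. destruct l; simpl; [now rewrite ten1r | reflexivity]. Qed.

Lemma tens_app l l' : tens (l ++ l') = tens l ⊗ tens l'.
Proof.
induction l as [|a l IH].
- simpl; now rewrite ten1l.
- change ((a :: l) ++ l') with (a :: (l ++ l')).
  now rewrite !tens_cons, IH, tenA.
Qed.

Lemma tens_concat (ll : list (list C)) : tens (concat ll) = tens (map tens ll).
Proof.
induction ll as [|l ll IH]; [reflexivity|].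
change (tens (l ++ concat ll) = tens (tens l :: map tens ll)).
now rewrite tens_app, tens_cons, IH.
Qed.

Definition mor l m : Type := hom (tens l) (tens m).

Definition mcomp {l m n} (f : mor l m) (g : mor m n) : mor l n := f >> g.

Definition idw l : mor l l := idm (tens l).

Definition par {l l' m m'} (f : mor l m) (g : mor l' m') : mor (l ++ l') (m ++ m') :=
  eqhom (tens_app l l') >> tenm f g >> eqhom (eq_sym (tens_app m m')).

Fixpoint proj l (i : nat) : mor l [nth i l one] :=
  match l return mor l [nth i l one] with
  | [] => match i return mor [] [nth i [] one] with
          | 0 | S _ => idw []
          end
  | a :: l' => match i return mor (a :: l') [nth i (a :: l') one] with
               | 0 => @par [a] l' [a] [] (idw [a]) (del (tens l'))
               | S j => @par [a] l' [] [nth j l' one] (del a) (proj l' j)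
               end
  end.

(* The structural morphism (made of copies, deletions and symmetries) whose
   i-th output wire is the input wire number [nth i js]. *)
Fixpoint wire l (js : list nat) : mor l (map (fun j => nth j l one) js) :=
  match js return mor l (map (fun j => nth j l one) js) with
  | [] => del (tens l)
  | j :: js' =>
      @mcomp l (l ++ l) ([nth j l one] ++ map (fun j => nth j l one) js')
        (copy (tens l) >> eqhom (eq_sym (tens_app l l)))
        (par (proj l j) (wire l js'))
  end.

(* Regard consecutive wires as a single wire, and conversely. *)
Definition group (ll : list (list C)) : mor (concat ll) (map tens ll) :=
  eqhom (tens_concat ll).

Definition ungroup (ll : list (list C)) : mor (map tens ll) (concat ll) :=
  eqhom (eq_sym (tens_concat ll)).

End Wires.

Notation "f ;; g" := (mcomp f g) (at level 50, left associativity) : hom_scope.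
Notation "f ⊠ g" := (par f g) (at level 40, left associativity) : hom_scope.

(** * Conditionals and conditional products *)

Section Conditionals.
Context {C : markov_category}.

Definition is_conditional {A X Y : C} (phi : mor [A] [X; Y]) (k : mor [A; X] [Y]) : Prop :=
  phi = wire [A] [0; 0] ;; (idw [A] ⊠ (phi ;; wire [X; Y] [0]))
        ;; wire [A; X] [1; 0; 1] ;; (idw [X] ⊠ k).

Definition cond_product_of {A X Y Z : C} (h : mor [A] [Y])
    (kf : mor [A; Y] [X]) (kg : mor [A; Y] [Z]) : mor [A] [X; Y; Z] :=
  wire [A] [0; 0] ;; (idw [A] ⊠ h)
  ;; wire [A; Y] [0; 1; 1; 0; 1] ;; (kf ⊠ idw [Y] ⊠ kg).

(* [p] is the conditional product of [f] and [g] over [Y], whichever the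
   conditionals of [f] and [g] used to compute it. *)
Definition is_cond_product {A X Y Z : C} (f : mor [A] [X; Y]) (g : mor [A] [Y; Z])
    (p : mor [A] [X; Y; Z]) : Prop :=
  f ;; wire [X; Y] [1] = g ;; wire [Y; Z] [0] /\
  forall (kf : mor [A; Y] [X]) (kg : mor [A; Y] [Z]),
    is_conditional (f ;; wire [X; Y] [1; 0]) kf ->
    is_conditional g kg ->
    p = cond_product_of (f ;; wire [X; Y] [1]) kf kg.

End Conditionals.

Definition has_conditionals (C : markov_category) : Prop :=
  forall (A X Y : C) (phi : mor [A] [X; Y]),
    exists k : mor [A; X] [Y], is_conditional phi k.

(** * Categories and semicategories in single-sorted form *)

(* A composition takes a proof of composability; equations between composites
   are required for all such proofs, so that no transport is needed. *)
Record semicat_on {O M : Type} (s t : M -> O) := Semicat {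
  scomp : forall f g, t f = s g -> M;
  s_scomp : forall f g p, s (@scomp f g p) = s f;
  t_scomp : forall f g p, t (@scomp f g p) = t g;
  scompA : forall f g h p q p' q',
    @scomp (@scomp f g p) h p' = @scomp f (@scomp g h q) q'
}.

Arguments scomp {O M s t} K f g p : rename.

Record cat_on {O M : Type} (s t : M -> O) := Cat {
  cat_semi :> semicat_on s t;
  cid : O -> M;
  s_cid : forall a, s (cid a) = a;
  t_cid : forall a, t (cid a) = a;
  cid_l : forall f p, scomp cat_semi (cid (s f)) f p = f;
  cid_r : forall f p, scomp cat_semi f (cid (t f)) p = f
}.
Arguments cid {O M s t} K a : rename.

(** * Semi triple categories *)

(* A double structure with objects [O], arrows [A] in direction 1, arrows [B] in
   direction 2 and squares [S]; [s1, t1 : S -> B] and [s2, t2 : S -> A] are the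
   faces of squares in the two directions. Direction 1 has no identities:
   the laws say that (direction 2) is a category strictly internal to
   semicategories (direction 1). *)
Record semi_double_laws {O A B S : Type} {sA tA : A -> O} {sB tB : B -> O}
    {s1 t1 : S -> B} {s2 t2 : S -> A}
    (KA : semicat_on sA tA) (KS1 : semicat_on s1 t1)
    (KB : cat_on sB tB) (KS2 : cat_on s2 t2) : Prop := SemiDouble {
  corner_ss : forall q, sA (s2 q) = sB (s1 q);
  corner_ts : forall q, tA (s2 q) = sB (t1 q);
  corner_st : forall q, sA (t2 q) = tB (s1 q);
  corner_tt : forall q, tA (t2 q) = tB (t1 q);
  s2_scomp : forall q r p p', s2 (scomp KS1 q r p) = scomp KA (s2 q) (s2 r) p';
  t2_scomp : forall q r p p', t2 (scomp KS1 q r p) = scomp KA (t2 q) (t2 r) p';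
  s1_scomp : forall q r p p', s1 (scomp KS2 q r p) = scomp KB (s1 q) (s1 r) p';
  t1_scomp : forall q r p p', t1 (scomp KS2 q r p) = scomp KB (t1 q) (t1 r) p';
  s1_cid : forall f, s1 (cid KS2 f) = cid KB (sA f);
  t1_cid : forall f, t1 (cid KS2 f) = cid KB (tA f);
  cid2_scomp : forall f g p p',
    cid KS2 (scomp KA f g p) = scomp KS1 (cid KS2 f) (cid KS2 g) p';
  interchange : forall q r q' r' p p' v v' u u',
    scomp KS2 (scomp KS1 q r p) (scomp KS1 q' r' p') u
    = scomp KS1 (scomp KS2 q q' v) (scomp KS2 r r' v') u'
}.

Record double_laws {O A B S : Type} {sA tA : A -> O} {sB tB : B -> O}
    {s1 t1 : S -> B} {s2 t2 : S -> A}
    (KA : cat_on sA tA) (KS1 : cat_on s1 t1)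
    (KB : cat_on sB tB) (KS2 : cat_on s2 t2) : Prop := Double {
  double_semi :> semi_double_laws KA KS1 KB KS2;
  s2_cid : forall b, s2 (cid KS1 b) = cid KA (sB b);
  t2_cid : forall b, t2 (cid KS1 b) = cid KA (tB b);
  cid1_scomp : forall f g p p',
    cid KS1 (scomp KB f g p) = scomp KS2 (cid KS1 f) (cid KS1 g) p';
  cid_cid : forall a, cid KS1 (cid KB a) = cid KS2 (cid KA a)
}.

(* Face maps: [xs..]/[xt..] are the source and target in the direction x, etc. *)
Record square_cells := SquareCells {
  Ob : Type;
  X : Type;  xsX : X -> Ob;  xtX : X -> Ob;
  Y : Type;  ysY : Y -> Ob;  ytY : Y -> Ob;
  Z : Type;  zsZ : Z -> Ob;  ztZ : Z -> Ob;
  XY : Type;  xsXY : XY -> Y;  xtXY : XY -> Y;  ysXY : XY -> X;  ytXY : XY -> X;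
  XZ : Type;  xsXZ : XZ -> Z;  xtXZ : XZ -> Z;  zsXZ : XZ -> X;  ztXZ : XZ -> X;
  YZ : Type;  ysYZ : YZ -> Z;  ytYZ : YZ -> Z;  zsYZ : YZ -> Y;  ztYZ : YZ -> Y
}.

Record cube_boundary (G : square_cells) := CubeBoundary {
  bxs : YZ G;  bxt : YZ G;
  bys : XZ G;  byt : XZ G;
  bzs : XY G;  bzt : XY G;
  edge_z_ss : xsXZ bys = ysYZ bxs;
  edge_z_st : xsXZ byt = ytYZ bxs;
  edge_z_ts : xtXZ bys = ysYZ bxt;
  edge_z_tt : xtXZ byt = ytYZ bxt;
  edge_y_ss : xsXY bzs = zsYZ bxs;
  edge_y_st : xsXY bzt = ztYZ bxs;
  edge_y_ts : xtXY bzs = zsYZ bxt;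
  edge_y_tt : xtXY bzt = ztYZ bxt;
  edge_x_ss : ysXY bzs = zsXZ bys;
  edge_x_st : ysXY bzt = ztXZ bys;
  edge_x_ts : ytXY bzs = zsXZ byt;
  edge_x_tt : ytXY bzt = ztXZ byt
}.

Record cube_cells := CubeCells {
  sqc :> square_cells;
  XYZ : Type;
  xsC : XYZ -> YZ sqc;  xtC : XYZ -> YZ sqc;
  ysC : XYZ -> XZ sqc;  ytC : XYZ -> XZ sqc;
  zsC : XYZ -> XY sqc;  ztC : XYZ -> XY sqc
}.

(* A category (direction z) strictly internal to x-semi double categories,
   unfolded: [dXY] and [dXY_Z] are the x-semi double categories of objects and
   of arrows of the internal category, the other fields express that
   z-composition, z-identities, and z-faces are x-semi double functors. *)
Record x_semi_triple (G : cube_cells) := XSemiTriple {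
  kX : semicat_on (@xsX G) (@xtX G);
  kXYx : semicat_on (@xsXY G) (@xtXY G);
  kXZx : semicat_on (@xsXZ G) (@xtXZ G);
  kCx : semicat_on (@xsC G) (@xtC G);
  kY : cat_on (@ysY G) (@ytY G);
  kXYy : cat_on (@ysXY G) (@ytXY G);
  kYZy : cat_on (@ysYZ G) (@ytYZ G);
  kCy : cat_on (@ysC G) (@ytC G);
  kZ : cat_on (@zsZ G) (@ztZ G);
  kXZz : cat_on (@zsXZ G) (@ztXZ G);
  kYZz : cat_on (@zsYZ G) (@ztYZ G);
  kCz : cat_on (@zsC G) (@ztC G);
  dXY : semi_double_laws kX kXYx kY kXYy;
  dXZ : semi_double_laws kX kXZx kZ kXZz;
  dYZ : double_laws kY kYZy kZ kYZz;
  dXY_Z : semi_double_laws kXZx kCx kYZy kCy;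
  dXZ_Y : semi_double_laws kXYx kCx kYZz kCz;
  dYZ_X : double_laws kXYy kCy kXZz kCz
}.

(** * Symmetric monoidal structure *)

(* Strict symmetric monoidal structure on a category, with tensor products
   [pt0] of objects and [pt1] of morphisms. *)
Record permutative {O M : Type} {s t : M -> O} (K : cat_on s t) := Permutative {
  pt0 : O -> O -> O;
  pt1 : M -> M -> M;
  pu : O;
  s_pt1 : forall f g, s (pt1 f g) = pt0 (s f) (s g);
  t_pt1 : forall f g, t (pt1 f g) = pt0 (t f) (t g);
  pt1_scomp : forall f g f' g' p p' p'',
    pt1 (scomp K f g p) (scomp K f' g' p') = scomp K (pt1 f f') (pt1 g g') p'';
  pt1_cid : forall a b, pt1 (cid K a) (cid K b) = cid K (pt0 a b);
  pt0A : forall a b c, pt0 (pt0 a b) c = pt0 a (pt0 b c);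
  pt1A : forall f g h, pt1 (pt1 f g) h = pt1 f (pt1 g h);
  pt0_ul : forall a, pt0 pu a = a;
  pt0_ur : forall a, pt0 a pu = a;
  pt1_ul : forall f, pt1 (cid K pu) f = f;
  pt1_ur : forall f, pt1 f (cid K pu) = f;
  psw : O -> O -> M;
  s_psw : forall a b, s (psw a b) = pt0 a b;
  t_psw : forall a b, t (psw a b) = pt0 b a;
  psw_nat : forall f g p p',
    scomp K (pt1 f g) (psw (t f) (t g)) p = scomp K (psw (s f) (s g)) (pt1 g f) p';
  pswK : forall a b p, scomp K (psw a b) (psw b a) p = cid K (pt0 a b);
  psw_hexagon : forall a b c p,
    psw a (pt0 b c)
    = scomp K (pt1 (psw a b) (cid K c)) (pt1 (cid K b) (psw a c)) p
}.

Record strict_symmetric {O M O' M' : Type} {s t : M -> O} {s' t' : M' -> O'}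
    {K : cat_on s t} {K' : cat_on s' t'} (P : permutative K) (P' : permutative K')
    (F0 : O -> O') (F1 : M -> M') : Prop := StrictSymmetric {
  F0_pt0 : forall a b, F0 (pt0 P a b) = pt0 P' (F0 a) (F0 b);
  F1_pt1 : forall f g, F1 (pt1 P f g) = pt1 P' (F1 f) (F1 g);
  F0_pu : F0 (pu P) = pu P';
  F1_psw : forall a b, F1 (psw P a b) = psw P' (F0 a) (F0 b)
}.

(* Composition in one direction ([KA] on arrows [A], [KS] on squares [S])
   is a strict symmetric monoidal functor. *)
Record strict_composition {O A B S : Type} {sA tA : A -> O} {s1 t1 : S -> B}
    {s2 t2 : S -> A} (KA : semicat_on sA tA) (KS : semicat_on s1 t1)
    {Kz : cat_on s2 t2} (P : permutative Kz) : Prop := StrictComposition {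
  scomp_pt0 : forall f g f' g' p p' p'',
    pt0 P (scomp KA f g p) (scomp KA f' g' p')
    = scomp KA (pt0 P f f') (pt0 P g g') p'';
  scomp_pt1 : forall f g f' g' p p' p'',
    pt1 P (scomp KS f g p) (scomp KS f' g' p')
    = scomp KS (pt1 P f f') (pt1 P g g') p'';
  scomp_psw : forall f g f' g' p p' p'',
    psw P (scomp KA f g p) (scomp KA f' g' p')
    = scomp KS (psw P f f') (psw P g g') p''
}.

(* Composition in one direction is a strong symmetric monoidal functor,
   strictly compatible with units; the comparison isomorphisms [mu] go from
   (f ⊗ f') ; (g ⊗ g') to (f ; g) ⊗ (f' ; g') and are identities on the two
   ends. *)
Record strong_composition {O A B S : Type} {sA tA : A -> O} {sB tB : B -> O}
    {s1 t1 : S -> B} {s2 t2 : S -> A} (KA : semicat_on sA tA)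
    (KS : semicat_on s1 t1) {KO : cat_on sB tB} {Kz : cat_on s2 t2}
    (PO : permutative KO) (P : permutative Kz) := StrongComposition {
  mu : forall f g f' g', tA f = sA g -> tA f' = sA g' -> S;
  s_mu : forall f g f' g' p p' q,
    s2 (@mu f g f' g' p p') = scomp KA (pt0 P f f') (pt0 P g g') q;
  t_mu : forall f g f' g' p p',
    t2 (@mu f g f' g' p p') = pt0 P (scomp KA f g p) (scomp KA f' g' p');
  s1_mu : forall f g f' g' p p',
    s1 (@mu f g f' g' p p') = cid KO (pt0 PO (sA f) (sA f'));
  t1_mu : forall f g f' g' p p',
    t1 (@mu f g f' g' p p') = cid KO (pt0 PO (tA g) (tA g'));
  mu_iso : forall f g f' g' p p', exists nu q q',
    scomp Kz (@mu f g f' g' p p') nu q = cid Kz (s2 (@mu f g f' g' p p')) /\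
    scomp Kz nu (@mu f g f' g' p p') q' = cid Kz (t2 (@mu f g f' g' p p'));
  mu_nat : forall (a b a' b' : S) p p' q r r' w w' u u',
    scomp Kz (scomp KS (pt1 P a a') (pt1 P b b') q)
             (@mu (t2 a) (t2 b) (t2 a') (t2 b') w w') u
    = scomp Kz (@mu (s2 a) (s2 b) (s2 a') (s2 b') r r')
               (pt1 P (scomp KS a b p) (scomp KS a' b' p')) u';
  mu_scomp : forall f g h f' g' h' p q p' q' l l' r r' v w u u',
    scomp Kz (scomp KS (@mu f g f' g' p p') (cid Kz (pt0 P h h')) v)
             (@mu (scomp KA f g p) h (scomp KA f' g' p') h' l l') u
    = scomp Kz (scomp KS (cid Kz (pt0 P f f')) (@mu g h g' h' q q') w)
               (@mu f (scomp KA g h q) f' (scomp KA g' h' q') r r') u';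
  mu_pt0 : forall f g f' g' f'' g'' p p' p'' l r u u',
    scomp Kz (@mu (pt0 P f f') (pt0 P g g') f'' g'' l p'')
             (pt1 P (@mu f g f' g' p p') (cid Kz (scomp KA f'' g'' p''))) u
    = scomp Kz (@mu f g (pt0 P f' f'') (pt0 P g' g'') p r)
               (pt1 P (cid Kz (scomp KA f g p)) (@mu f' g' f'' g'' p' p'')) u';
  scomp_pu : forall p, scomp KA (pu P) (pu P) p = pu P;
  mu_ul : forall f g p q, @mu (pu P) (pu P) f g p q = cid Kz (scomp KA f g q);
  mu_ur : forall f g p q, @mu f g (pu P) (pu P) p q = cid Kz (scomp KA f g p);
  mu_psw : forall f g f' g' p p' v u u',
    scomp Kz (@mu f g f' g' p p') (psw P (scomp KA f g p) (scomp KA f' g' p')) u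
    = scomp Kz (scomp KS (psw P f f') (psw P g g') v) (@mu f' g' f g p' p) u'
}.
Arguments mu {O A B S sA tA sB tB s1 t1 s2 t2 KA KS KO Kz PO P} c f g f' g' p p'
  : rename.

(* A symmetric monoidal x-semi triple category: as in the usual notion of
   symmetric monoidal double category, the four categories formed by the
   z-direction are symmetric monoidal (strictly associative and unital here), all
   faces, y-identities and y-compositions are strict symmetric monoidal functors,
   and x-composition is strong symmetric monoidal.
   Strictness is not available for x-composition of arenas: the parameters of
   (f ⊗ f') ; (g ⊗ g') are those of (f ; g) ⊗ (f' ; g') in another order. *)
Record symmetric_monoidal (G : cube_cells) (T : x_semi_triple G) := SymMonTriple {
  pOb : permutative (kZ T);
  pX : permutative (kXZz T);
  pY : permutative (kYZz T);
  pXY : permutative (kCz T);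
  xsX_sm : strict_symmetric pX pOb (@xsX G) (@xsXZ G);
  xtX_sm : strict_symmetric pX pOb (@xtX G) (@xtXZ G);
  ysY_sm : strict_symmetric pY pOb (@ysY G) (@ysYZ G);
  ytY_sm : strict_symmetric pY pOb (@ytY G) (@ytYZ G);
  xsXY_sm : strict_symmetric pXY pY (@xsXY G) (@xsC G);
  xtXY_sm : strict_symmetric pXY pY (@xtXY G) (@xtC G);
  ysXY_sm : strict_symmetric pXY pX (@ysXY G) (@ysC G);
  ytXY_sm : strict_symmetric pXY pX (@ytXY G) (@ytC G);
  idY_sm : strict_symmetric pOb pY (cid (kY T)) (cid (kYZy T));
  idXY_sm : strict_symmetric pX pXY (cid (kXYy T)) (cid (kCy T));
  compY_sm : strict_composition (kY T) (kYZy T) pY;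
  compXY_sm : strict_composition (kXYy T) (kCy T) pXY;
  muX : strong_composition (kX T) (kXZx T) pOb pX;
  muXY : strong_composition (kXYx T) (kCx T) pY pXY;
  ys_muXY : forall q r q' r' p p' v v',
    ysC (mu muXY q r q' r' p p') = mu muX (ysXY q) (ysXY r) (ysXY q') (ysXY r') v v';
  yt_muXY : forall q r q' r' p p' v v',
    ytC (mu muXY q r q' r' p p') = mu muX (ytXY q) (ytXY r) (ytXY q') (ytXY r') v v';
  muXY_cid : forall f g f' g' p p' v v',
    mu muXY (cid (kXYy T) f) (cid (kXYy T) g) (cid (kXYy T) f') (cid (kXYy T) g') v v'
    = cid (kCy T) (mu muX f g f' g' p p');
  muXY_scomp : forall a b a' b' c d c' d' p q p' q' ac bd ac' bd' v v' u,
    mu muXY (scomp (kXYy T) a c ac) (scomp (kXYy T) b d bd)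
            (scomp (kXYy T) a' c' ac') (scomp (kXYy T) b' d' bd') v v'
    = scomp (kCy T) (mu muXY a b a' b' p p') (mu muXY c d c' d' q q') u
}.

(** * Moore arenas: cells *)

Section Arena.
Context {C : markov_category}.

Record arob := Arob { ar_a : C; ar_c : C }.
Implicit Types o : arob.

Definition oten o o' : arob :=
  Arob (tens [ar_a o; ar_a o']) (tens [ar_c o; ar_c o']).

Record xdata o1 o2 := XData {
  xpar : arob;
  xf : mor [ar_c o1] [ar_c xpar; ar_c o2];
  xfb : mor [ar_c o1; ar_a o1] [ar_c xpar; ar_c o2; ar_a xpar; ar_a o2]
}.

Definition xlaw o1 o2 (d : xdata o1 o2) : Prop :=
  xfb d ;; wire [ar_c (xpar d); ar_c o2; ar_a (xpar d); ar_a o2] [0; 1]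
  = wire [ar_c o1; ar_a o1] [0] ;; xf d.

Record ydata o1 o2 := YData {
  yf : mor [ar_c o1] [ar_c o2];
  ysh : mor [ar_c o1; ar_a o2] [ar_a o1]
}.

Definition ylaw o1 o2 (l : ydata o1 o2) : Prop :=
  deterministic (yf l) /\ deterministic (ysh l).

Record zdata o1 o2 := ZData {
  zf : mor [ar_c o1] [ar_c o2];
  zg : mor [ar_a o1] [ar_a o2]
}.

Definition zlaw o1 o2 (z : zdata o1 o2) : Prop :=
  deterministic (zf z) /\ deterministic (zg z).

Record xydata o1 o2 o3 o4 (d12 : xdata o1 o2) (d34 : xdata o3 o4)
    (l13 : ydata o1 o3) (l24 : ydata o2 o4) := XYData {
  xyy : ydata (xpar d12) (xpar d34);
  xys : mor [ar_c o1; ar_a o3]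
            [ar_c (xpar d12); ar_c o2; ar_a (xpar d34); ar_a o4]
}.

Definition xylaw o1 o2 o3 o4 (d12 : xdata o1 o2) (d34 : xdata o3 o4)
    (l13 : ydata o1 o3) (l24 : ydata o2 o4) (q : xydata d12 d34 l13 l24) : Prop :=
  let c1 := ar_c o1 in let c2 := ar_c o2 in
  let a3 := ar_a o3 in let a4 := ar_a o4 in
  let c12 := ar_c (xpar d12) in let a34 := ar_a (xpar d34) in
  ylaw (xyy q) /\
  xf d12 ;; (yf (xyy q) ⊠ yf l24) = yf l13 ;; xf d34 /\
  xys q ;; (yf (xyy q) ⊠ yf l24 ⊠ idw [a34; a4])
    = (yf l13 ⊠ idw [a3]) ;; xfb d34 /\
  wire [c1; a3] [0; 0; 1] ;; (idw [c1] ⊠ ysh l13) ;; xfb d12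
    = xys q ;; wire [c12; c2; a34; a4] [0; 1; 0; 2; 1; 3]
      ;; (idw [c12; c2] ⊠ ysh (xyy q) ⊠ ysh l24).

Definition yzlaw o1 o2 o3 o4 (l13 : ydata o1 o3) (l24 : ydata o2 o4)
    (z12 : zdata o1 o2) (z34 : zdata o3 o4) : Prop :=
  yf l13 ;; zf z34 = zf z12 ;; yf l24.

(* The two components f1234 and g1234 of an xz-square form a z-morphism
   between the parameter objects. *)
Definition xzlaw o1 o2 o3 o4 (d12 : xdata o1 o2) (d34 : xdata o3 o4)
    (z13 : zdata o1 o3) (z24 : zdata o2 o4) (z : zdata (xpar d12) (xpar d34)) : Prop :=
  zlaw z /\
  xf d12 ;; (zf z ⊠ zf z24) = zf z13 ;; xf d34 /\
  xfb d12 ;; (zf z ⊠ zf z24 ⊠ zg z ⊠ zg z24) = (zf z13 ⊠ zg z13) ;; xfb d34.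

Record ArX := MkX { X_s : arob; X_t : arob; X_d : xdata X_s X_t; X_ok : xlaw X_d }.
Record ArY := MkY { Y_s : arob; Y_t : arob; Y_d : ydata Y_s Y_t; Y_ok : ylaw Y_d }.
Record ArZ := MkZ { Z_s : arob; Z_t : arob; Z_d : zdata Z_s Z_t; Z_ok : zlaw Z_d }.

Record ArXY := MkXY {
  XY_1 : arob;  XY_2 : arob;  XY_3 : arob;  XY_4 : arob;
  XY_top : xdata XY_1 XY_2;   XY_top_ok : xlaw XY_top;
  XY_bot : xdata XY_3 XY_4;   XY_bot_ok : xlaw XY_bot;
  XY_left : ydata XY_1 XY_3;  XY_left_ok : ylaw XY_left;
  XY_right : ydata XY_2 XY_4; XY_right_ok : ylaw XY_right;
  XY_d : xydata XY_top XY_bot XY_left XY_right;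
  XY_ok : xylaw XY_d
}.

Record ArXZ := MkXZ {
  XZ_1 : arob;  XZ_2 : arob;  XZ_3 : arob;  XZ_4 : arob;
  XZ_top : xdata XZ_1 XZ_2;   XZ_top_ok : xlaw XZ_top;
  XZ_bot : xdata XZ_3 XZ_4;   XZ_bot_ok : xlaw XZ_bot;
  XZ_left : zdata XZ_1 XZ_3;  XZ_left_ok : zlaw XZ_left;
  XZ_right : zdata XZ_2 XZ_4; XZ_right_ok : zlaw XZ_right;
  XZ_d : zdata (xpar XZ_top) (xpar XZ_bot);
  XZ_ok : xzlaw XZ_left XZ_right XZ_d
}.

Record ArYZ := MkYZ {
  YZ_1 : arob;  YZ_2 : arob;  YZ_3 : arob;  YZ_4 : arob;
  YZ_left : ydata YZ_1 YZ_3;  YZ_left_ok : ylaw YZ_left;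
  YZ_right : ydata YZ_2 YZ_4; YZ_right_ok : ylaw YZ_right;
  YZ_top : zdata YZ_1 YZ_2;   YZ_top_ok : zlaw YZ_top;
  YZ_bot : zdata YZ_3 YZ_4;   YZ_bot_ok : zlaw YZ_bot;
  YZ_ok : yzlaw YZ_left YZ_right YZ_top YZ_bot
}.

Definition arena_squares : square_cells := {|
  Ob := arob;
  X := ArX;  xsX := X_s;  xtX := X_t;
  Y := ArY;  ysY := Y_s;  ytY := Y_t;
  Z := ArZ;  zsZ := Z_s;  ztZ := Z_t;
  XY := ArXY;
  xsXY := fun q => MkY (XY_left_ok q);  xtXY := fun q => MkY (XY_right_ok q);
  ysXY := fun q => MkX (XY_top_ok q);   ytXY := fun q => MkX (XY_bot_ok q);
  XZ := ArXZ;
  xsXZ := fun q => MkZ (XZ_left_ok q);  xtXZ := fun q => MkZ (XZ_right_ok q);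
  zsXZ := fun q => MkX (XZ_top_ok q);   ztXZ := fun q => MkX (XZ_bot_ok q);
  YZ := ArYZ;
  ysYZ := fun q => MkZ (YZ_top_ok q);   ytYZ := fun q => MkZ (YZ_bot_ok q);
  zsYZ := fun q => MkY (YZ_left_ok q);  ztYZ := fun q => MkY (YZ_right_ok q)
|}.

(* There is exactly one cube for each boundary. *)
Definition arena_cells : cube_cells := {|
  sqc := arena_squares;
  XYZ := cube_boundary arena_squares;
  xsC := @bxs _;  xtC := @bxt _;
  ysC := @bys _;  ytC := @byt _;
  zsC := @bzs _;  ztC := @bzt _
|}.

(** * Moore arenas: compositions *)

Definition zcomp o1 o2 o3 (z : zdata o1 o2) (w : zdata o2 o3) : zdata o1 o3 :=
  ZData (zf z ;; zf w) (zg z ;; zg w).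

Definition zten o1 o2 o1' o2' (z : zdata o1 o2) (z' : zdata o1' o2') :
    zdata (oten o1 o1') (oten o2 o2') :=
  @ZData (oten o1 o1') (oten o2 o2')
    (ungroup [[ar_c o1; ar_c o1']] ;; (zf z ⊠ zf z') ;; group [[ar_c o2; ar_c o2']])
    (ungroup [[ar_a o1; ar_a o1']] ;; (zg z ⊠ zg z') ;; group [[ar_a o2; ar_a o2']]).

Definition ycomp o1 o2 o3 (l : ydata o1 o2) (m : ydata o2 o3) : ydata o1 o3 :=
  let c1 := ar_c o1 in let a3 := ar_a o3 in
  YData (yf l ;; yf m)
    (wire [c1; a3] [0; 0; 1] ;; (idw [c1] ⊠ yf l ⊠ idw [a3])
     ;; (idw [c1] ⊠ ysh m) ;; ysh l).

Definition yten o1 o2 o1' o2' (l : ydata o1 o2) (l' : ydata o1' o2') :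
    ydata (oten o1 o1') (oten o2 o2') :=
  let c1 := ar_c o1 in let c1' := ar_c o1' in
  let a1 := ar_a o1 in let a1' := ar_a o1' in
  let c2 := ar_c o2 in let c2' := ar_c o2' in
  let a2 := ar_a o2 in let a2' := ar_a o2' in
  @YData (oten o1 o1') (oten o2 o2')
    (ungroup [[c1; c1']] ;; (yf l ⊠ yf l') ;; group [[c2; c2']])
    (ungroup [[c1; c1']; [a2; a2']] ;; wire [c1; c1'; a2; a2'] [0; 2; 1; 3]
     ;; (ysh l ⊠ ysh l') ;; group [[a1; a1']]).

Definition xcomp o1 o2 o3 (d : xdata o1 o2) (e : xdata o2 o3) : xdata o1 o3 :=
  let c1 := ar_c o1 in let a1 := ar_a o1 in
  let c2 := ar_c o2 in let a2 := ar_a o2 in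
  let c3 := ar_c o3 in let a3 := ar_a o3 in
  let c12 := ar_c (xpar d) in let a12 := ar_a (xpar d) in
  let c23 := ar_c (xpar e) in let a23 := ar_a (xpar e) in
  @XData o1 o3 (Arob (tens [a12; a2; a23]) (tens [c12; c2; c23]))
    (xf d ;; wire [c12; c2] [0; 1; 1] ;; (idw [c12; c2] ⊠ xf e)
     ;; group [[c12; c2; c23]; [c3]])
    (xfb d ;; wire [c12; c2; a12; a2] [0; 1; 2; 3; 1; 3]
     ;; (idw [c12; c2; a12; a2] ⊠ xfb e)
     ;; wire [c12; c2; a12; a2; c23; c3; a23; a3] [0; 1; 4; 5; 2; 3; 6; 7]
     ;; group [[c12; c2; c23]; [c3]; [a12; a2; a23]; [a3]]).

Definition xten o1 o2 o1' o2' (d : xdata o1 o2) (d' : xdata o1' o2') :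
    xdata (oten o1 o1') (oten o2 o2') :=
  let c1 := ar_c o1 in let c1' := ar_c o1' in
  let a1 := ar_a o1 in let a1' := ar_a o1' in
  let c2 := ar_c o2 in let c2' := ar_c o2' in
  let a2 := ar_a o2 in let a2' := ar_a o2' in
  let c12 := ar_c (xpar d) in let c12' := ar_c (xpar d') in
  let a12 := ar_a (xpar d) in let a12' := ar_a (xpar d') in
  @XData (oten o1 o1') (oten o2 o2') (oten (xpar d) (xpar d'))
    (ungroup [[c1; c1']] ;; (xf d ⊠ xf d')
     ;; wire [c12; c2; c12'; c2'] [0; 2; 1; 3]
     ;; group [[c12; c12']; [c2; c2']])
    (ungroup [[c1; c1']; [a1; a1']] ;; wire [c1; c1'; a1; a1'] [0; 2; 1; 3]
     ;; (xfb d ⊠ xfb d')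
     ;; wire [c12; c2; a12; a2; c12'; c2'; a12'; a2'] [0; 4; 1; 5; 2; 6; 3; 7]
     ;; group [[c12; c12']; [c2; c2']; [a12; a12']; [a2; a2']]).

Definition xy_xcomp o1 o2 o3 o4 o5 o6
    (d12 : xdata o1 o2) (d23 : xdata o2 o3) (d45 : xdata o4 o5) (d56 : xdata o5 o6)
    (l14 : ydata o1 o4) (l25 : ydata o2 o5) (l36 : ydata o3 o6)
    (q : xydata d12 d45 l14 l25) (r : xydata d23 d56 l25 l36) :
    xydata (xcomp d12 d23) (xcomp d45 d56) l14 l36 :=
  let c2 := ar_c o2 in let c3 := ar_c o3 in
  let a5 := ar_a o5 in let a6 := ar_a o6 in
  let c12 := ar_c (xpar d12) in let c23 := ar_c (xpar d23) in
  let a45 := ar_a (xpar d45) in let a56 := ar_a (xpar d56) in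
  @XYData _ _ _ _ (xcomp d12 d23) (xcomp d45 d56) l14 l36
    (yten (xyy q) (yten l25 (xyy r)))
    (xys q ;; wire [c12; c2; a45; a5] [0; 1; 2; 3; 1; 3]
     ;; (idw [c12; c2; a45; a5] ⊠ xys r)
     ;; wire [c12; c2; a45; a5; c23; c3; a56; a6] [0; 1; 4; 5; 2; 3; 6; 7]
     ;; group [[c12; c2; c23]; [c3]; [a45; a5; a56]; [a6]]).

Definition xy_ten o1 o2 o3 o4 o1' o2' o3' o4'
    (d12 : xdata o1 o2) (d34 : xdata o3 o4) (l13 : ydata o1 o3) (l24 : ydata o2 o4)
    (d12' : xdata o1' o2') (d34' : xdata o3' o4')
    (l13' : ydata o1' o3') (l24' : ydata o2' o4')
    (q : xydata d12 d34 l13 l24) (q' : xydata d12' d34' l13' l24') :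
    xydata (xten d12 d12') (xten d34 d34') (yten l13 l13') (yten l24 l24') :=
  let c1 := ar_c o1 in let c1' := ar_c o1' in
  let a3 := ar_a o3 in let a3' := ar_a o3' in
  let c2 := ar_c o2 in let c2' := ar_c o2' in
  let a4 := ar_a o4 in let a4' := ar_a o4' in
  let c12 := ar_c (xpar d12) in let c12' := ar_c (xpar d12') in
  let a34 := ar_a (xpar d34) in let a34' := ar_a (xpar d34') in
  @XYData _ _ _ _ (xten d12 d12') (xten d34 d34') (yten l13 l13') (yten l24 l24')
    (yten (xyy q) (xyy q'))
    (ungroup [[c1; c1']; [a3; a3']] ;; wire [c1; c1'; a3; a3'] [0; 2; 1; 3]
     ;; (xys q ⊠ xys q')
     ;; wire [c12; c2; a34; a4; c12'; c2'; a34'; a4'] [0; 4; 1; 5; 2; 6; 3; 7]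
     ;; group [[c12; c12']; [c2; c2']; [a34; a34']; [a4; a4']]).

Section YComposite.
Context {o1 o2 o3 o4 o5 o6 : arob}
  {d12 : xdata o1 o2} {d34 : xdata o3 o4} {d56 : xdata o5 o6}
  {l13 : ydata o1 o3} {l24 : ydata o2 o4} {l35 : ydata o3 o5} {l46 : ydata o4 o6}
  (q : xydata d12 d34 l13 l24) (r : xydata d34 d56 l35 l46).
Let c1 := ar_c o1.  Let c2 := ar_c o2.  Let c4 := ar_c o4.
Let a4 := ar_a o4.  Let a5 := ar_a o5.  Let a6 := ar_a o6.
Let c12 := ar_c (xpar d12).  Let c34 := ar_c (xpar d34).
Let a34 := ar_a (xpar d34).  Let a56 := ar_a (xpar d56).

Definition xy_ycomp_upper :
    mor [tens [c1; a5]] [tens [c12; c2]; tens [c34; c4; a34; a4]] :=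
  ungroup [[c1; a5]] ;; wire [c1; a5] [0; 0; 1]
  ;; (idw [c1] ⊠ yf l13 ⊠ idw [a5]) ;; (idw [c1] ⊠ ysh l35) ;; xys q
  ;; wire [c12; c2; a34; a4] [0; 1; 0; 1; 2; 3]
  ;; (idw [c12; c2] ⊠ yf (xyy q) ⊠ yf l24 ⊠ idw [a34; a4])
  ;; group [[c12; c2]; [c34; c4; a34; a4]].

Definition xy_ycomp_lower :
    mor [tens [c1; a5]] [tens [c34; c4; a34; a4]; tens [a56; a6]] :=
  ungroup [[c1; a5]] ;; (yf l13 ⊠ idw [a5]) ;; xys r
  ;; wire [c34; c4; a56; a6] [0; 1; 0; 2; 1; 3; 2; 3]
  ;; (idw [c34; c4] ⊠ ysh (xyy r) ⊠ ysh l46 ⊠ idw [a56; a6])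
  ;; group [[c34; c4; a34; a4]; [a56; a6]].

Definition is_xy_ycomp (w : xydata d12 d56 (ycomp l13 l35) (ycomp l24 l46)) : Prop :=
  xyy w = ycomp (xyy q) (xyy r) /\
  exists p : mor [tens [c1; a5]]
                 [tens [c12; c2]; tens [c34; c4; a34; a4]; tens [a56; a6]],
    is_cond_product xy_ycomp_upper xy_ycomp_lower p /\
    xys w = group [[c1; a5]] ;; p
            ;; wire [tens [c12; c2]; tens [c34; c4; a34; a4]; tens [a56; a6]] [0; 2]
            ;; ungroup [[c12; c2]; [a56; a6]].
End YComposite.

(** * The structure of the triple category of Moore arenas *)

(* Identities are determined by compositions, and the compositions of yz-squares
   and of cubes by their boundaries. *)
Record arena_compositions (T : x_semi_triple arena_cells) : Prop := {
  compZ_arena : forall o1 o2 o3 (z : zdata o1 o2) (w : zdata o2 o3) hz hw p,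
    exists h, scomp (kZ T) (MkZ (Z_d := z) hz) (MkZ (Z_d := w) hw) p
              = MkZ (Z_d := zcomp z w) h;
  compY_arena : forall o1 o2 o3 (l : ydata o1 o2) (m : ydata o2 o3) hl hm p,
    exists h, scomp (kY T) (MkY (Y_d := l) hl) (MkY (Y_d := m) hm) p
              = MkY (Y_d := ycomp l m) h;
  compX_arena : forall o1 o2 o3 (d : xdata o1 o2) (e : xdata o2 o3) hd he p,
    exists h, scomp (kX T) (MkX (X_d := d) hd) (MkX (X_d := e) he) p
              = MkX (X_d := xcomp d e) h;
  compXYx_arena : forall o1 o2 o3 o4 o5 o6
      (d12 : xdata o1 o2) (d23 : xdata o2 o3) (d45 : xdata o4 o5) (d56 : xdata o5 o6)
      (l14 : ydata o1 o4) (l25 : ydata o2 o5) (l36 : ydata o3 o6)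
      h12 h23 h45 h56 h14 h25 h25' h36
      (q : xydata d12 d45 l14 l25) (r : xydata d23 d56 l25 l36) hq hr p,
    exists h13 h46 h,
      scomp (kXYx T) (@MkXY _ _ _ _ d12 h12 d45 h45 l14 h14 l25 h25 q hq)
                     (@MkXY _ _ _ _ d23 h23 d56 h56 l25 h25' l36 h36 r hr) p
      = @MkXY _ _ _ _ (xcomp d12 d23) h13 (xcomp d45 d56) h46 l14 h14 l36 h36
          (xy_xcomp q r) h;
  compXYy_arena : forall o1 o2 o3 o4 o5 o6
      (d12 : xdata o1 o2) (d34 : xdata o3 o4) (d56 : xdata o5 o6)
      (l13 : ydata o1 o3) (l24 : ydata o2 o4) (l35 : ydata o3 o5) (l46 : ydata o4 o6)
      h12 h34 h34' h56 h13 h24 h35 h46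
      (q : xydata d12 d34 l13 l24) (r : xydata d34 d56 l35 l46) hq hr p,
    exists h15 h26 w h,
      is_xy_ycomp q r w /\
      scomp (kXYy T) (@MkXY _ _ _ _ d12 h12 d34 h34 l13 h13 l24 h24 q hq)
                     (@MkXY _ _ _ _ d34 h34' d56 h56 l35 h35 l46 h46 r hr) p
      = @MkXY _ _ _ _ d12 h12 d56 h56 (ycomp l13 l35) h15 (ycomp l24 l46) h26 w h;
  compXZx_arena : forall o1 o2 o3 o4 o5 o6
      (d12 : xdata o1 o2) (d23 : xdata o2 o3) (d45 : xdata o4 o5) (d56 : xdata o5 o6)
      (z14 : zdata o1 o4) (z25 : zdata o2 o5) (z36 : zdata o3 o6)
      h12 h23 h45 h56 h14 h25 h25' h36
      (q : zdata (xpar d12) (xpar d45)) (r : zdata (xpar d23) (xpar d56)) hq hr p,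
    exists h13 h46 h,
      scomp (kXZx T) (@MkXZ _ _ _ _ d12 h12 d45 h45 z14 h14 z25 h25 q hq)
                     (@MkXZ _ _ _ _ d23 h23 d56 h56 z25 h25' z36 h36 r hr) p
      = @MkXZ _ _ _ _ (xcomp d12 d23) h13 (xcomp d45 d56) h46 z14 h14 z36 h36
          (zten q (zten z25 r)) h;
  compXZz_arena : forall o1 o2 o3 o4 o5 o6
      (d12 : xdata o1 o2) (d34 : xdata o3 o4) (d56 : xdata o5 o6)
      (z13 : zdata o1 o3) (z24 : zdata o2 o4) (z35 : zdata o3 o5) (z46 : zdata o4 o6)
      h12 h34 h34' h56 h13 h24 h35 h46
      (q : zdata (xpar d12) (xpar d34)) (r : zdata (xpar d34) (xpar d56)) hq hr p,
    exists h15 h26 h,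
      scomp (kXZz T) (@MkXZ _ _ _ _ d12 h12 d34 h34 z13 h13 z24 h24 q hq)
                     (@MkXZ _ _ _ _ d34 h34' d56 h56 z35 h35 z46 h46 r hr) p
      = @MkXZ _ _ _ _ d12 h12 d56 h56 (zcomp z13 z35) h15 (zcomp z24 z46) h26
          (zcomp q r) h
}.

Definition oswap o o' : zdata (oten o o') (oten o' o) :=
  @ZData (oten o o') (oten o' o) (swap (ar_c o) (ar_c o')) (swap (ar_a o) (ar_a o')).

(* (c12 ⊗ c12') ⊗ (c2 ⊗ c2') ⊗ (c23 ⊗ c23') to
   (c12 ⊗ c2 ⊗ c23) ⊗ (c12' ⊗ c2' ⊗ c23'), and likewise for a. *)
Definition shuffle6 (c12 c12' c2 c2' c23 c23' : C) :
    mor [tens [tens [c12; c12']; tens [c2; c2']; tens [c23; c23']]]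
        [tens [tens [c12; c2; c23]; tens [c12'; c2'; c23']]] :=
  ungroup [[tens [c12; c12']; tens [c2; c2']; tens [c23; c23']]]
  ;; ungroup [[c12; c12']; [c2; c2']; [c23; c23']]
  ;; wire [c12; c12'; c2; c2'; c23; c23'] [0; 2; 4; 1; 3; 5]
  ;; group [[c12; c2; c23]; [c12'; c2'; c23']]
  ;; group [[tens [c12; c2; c23]; tens [c12'; c2'; c23']]].

Definition xmu o1 o2 o3 o1' o2' o3' (d : xdata o1 o2) (e : xdata o2 o3)
    (d' : xdata o1' o2') (e' : xdata o2' o3') :
    zdata (xpar (xcomp (xten d d') (xten e e')))
          (xpar (xten (xcomp d e) (xcomp d' e'))) :=
  @ZData (xpar (xcomp (xten d d') (xten e e')))
         (xpar (xten (xcomp d e) (xcomp d' e')))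
    (shuffle6 (ar_c (xpar d)) (ar_c (xpar d')) (ar_c o2) (ar_c o2')
              (ar_c (xpar e)) (ar_c (xpar e')))
    (shuffle6 (ar_a (xpar d)) (ar_a (xpar d')) (ar_a o2) (ar_a o2')
              (ar_a (xpar e)) (ar_a (xpar e'))).

(* The tensor products of yz-squares and of cubes, the symmetries of y-morphisms
   and of xy-squares, and the comparison cubes are determined by their
   boundaries, and the other units by the unit laws. *)
Record arena_tensor (T : x_semi_triple arena_cells) (M : symmetric_monoidal T) : Prop := {
  unit_arena : pu (pOb M) = Arob one one;
  tenOb_arena : forall o o', pt0 (pOb M) o o' = oten o o';
  tenZ_arena : forall o1 o2 o1' o2' (z : zdata o1 o2) (z' : zdata o1' o2') hz hz',
    exists h, pt1 (pOb M) (MkZ (Z_d := z) hz) (MkZ (Z_d := z') hz')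
              = MkZ (Z_d := zten z z') h;
  tenY_arena : forall o1 o2 o1' o2' (l : ydata o1 o2) (l' : ydata o1' o2') hl hl',
    exists h, pt0 (pY M) (MkY (Y_d := l) hl) (MkY (Y_d := l') hl')
              = MkY (Y_d := yten l l') h;
  tenX_arena : forall o1 o2 o1' o2' (d : xdata o1 o2) (d' : xdata o1' o2') hd hd',
    exists h, pt0 (pX M) (MkX (X_d := d) hd) (MkX (X_d := d') hd')
              = MkX (X_d := xten d d') h;
  tenXY_arena : forall q q' : ArXY,
    exists h1 h2 h3 h4 h,
      pt0 (pXY M) q q'
      = @MkXY _ _ _ _ (xten (XY_top q) (XY_top q')) h1
          (xten (XY_bot q) (XY_bot q')) h2
          (yten (XY_left q) (XY_left q')) h3
          (yten (XY_right q) (XY_right q')) h4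
          (xy_ten (XY_d q) (XY_d q')) h;
  tenXZ_arena : forall q q' : ArXZ,
    exists h1 h2 h3 h4 h,
      pt1 (pX M) q q'
      = @MkXZ _ _ _ _ (xten (XZ_top q) (XZ_top q')) h1
          (xten (XZ_bot q) (XZ_bot q')) h2
          (zten (XZ_left q) (XZ_left q')) h3
          (zten (XZ_right q) (XZ_right q')) h4
          (zten (XZ_d q) (XZ_d q')) h;
  swapOb_arena : forall o o',
    exists h, psw (pOb M) o o' = MkZ (Z_d := oswap o o') h;
  swapX_arena : forall o1 o2 o1' o2' (d : xdata o1 o2) (d' : xdata o1' o2') hd hd',
    exists h1 h2 h3 h4 h,
      psw (pX M) (MkX (X_d := d) hd) (MkX (X_d := d') hd')
      = @MkXZ _ _ _ _ (xten d d') h1 (xten d' d) h2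
          (oswap o1 o1') h3 (oswap o2 o2') h4 (oswap (xpar d) (xpar d')) h;
  muX_arena : forall o1 o2 o3 o1' o2' o3' (d : xdata o1 o2) (e : xdata o2 o3)
      (d' : xdata o1' o2') (e' : xdata o2' o3') hd he hd' he' p p',
    exists z13 z24 h1 h2 h3 h4 h,
      mu (muX M) (MkX (X_d := d) hd) (MkX (X_d := e) he)
                 (MkX (X_d := d') hd') (MkX (X_d := e') he') p p'
      = @MkXZ _ _ _ _ (xcomp (xten d d') (xten e e')) h1
          (xten (xcomp d e) (xcomp d' e')) h2 z13 h3 z24 h4 (xmu d e d' e') h
}.

End Arena.
Arguments arob C : clear implicits.
Arguments arena_cells C : clear implicits.

(* Main.v *)
From Stdlib Require Import List Arith Bool Lia ClassicalEpsilon.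
Require Import Defs.
Import ListNotations.

(* Idea. Cubes are boundaries, so that the triple category and its symmetric monoidal
   structure are determined by those of the squares, and the laws to be proved are
   equations between string diagrams. Strictness is an equality of objects: typed
   equations would be full of transports, hence morphisms are compared as arrows
   [Arr f] that carry their domain and codomain. Up to this, a diagram is a program
   drawing variables from its generators, and programs that differ by the order of
   the draws, by unused draws, or by repeated draws from a deterministic generator
   denote the same arrow. The tactic [diagram] decides this by reflection, after
   rewriting with given equations.

   The conditional product of f and g over Y is f followed by a conditional of g, and
   also g followed by a conditional of f, hence it does not depend on the conditionals.
   So the laws of the y-composition of xy-squares can be checked with well chosen
   conditionals: those of a composite square are built from those of its factors by
   precomposition with the deterministic lenses (associativity), by composing them
   stage by stage along x (interchange), or by tensoring them. *)

Set Implicit Arguments.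
Unset Strict Implicit.
Unset Printing Implicit Defensive.
Local Open Scope hom_scope.

(** * Cubes determined by their boundaries *)

(** Nothing singles out the y-composite of xy-squares by a formula: [is_xy_ycomp] quantifies over
    all conditionals, and the composite is extracted by a choice axiom from an existence statement.
    Every law about it therefore starts from the fact that this relation is functional, so that one
    pair of conditionals may be prescribed for each composite in the law. Prescribing them
    compatibly is the real work: a conditional may depend on all the inputs of its square, while the
    neighbouring composite has only some of these wires at hand. In the interchange law, equations
    (b) and (c) of squares show that the missing wires matter only through wires of the middle row.
    In these computations the equation of a conditional is used in both directions. Right to left it
    restores a joint morphism, where wires computed by a lens are seen to equal wires already drawn;
    left to right it splits the joint morphism again, after which a conditional whose outputs are no
    longer read is discarded. The classical axioms also give proof irrelevance, so that cells with
    the same data are equal whatever the proofs of their equations. *)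

Lemma scomp_eq (O M : Type) (s t : M -> O) (K : semicat_on s t) f f' g g' p p' :
  f = f' -> g = g' -> scomp K f g p = scomp K f' g' p'.
Proof. intros -> ->; f_equal; apply proof_irrelevance. Qed.

Lemma cid_l_eq (O M : Type) (s t : M -> O) (K : cat_on s t) a f p :
  a = s f -> scomp K (cid K a) f p = f.
Proof. intros ->; apply cid_l. Qed.

Lemma cid_r_eq (O M : Type) (s t : M -> O) (K : cat_on s t) a f p :
  a = t f -> scomp K f (cid K a) p = f.
Proof. intros ->; apply cid_r. Qed.

Section Faces.
Context {O A B S : Type} {sA tA : A -> O} {sB tB : B -> O} {s1 t1 : S -> B} {s2 t2 : S -> A}
  {KA : semicat_on sA tA} {KS1 : semicat_on s1 t1} {KB : cat_on sB tB} {KS2 : cat_on s2 t2}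
  (L : semi_double_laws KA KS1 KB KS2).

(** The laws on faces of composites hold for any proof that the faces compose. The corner equations
    supply such a proof, so that a face can be rewritten without exhibiting one beforehand. *)
Lemma ex_s2_scomp q r p : exists p', s2 (scomp KS1 q r p) = scomp KA (s2 q) (s2 r) p'.
Proof.
assert (p' : tA (s2 q) = sA (s2 r)) by now rewrite (corner_ts L), (corner_ss L), p.
exists p'; apply (s2_scomp L).
Qed.

Lemma ex_t2_scomp q r p : exists p', t2 (scomp KS1 q r p) = scomp KA (t2 q) (t2 r) p'.
Proof.
assert (p' : tA (t2 q) = sA (t2 r)) by now rewrite (corner_tt L), (corner_st L), p.
exists p'; apply (t2_scomp L).
Qed.

Lemma ex_s1_scomp q r p : exists p', s1 (scomp KS2 q r p) = scomp KB (s1 q) (s1 r) p'.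
Proof.
assert (p' : tB (s1 q) = sB (s1 r)) by now rewrite <- (corner_st L), <- (corner_ss L), p.
exists p'; apply (s1_scomp L).
Qed.

Lemma ex_t1_scomp q r p : exists p', t1 (scomp KS2 q r p) = scomp KB (t1 q) (t1 r) p'.
Proof.
assert (p' : tB (t1 q) = sB (t1 r)) by now rewrite <- (corner_tt L), <- (corner_ts L), p.
exists p'; apply (t1_scomp L).
Qed.
End Faces.

(** Cubes are handled over arbitrary squares, from the double laws of the squares alone;
    [arena_cells C] is an instance up to conversion. *)
Definition boundary_cells (G : square_cells) : cube_cells := {|
  sqc := G;
  XYZ := cube_boundary G;
  xsC := @bxs _;  xtC := @bxt _;
  ysC := @bys _;  ytC := @byt _;
  zsC := @bzs _;  ztC := @bzt _
|}.

Lemma boundary_eq (G : square_cells) (f g : cube_boundary G) :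
  bxs f = bxs g -> bxt f = bxt g -> bys f = bys g -> byt f = byt g ->
  bzs f = bzs g -> bzt f = bzt g -> f = g.
Proof.
destruct f, g; cbn; intros; subst; f_equal; apply proof_irrelevance.
Qed.

Ltac pose_edges f :=
  pose proof (edge_z_ss f); pose proof (edge_z_st f);
  pose proof (edge_z_ts f); pose proof (edge_z_tt f);
  pose proof (edge_y_ss f); pose proof (edge_y_st f);
  pose proof (edge_y_ts f); pose proof (edge_y_tt f);
  pose proof (edge_x_ss f); pose proof (edge_x_st f);
  pose proof (edge_x_ts f); pose proof (edge_x_tt f).

Ltac ex_rewrite l := let E := fresh in destruct l as [? E]; rewrite E; clear E.

Section Cubes.
Context {G : square_cells}
  {KX : semicat_on (@xsX G) (@xtX G)}
  {KXYx : semicat_on (@xsXY G) (@xtXY G)}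
  {KXZx : semicat_on (@xsXZ G) (@xtXZ G)}
  {KY : cat_on (@ysY G) (@ytY G)}
  {KXYy : cat_on (@ysXY G) (@ytXY G)}
  {KYZy : cat_on (@ysYZ G) (@ytYZ G)}
  {KZ : cat_on (@zsZ G) (@ztZ G)}
  {KXZz : cat_on (@zsXZ G) (@ztXZ G)}
  {KYZz : cat_on (@zsYZ G) (@ztYZ G)}
  (LXY : semi_double_laws KX KXYx KY KXYy)
  (LXZ : semi_double_laws KX KXZx KZ KXZz)
  (LYZ : double_laws KY KYZy KZ KYZz).

Ltac edges :=
  cbn; rewrite ?s_scomp, ?t_scomp, ?s_cid, ?t_cid; try congruence.

Ltac face_eq a b :=
  destruct a as [? ->], b as [? ->]; apply scomp_eq; congruence.

(** The four edges along x are the ones where both neighbouring faces are composites, and they need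
    the double laws; the others follow by congruence. [Defined] lets the faces compute, while
    [abstract] hides the proofs about the edges along x. *)
Definition compCx (f g : cube_boundary G) (p : bxt f = bxs g) : cube_boundary G.
Proof.
pose_edges f; pose_edges g.
assert (e1 : xtXZ (bys f) = xsXZ (bys g)) by congruence.
assert (e2 : xtXZ (byt f) = xsXZ (byt g)) by congruence.
assert (e3 : xtXY (bzs f) = xsXY (bzs g)) by congruence.
assert (e4 : xtXY (bzt f) = xsXY (bzt g)) by congruence.
apply (@CubeBoundary G (bxs f) (bxt g) (scomp KXZx _ _ e1) (scomp KXZx _ _ e2)
  (scomp KXYx _ _ e3) (scomp KXYx _ _ e4)); edges.
- abstract (face_eq (ex_s2_scomp LXY e3) (ex_s2_scomp LXZ e1)).
- abstract (face_eq (ex_s2_scomp LXY e4) (ex_t2_scomp LXZ e1)).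
- abstract (face_eq (ex_t2_scomp LXY e3) (ex_s2_scomp LXZ e2)).
- abstract (face_eq (ex_t2_scomp LXY e4) (ex_t2_scomp LXZ e2)).
Defined.

Definition compCy (f g : cube_boundary G) (p : byt f = bys g) : cube_boundary G.
Proof.
pose_edges f; pose_edges g.
assert (e1 : ytYZ (bxs f) = ysYZ (bxs g)) by congruence.
assert (e2 : ytYZ (bxt f) = ysYZ (bxt g)) by congruence.
assert (e3 : ytXY (bzs f) = ysXY (bzs g)) by congruence.
assert (e4 : ytXY (bzt f) = ysXY (bzt g)) by congruence.
apply (@CubeBoundary G (scomp KYZy _ _ e1) (scomp KYZy _ _ e2) (bys f) (byt g)
  (scomp KXYy _ _ e3) (scomp KXYy _ _ e4)); edges.
- abstract (face_eq (ex_s1_scomp LXY e3) (ex_s2_scomp LYZ e1)).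
- abstract (face_eq (ex_s1_scomp LXY e4) (ex_t2_scomp LYZ e1)).
- abstract (face_eq (ex_t1_scomp LXY e3) (ex_s2_scomp LYZ e2)).
- abstract (face_eq (ex_t1_scomp LXY e4) (ex_t2_scomp LYZ e2)).
Defined.

Definition compCz (f g : cube_boundary G) (p : bzt f = bzs g) : cube_boundary G.
Proof.
pose_edges f; pose_edges g.
assert (e1 : ztYZ (bxs f) = zsYZ (bxs g)) by congruence.
assert (e2 : ztYZ (bxt f) = zsYZ (bxt g)) by congruence.
assert (e3 : ztXZ (bys f) = zsXZ (bys g)) by congruence.
assert (e4 : ztXZ (byt f) = zsXZ (byt g)) by congruence.
apply (@CubeBoundary G (scomp KYZz _ _ e1) (scomp KYZz _ _ e2)
  (scomp KXZz _ _ e3) (scomp KXZz _ _ e4) (bzs f) (bzt g)); edges.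
- abstract (face_eq (ex_s1_scomp LXZ e3) (ex_s1_scomp LYZ e1)).
- abstract (face_eq (ex_s1_scomp LXZ e4) (ex_t1_scomp LYZ e1)).
- abstract (face_eq (ex_t1_scomp LXZ e3) (ex_s1_scomp LYZ e2)).
- abstract (face_eq (ex_t1_scomp LXZ e4) (ex_t1_scomp LYZ e2)).
Defined.

Definition idCy (q : XZ G) : cube_boundary G.
Proof.
apply (@CubeBoundary G (cid KYZy (xsXZ q)) (cid KYZy (xtXZ q)) q q
  (cid KXYy (zsXZ q)) (cid KXYy (ztXZ q))); edges;
abstract (rewrite ?(s1_cid LXY), ?(t1_cid LXY), ?(s2_cid LYZ), ?(t2_cid LYZ),
  ?(corner_ss LXZ), ?(corner_ts LXZ), ?(corner_st LXZ), ?(corner_tt LXZ); reflexivity).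
Defined.

Definition idCz (q : XY G) : cube_boundary G.
Proof.
apply (@CubeBoundary G (cid KYZz (xsXY q)) (cid KYZz (xtXY q))
  (cid KXZz (ysXY q)) (cid KXZz (ytXY q)) q q); edges;
abstract (rewrite ?(s1_cid LXZ), ?(t1_cid LXZ), ?(s1_cid LYZ), ?(t1_cid LYZ),
  ?(corner_ss LXY), ?(corner_ts LXY), ?(corner_st LXY), ?(corner_tt LXY); reflexivity).
Defined.

(** Once the edge equations of every cube are in the context, [congruence] finds which faces
    compose. Each cube is generalized after its edges are posed, so that the recursion moves on to
    the next one. *)
Ltac cubes :=
  intros;
  let rec go := match goal with
    | f : cube_boundary G |- _ => pose_edges f; generalize dependent f; go; intros
    | |- _ => intros
    end in go;
  apply boundary_eq; cbn in *;
  first [ reflexivity | apply scompA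
        | apply cid_l_eq; congruence | apply cid_r_eq; congruence
        | apply scomp_eq; congruence ].

Definition KCx : semicat_on (@bxs G) (@bxt G).
Proof. refine (@Semicat _ _ _ _ compCx _ _ _); [reflexivity|reflexivity|abstract cubes]. Defined.

Definition SCy : semicat_on (@bys G) (@byt G).
Proof. refine (@Semicat _ _ _ _ compCy _ _ _); [reflexivity|reflexivity|abstract cubes]. Defined.

Definition SCz : semicat_on (@bzs G) (@bzt G).
Proof. refine (@Semicat _ _ _ _ compCz _ _ _); [reflexivity|reflexivity|abstract cubes]. Defined.

Definition KCy : cat_on (@bys G) (@byt G).
Proof.
refine (@Cat _ _ _ _ SCy idCy _ _ _ _); [reflexivity|reflexivity|abstract cubes|abstract cubes].
Defined.

Definition KCz : cat_on (@bzs G) (@bzt G).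
Proof.
refine (@Cat _ _ _ _ SCz idCz _ _ _ _); [reflexivity|reflexivity|abstract cubes|abstract cubes].
Defined.

Ltac cube_law :=
  intros;
  let rec go := match goal with
    | f : cube_boundary G |- _ => pose_edges f; generalize dependent f; go; intros
    | |- _ => intros
    end in go;
  try apply boundary_eq; cbn in *;
  rewrite ?s_scomp, ?t_scomp, ?s_cid, ?t_cid, ?(s1_cid LXZ), ?(t1_cid LXZ), ?(s1_cid LXY),
    ?(t1_cid LXY), ?(s1_cid LYZ), ?(t1_cid LYZ), ?(s2_cid LYZ), ?(t2_cid LYZ),
    ?(corner_ss LXY), ?(corner_ts LXY), ?(corner_st LXY), ?(corner_tt LXY),
    ?(corner_ss LXZ), ?(corner_ts LXZ), ?(corner_st LXZ), ?(corner_tt LXZ);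
  first [ reflexivity | congruence
        | apply scomp_eq; congruence
        | apply (interchange LXY) | apply (interchange LXZ) | apply (interchange LYZ)
        | apply (cid_cid LYZ)
        | match goal with
          | |- context [zsXZ (scomp _ _ _ ?p)] => ex_rewrite (ex_s2_scomp LXZ p)
          | |- context [ztXZ (scomp _ _ _ ?p)] => ex_rewrite (ex_t2_scomp LXZ p)
          | |- context [ysXY (scomp _ _ _ ?p)] => ex_rewrite (ex_s2_scomp LXY p)
          | |- context [ytXY (scomp _ _ _ ?p)] => ex_rewrite (ex_t2_scomp LXY p)
          | |- context [xsXZ (scomp _ _ _ ?p)] => ex_rewrite (ex_s1_scomp LXZ p)
          | |- context [xtXZ (scomp _ _ _ ?p)] => ex_rewrite (ex_t1_scomp LXZ p)
          | |- context [xsXY (scomp _ _ _ ?p)] => ex_rewrite (ex_s1_scomp LXY p)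
          | |- context [xtXY (scomp _ _ _ ?p)] => ex_rewrite (ex_t1_scomp LXY p)
          end;
          first [ apply (cid2_scomp LXY) | apply (cid2_scomp LXZ)
                | apply (cid2_scomp LYZ) | apply (cid1_scomp LYZ) ] ].

Lemma double_XY_Z : @semi_double_laws _ _ _ _ _ _ _ _ (@bxs G) (@bxt G) (@bys G) (@byt G)
  KXZx KCx KYZy KCy.
Proof.
constructor; cube_law.
Qed.

Lemma double_XZ_Y : @semi_double_laws _ _ _ _ _ _ _ _ (@bxs G) (@bxt G) (@bzs G) (@bzt G)
  KXYx KCx KYZz KCz.
Proof.
constructor; cube_law.
Qed.

Lemma double_YZ_X : @double_laws _ _ _ _ _ _ _ _ (@bys G) (@byt G) (@bzs G) (@bzt G)
  KXYy KCy KXZz KCz.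
Proof.
constructor; [constructor|..]; cube_law.
Qed.

Definition boundary_triple : x_semi_triple (boundary_cells G) :=
  @XSemiTriple (boundary_cells G) KX KXYx KXZx KCx KY KXYy KYZy KCy KZ KXZz KYZz KCz
    LXY LXZ LYZ double_XY_Z double_XZ_Y double_YZ_X.
End Cubes.

Lemma psw_nat_eq (O M : Type) (s t : M -> O) (K : cat_on s t) (P : permutative K) f g a b c d p p' :
  a = t f -> b = t g -> c = s f -> d = s g ->
  scomp K (pt1 P f g) (psw P a b) p = scomp K (psw P c d) (pt1 P g f) p'.
Proof. intros -> -> -> ->; apply psw_nat. Qed.

Lemma scomp_ids (O M : Type) (s t : M -> O) (K : cat_on s t) a f g p :
  f = cid K a -> g = cid K a -> scomp K f g p = cid K a.
Proof. intros -> ->; apply cid_l_eq; now rewrite s_cid. Qed.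

(** * Symmetric monoidal structure on cubes *)

Section CubeMonoidal.
Context {G : square_cells}
  {KX : semicat_on (@xsX G) (@xtX G)}
  {KXYx : semicat_on (@xsXY G) (@xtXY G)}
  {KXZx : semicat_on (@xsXZ G) (@xtXZ G)}
  {KY : cat_on (@ysY G) (@ytY G)}
  {KXYy : cat_on (@ysXY G) (@ytXY G)}
  {KYZy : cat_on (@ysYZ G) (@ytYZ G)}
  {KZ : cat_on (@zsZ G) (@ztZ G)}
  {KXZz : cat_on (@zsXZ G) (@ztXZ G)}
  {KYZz : cat_on (@zsYZ G) (@ztYZ G)}
  (LXY : semi_double_laws KX KXYx KY KXYy)
  (LXZ : semi_double_laws KX KXZx KZ KXZz)
  (LYZ : double_laws KY KYZy KZ KYZz)
  (PO : permutative KZ) (PX : permutative KXZz) (PY : permutative KYZz)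
  (xsX_sm : strict_symmetric PX PO (@xsX G) (@xsXZ G))
  (xtX_sm : strict_symmetric PX PO (@xtX G) (@xtXZ G))
  (ysY_sm : strict_symmetric PY PO (@ysY G) (@ysYZ G))
  (ytY_sm : strict_symmetric PY PO (@ytY G) (@ytYZ G))
  (tXY : XY G -> XY G -> XY G) (uXY : XY G)
  (xs_tXY : forall a b, xsXY (tXY a b) = pt0 PY (xsXY a) (xsXY b))
  (xt_tXY : forall a b, xtXY (tXY a b) = pt0 PY (xtXY a) (xtXY b))
  (ys_tXY : forall a b, ysXY (tXY a b) = pt0 PX (ysXY a) (ysXY b))
  (yt_tXY : forall a b, ytXY (tXY a b) = pt0 PX (ytXY a) (ytXY b))
  (xs_uXY : xsXY uXY = pu PY) (xt_uXY : xtXY uXY = pu PY)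
  (ys_uXY : ysXY uXY = pu PX) (yt_uXY : ytXY uXY = pu PX)
  (tXY_A : forall a b c, tXY (tXY a b) c = tXY a (tXY b c))
  (tXY_ul : forall a, tXY uXY a = a) (tXY_ur : forall a, tXY a uXY = a).

Notation KCx := (KCx LXY LXZ).
Notation KCy := (KCy LXY LXZ LYZ).
Notation KCz := (KCz LXY LXZ LYZ).

Ltac faces :=
  rewrite ?xs_tXY, ?xt_tXY, ?ys_tXY, ?yt_tXY, ?xs_uXY, ?xt_uXY, ?ys_uXY, ?yt_uXY,
    ?s_pt1, ?t_pt1, ?s_psw, ?t_psw,
    ?(F1_pt1 xsX_sm), ?(F1_pt1 xtX_sm), ?(F1_pt1 ysY_sm), ?(F1_pt1 ytY_sm),
    ?(F0_pt0 xsX_sm), ?(F0_pt0 xtX_sm), ?(F0_pt0 ysY_sm), ?(F0_pt0 ytY_sm),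
    ?(F1_psw xsX_sm), ?(F1_psw xtX_sm), ?(F1_psw ysY_sm), ?(F1_psw ytY_sm),
    ?(corner_ss LXY), ?(corner_ts LXY), ?(corner_st LXY), ?(corner_tt LXY).

Definition tC (f g : cube_boundary G) : cube_boundary G.
Proof.
apply (@CubeBoundary G (pt1 PY (bxs f) (bxs g)) (pt1 PY (bxt f) (bxt g))
  (pt1 PX (bys f) (bys g)) (pt1 PX (byt f) (byt g))
  (tXY (bzs f) (bzs g)) (tXY (bzt f) (bzt g)));
pose_edges f; pose_edges g; abstract (faces; congruence).
Defined.

Definition swC (a b : XY G) : cube_boundary G.
Proof.
apply (@CubeBoundary G (psw PY (xsXY a) (xsXY b)) (psw PY (xtXY a) (xtXY b))
  (psw PX (ysXY a) (ysXY b)) (psw PX (ytXY a) (ytXY b)) (tXY a b) (tXY b a));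
abstract (faces; congruence).
Defined.

Ltac pose_all_edges :=
  let rec go := match goal with
    | f : cube_boundary G |- _ => pose_edges f; generalize dependent f; go; intros
    | |- _ => intros
    end in go.

Ltac perm :=
  intros; pose_all_edges; apply boundary_eq; cbn in *; faces;
  first [ reflexivity | apply tXY_A | apply tXY_ul | apply tXY_ur | apply pt1_scomp | apply pt1_cid | apply pt1A
        | apply pt1_ul | apply pt1_ur | apply psw_nat_eq; congruence
        | symmetry; apply tXY_A | etransitivity; [apply pswK|]; faces; reflexivity
        | apply psw_hexagon ].

(** Its objects are xy-squares and its arrows are cubes. The laws for arrows reduce to the side
    faces, where [PY] and [PX] provide them, and to the laws of [tXY] on the two z-faces. *)
Definition PXY : permutative KCz.
Proof.
refine (@Permutative _ _ _ _ KCz tXY tC uXY _ _ _ _ tXY_A _ tXY_ul tXY_ur _ _ swC _ _ _ _ _);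
  try reflexivity; abstract perm.
Defined.

Context
  (idY_sm : strict_symmetric PO PY (cid KY) (cid KYZy))
  (cid_tXY : forall f g, cid KXYy (pt0 PX f g) = tXY (cid KXYy f) (cid KXYy g))
  (cid_uXY : cid KXYy (pu PX) = uXY)
  (compY_sm : strict_composition KY KYZy PY)
  (scomp_tXY : forall f g f' g' p p' p'',
    tXY (scomp KXYy f g p) (scomp KXYy f' g' p')
    = scomp KXYy (tXY f f') (tXY g g') p'').

Ltac sm := constructor; cbn; intros; auto.

Lemma xsXY_sm : strict_symmetric PXY PY (@xsXY G) (@bxs G).  Proof. sm. Qed.
Lemma xtXY_sm : strict_symmetric PXY PY (@xtXY G) (@bxt G).  Proof. sm. Qed.
Lemma ysXY_sm : strict_symmetric PXY PX (@ysXY G) (@bys G).  Proof. sm. Qed.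
Lemma ytXY_sm : strict_symmetric PXY PX (@ytXY G) (@byt G).  Proof. sm. Qed.

Lemma idXY_sm : strict_symmetric PX PXY (cid KXYy) (cid KCy).
Proof.
constructor; cbn; auto; intros; apply boundary_eq; cbn; auto;
  rewrite ?s_pt1, ?t_pt1, ?s_psw, ?t_psw, ?(s1_cid LXY), ?(t1_cid LXY), ?s_cid, ?t_cid,
    ?(F1_pt1 xsX_sm), ?(F1_pt1 xtX_sm), ?(F1_psw xsX_sm), ?(F1_psw xtX_sm);
  first [ reflexivity | apply (F1_pt1 idY_sm) | apply (F1_psw idY_sm) | apply cid_tXY ].
Qed.

Ltac faces_scomp :=
  repeat match goal with
  | |- context [xsXY (scomp _ _ _ ?p)] => ex_rewrite (ex_s1_scomp LXY p)
  | |- context [xtXY (scomp _ _ _ ?p)] => ex_rewrite (ex_t1_scomp LXY p)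
  | |- context [ysXY (scomp _ _ _ ?p)] => ex_rewrite (ex_s2_scomp LXY p)
  | |- context [ytXY (scomp _ _ _ ?p)] => ex_rewrite (ex_t2_scomp LXY p)
  end.

Lemma compXY_sm : strict_composition KXYy KCy PXY.
Proof.
constructor; cbn; auto; intros; apply boundary_eq; cbn; auto; rewrite ?s_scomp, ?t_scomp;
  faces_scomp;
  first [ reflexivity | apply (scomp_pt1 compY_sm) | apply (scomp_psw compY_sm) ].
Qed.

Context (MX : strong_composition KX KXZx PO PX).

Lemma mu_eq f g f' g' p p' h k h' k' q q' :
  f = h -> g = k -> f' = h' -> g' = k' ->
  mu MX f g f' g' p p' = mu MX h k h' k' q q'.
Proof. intros <- <- <- <-; f_equal; apply proof_irrelevance. Qed.

Lemma cidYZ_Y o : cid KYZz (cid KY o) = cid KYZy (cid KZ o).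
Proof. symmetry; apply (cid_cid LYZ). Qed.

Lemma ex_s_mu f g f' g' p p' : exists q,
  zsXZ (mu MX f g f' g' p p') = scomp KX (pt0 PX f f') (pt0 PX g g') q.
Proof.
assert (q : xtX (pt0 PX f f') = xsX (pt0 PX g g')).
{ rewrite (F0_pt0 xtX_sm), (F0_pt0 xsX_sm); congruence. }
exists q; apply (s_mu MX).
Qed.

Definition muC (f g f' g' : XY G) (p : xtXY f = xsXY g) (p' : xtXY f' = xsXY g') :
  cube_boundary G.
Proof.
assert (e1 : xtX (ysXY f) = xsX (ysXY g)) by (rewrite (corner_ts LXY), (corner_ss LXY); congruence).
assert (e1' : xtX (ysXY f') = xsX (ysXY g')) by (rewrite (corner_ts LXY), (corner_ss LXY); congruence).
assert (e2 : xtX (ytXY f) = xsX (ytXY g)) by (rewrite (corner_tt LXY), (corner_st LXY); congruence).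
assert (e2' : xtX (ytXY f') = xsX (ytXY g')) by (rewrite (corner_tt LXY), (corner_st LXY); congruence).
assert (e3 : xtXY (tXY f f') = xsXY (tXY g g')) by (faces; congruence).
apply (@CubeBoundary G
  (cid KYZz (pt0 PY (xsXY f) (xsXY f'))) (cid KYZz (pt0 PY (xtXY g) (xtXY g')))
  (mu MX _ _ _ _ e1 e1') (mu MX _ _ _ _ e2 e2')
  (scomp KXYx _ _ e3) (tXY (scomp KXYx f g p) (scomp KXYx f' g' p'))).
1-4: abstract (rewrite ?(s1_mu MX), ?(t1_mu MX), ?(s1_cid LYZ), ?(t1_cid LYZ), ?(s2_cid LYZ),
  ?(t2_cid LYZ); faces; rewrite ?s_cid, ?t_cid; f_equal; faces; reflexivity).
1-4: abstract (rewrite ?s_cid, ?t_cid, ?s_scomp, ?t_scomp; faces; rewrite ?s_scomp, ?t_scomp; reflexivity).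
1-4: abstract (faces; faces_scomp;
  first [ ex_rewrite (ex_s_mu e1 e1') | ex_rewrite (ex_s_mu e2 e2')
        | rewrite (t_mu MX); f_equal ];
  apply scomp_eq; faces; reflexivity).
Defined.
(** [mu_iso] says nothing about the two ends of the inverse, but they are forced: the ends of the
    composite and those of [mu] are identities, hence so are those of [nu]. Without this the
    inverses of two faces could not bound a common cube. *)
Lemma mu_inverse f g f' g' p p' : exists nu q q',
  scomp KXZz (mu MX f g f' g' p p') nu q = cid KXZz (zsXZ (mu MX f g f' g' p p')) /\
  scomp KXZz nu (mu MX f g f' g' p p') q' = cid KXZz (ztXZ (mu MX f g f' g' p p')) /\
  xsXZ nu = xsXZ (mu MX f g f' g' p p') /\ xtXZ nu = xtXZ (mu MX f g f' g' p p').
Proof.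
destruct (mu_iso MX p p') as (nu & q & q' & H & H').
exists nu, q, q'; repeat split; auto.
- apply (f_equal (@xsXZ _)) in H; destruct (ex_s1_scomp LXZ q) as [e E].
  rewrite E, (s1_cid LXZ), (corner_ss LXZ) in H; clear E.
  assert (K : forall x y e1, x = cid KZ y -> scomp KZ x (xsXZ nu) e1 = xsXZ nu).
  { intros x y e1 ->; apply cid_l_eq; rewrite <- e1, t_cid; reflexivity. }
  rewrite (K _ _ _ (s1_mu MX p p')) in H; rewrite H, (s1_mu MX), s_cid; reflexivity.
- apply (f_equal (@xtXZ _)) in H; destruct (ex_t1_scomp LXZ q) as [e E].
  rewrite E, (t1_cid LXZ), (corner_ts LXZ) in H; clear E.
  assert (K : forall x y e1, x = cid KZ y -> scomp KZ x (xtXZ nu) e1 = xtXZ nu).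
  { intros x y e1 ->; apply cid_l_eq; rewrite <- e1, t_cid; reflexivity. }
  rewrite (K _ _ _ (t1_mu MX p p')) in H; rewrite H, (t1_mu MX), s_cid; reflexivity.
Qed.

(** The inverse cube has the inverses of the two y-faces, the same identities at its x-ends, and the
    z-faces of [muC] exchanged. *)
Lemma muC_iso f g f' g' p p' : exists nu q q',
  scomp KCz (@muC f g f' g' p p') nu q = cid KCz (bzs (@muC f g f' g' p p')) /\
  scomp KCz nu (@muC f g f' g' p p') q' = cid KCz (bzt (@muC f g f' g' p p')).
Proof.
set (m := @muC f g f' g' p p').
assert (I : exists n q q', scomp KXZz (bys m) n q = cid KXZz (zsXZ (bys m)) /\
  scomp KXZz n (bys m) q' = cid KXZz (ztXZ (bys m)) /\
  xsXZ n = xsXZ (bys m) /\ xtXZ n = xtXZ (bys m)) by apply mu_inverse.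
assert (J : exists n q q', scomp KXZz (byt m) n q = cid KXZz (zsXZ (byt m)) /\
  scomp KXZz n (byt m) q' = cid KXZz (ztXZ (byt m)) /\
  xsXZ n = xsXZ (byt m) /\ xtXZ n = xtXZ (byt m)) by apply mu_inverse.
assert (z1 : zsYZ (bxs m) = ztYZ (bxs m)) by (cbn; now rewrite s_cid, t_cid).
assert (z2 : zsYZ (bxt m) = ztYZ (bxt m)) by (cbn; now rewrite s_cid, t_cid).
assert (c1 : bxs m = cid KYZz (zsYZ (bxs m))) by (cbn; now rewrite s_cid).
assert (c2 : bxt m = cid KYZz (zsYZ (bxt m))) by (cbn; now rewrite s_cid).
destruct I as (n1 & q1 & q1' & I1 & I2 & I3 & I4), J as (n2 & q2 & q2' & J1 & J2 & J3 & J4).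
assert (z3 : ztXZ n1 = zsXZ (bys m)).
{ apply (f_equal (@ztXZ _)) in I1; now rewrite t_scomp, t_cid in I1. }
assert (z4 : ztXZ n2 = zsXZ (byt m)).
{ apply (f_equal (@ztXZ _)) in J1; now rewrite t_scomp, t_cid in J1. }
pose_edges m; clearbody m.
assert (N : exists nu : cube_boundary G, bxs nu = bxs m /\ bxt nu = bxt m /\
  bys nu = n1 /\ byt nu = n2 /\ bzs nu = bzt m /\ bzt nu = bzs m).
{ unshelve eexists (@CubeBoundary G (bxs m) (bxt m) n1 n2 (bzt m) (bzs m)
    _ _ _ _ _ _ _ _ _ _ _ _); [..|repeat split; reflexivity]; congruence. }
destruct N as (nu & N1 & N2 & N3 & N4 & N5 & N6); subst n1 n2.
exists nu, (eq_sym N5), N6; split; apply boundary_eq; cbn; try congruence.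
1, 5: transitivity (cid KYZz (zsYZ (bxs m))); [apply scomp_ids; congruence|congruence].
1, 4: transitivity (cid KYZz (zsYZ (bxt m))); [apply scomp_ids; congruence|congruence].
- rewrite H7, <- I1; apply scomp_eq; reflexivity.
- rewrite H9, <- J1; apply scomp_eq; reflexivity.
- rewrite H8, <- I2; apply scomp_eq; reflexivity.
- rewrite H10, <- J2; apply scomp_eq; reflexivity.
Qed.

(** This and the following variants of the laws of [mu] take their arguments up to equality: the
    faces of composite or tensored squares have the required form only propositionally, and
    rewriting them in place is blocked by the proofs of composability that mention them. *)
Lemma mu_nat_eq (a b a' b' : XZ G) f g f' g' h k h' k' p p' q r r' w w' u u' :
  f = ztXZ a -> g = ztXZ b -> f' = ztXZ a' -> g' = ztXZ b' ->
  h = zsXZ a -> k = zsXZ b -> h' = zsXZ a' -> k' = zsXZ b' ->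
  scomp KXZz (scomp KXZx (pt1 PX a a') (pt1 PX b b') q) (mu MX f g f' g' w w') u
  = scomp KXZz (mu MX h k h' k' r r') (pt1 PX (scomp KXZx a b p) (scomp KXZx a' b' p')) u'.
Proof. intros -> -> -> -> -> -> -> ->; apply mu_nat. Qed.

Lemma mu_scomp_eq f g h f' g' h' fg fg' gh gh' hh ff p q p' q' l l' r r' v w u u' :
  fg = scomp KX f g p -> fg' = scomp KX f' g' p' ->
  gh = scomp KX g h q -> gh' = scomp KX g' h' q' ->
  hh = pt0 PX h h' -> ff = pt0 PX f f' ->
  scomp KXZz (scomp KXZx (mu MX f g f' g' p p') (cid KXZz hh) v) (mu MX fg h fg' h' l l') u
  = scomp KXZz (scomp KXZx (cid KXZz ff) (mu MX g h g' h' q q') w) (mu MX f gh f' gh' r r') u'.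
Proof. intros -> -> -> -> -> ->; apply mu_scomp. Qed.

Lemma mu_pt0_eq f g f' g' f'' g'' ff gg ff' gg' fg fg' p p' p'' l r u u' :
  ff = pt0 PX f f' -> gg = pt0 PX g g' -> ff' = pt0 PX f' f'' -> gg' = pt0 PX g' g'' ->
  fg = scomp KX f g p -> fg' = scomp KX f'' g'' p'' ->
  scomp KXZz (mu MX ff gg f'' g'' l p'') (pt1 PX (mu MX f g f' g' p p') (cid KXZz fg')) u
  = scomp KXZz (mu MX f g ff' gg' p r) (pt1 PX (cid KXZz fg) (mu MX f' g' f'' g'' p' p'')) u'.
Proof. intros -> -> -> -> -> ->; apply mu_pt0. Qed.

Lemma mu_psw_eq f g f' g' fg fg' p p' v u u' :
  fg = scomp KX f g p -> fg' = scomp KX f' g' p' ->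
  scomp KXZz (mu MX f g f' g' p p') (psw PX fg fg') u
  = scomp KXZz (scomp KXZx (psw PX f f') (psw PX g g') v) (mu MX f' g' f g p' p) u'.
Proof. intros -> ->; apply mu_psw. Qed.

Lemma mu_ul_eq f g h k r p q :
  h = pu PX -> k = pu PX -> r = scomp KX f g q ->
  mu MX h k f g p q = cid KXZz r.
Proof. intros -> -> ->; apply mu_ul. Qed.

Lemma mu_ur_eq f g h k r p q :
  h = pu PX -> k = pu PX -> r = scomp KX f g p ->
  mu MX f g h k p q = cid KXZz r.
Proof. intros -> -> ->; apply mu_ur. Qed.

(** The unit square is the y-identity of the unit x-morphism, and y-identities compose along x. *)
Lemma scomp_uXY p : scomp KXYx uXY uXY p = uXY.
Proof.
assert (e : xtX (pu PX) = xsX (pu PX)) by now rewrite (F0_pu xtX_sm), (F0_pu xsX_sm).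
assert (e' : xtXY (cid KXYy (pu PX)) = xsXY (cid KXYy (pu PX))) by now rewrite cid_uXY.
transitivity (scomp KXYx (cid KXYy (pu PX)) (cid KXYy (pu PX)) e').
- apply scomp_eq; now rewrite cid_uXY.
- now rewrite <- (cid2_scomp LXY e e'), (scomp_pu MX), cid_uXY.
Qed.

Ltac same_face := rewrite ?s_scomp, ?t_scomp, ?pt1_cid; faces; rewrite ?s_scomp, ?t_scomp, ?pt0A;
  first [reflexivity | congruence].

Ltac ids :=
  lazymatch goal with
  | |- scomp ?K (cid ?K' ?a) _ _ = _ =>
      transitivity (cid K' a);
        [apply scomp_ids; [reflexivity|rewrite ?pt1_cid; f_equal; same_face]
        |symmetry; apply scomp_ids; rewrite ?pt1_cid; f_equal; same_face]
  end.

Definition MXY : strong_composition KXYx KCx PY PXY.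
Proof.
unshelve refine (@StrongComposition _ _ _ _ _ _ _ _ _ _ _ _ KXYx KCx KYZz KCz PY PXY muC
  _ _ _ _ muC_iso _ _ _ _ _ _ _).
- abstract (intros; cbn; apply scomp_eq; reflexivity).
- reflexivity.
- reflexivity.
- reflexivity.
- abstract (intros; pose_all_edges; apply boundary_eq; cbn;
  [ transitivity (pt1 PY (bxs a) (bxs a'));
    [apply cid_r_eq|symmetry; apply cid_l_eq]; faces; congruence
  | transitivity (pt1 PY (bxt b) (bxt b'));
    [apply cid_r_eq|symmetry; apply cid_l_eq]; faces; congruence
  | apply mu_nat_eq; congruence
  | apply mu_nat_eq; congruence
  | apply scomp_eq; reflexivity
  | f_equal; apply scomp_eq; reflexivity ]).
- intros; apply boundary_eq; cbn.
  + ids.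
  + ids.
  + eapply mu_scomp_eq; eauto using s2_scomp.
  + eapply mu_scomp_eq; eauto using t2_scomp.
  + apply scompA.
  + f_equal; apply scompA.
- intros; apply boundary_eq; cbn.
  + ids.
  + ids.
  + eapply mu_pt0_eq; eauto using s2_scomp.
  + eapply mu_pt0_eq; eauto using t2_scomp.
  + apply scomp_eq; apply tXY_A.
  + apply tXY_A.
- exact scomp_uXY.
- intros; apply boundary_eq; cbn.
  + f_equal; same_face; apply pt0_ul.
  + f_equal; same_face; apply pt0_ul.
  + apply mu_ul_eq; [exact ys_uXY|exact ys_uXY|apply (s2_scomp LXY)].
  + apply mu_ul_eq; [exact yt_uXY|exact yt_uXY|apply (t2_scomp LXY)].
  + apply scomp_eq; apply tXY_ul.
  + now rewrite scomp_uXY, tXY_ul.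
- intros; apply boundary_eq; cbn.
  + f_equal; same_face; apply pt0_ur.
  + f_equal; same_face; apply pt0_ur.
  + apply mu_ur_eq; [exact ys_uXY|exact ys_uXY|apply (s2_scomp LXY)].
  + apply mu_ur_eq; [exact yt_uXY|exact yt_uXY|apply (t2_scomp LXY)].
  + apply scomp_eq; apply tXY_ur.
  + now rewrite scomp_uXY, tXY_ur.
- intros; apply boundary_eq; cbn.
  + transitivity (psw PY (xsXY f) (xsXY f')).
    { rewrite cid_l_eq; [f_equal; same_face | rewrite s_psw; f_equal; same_face]. }
    symmetry; apply cid_r_eq; rewrite t_psw; reflexivity.
  + transitivity (psw PY (xtXY g) (xtXY g')).
    { rewrite cid_l_eq; [f_equal; same_face | rewrite s_psw; f_equal; same_face]. }
    symmetry; apply cid_r_eq; rewrite t_psw; reflexivity.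
  + apply mu_psw_eq; apply (s2_scomp LXY).
  + apply mu_psw_eq; apply (t2_scomp LXY).
  + apply scomp_eq; reflexivity.
  + reflexivity.
Defined.

Lemma muXY_cid f g f' g' p p' v v' :
  mu MXY (cid KXYy f) (cid KXYy g) (cid KXYy f') (cid KXYy g') v v'
  = cid KCy (mu MX f g f' g' p p').
Proof.
apply boundary_eq; cbn.
- rewrite (s1_mu MX), !(s1_cid LXY), <- (F0_pt0 idY_sm); apply cidYZ_Y.
- rewrite (t1_mu MX), !(t1_cid LXY), <- (F0_pt0 idY_sm); apply cidYZ_Y.
- apply mu_eq; apply s_cid.
- apply mu_eq; apply t_cid.
- destruct (ex_s_mu p p') as [q ->].
  assert (e : xtXY (cid KXYy (pt0 PX f f')) = xsXY (cid KXYy (pt0 PX g g')))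
    by (rewrite (t1_cid LXY), (s1_cid LXY); congruence).
  rewrite (cid2_scomp LXY q e); apply scomp_eq; symmetry; apply cid_tXY.
- rewrite (t_mu MX), cid_tXY; f_equal; symmetry; apply (cid2_scomp LXY).
Qed.

Lemma muXY_scomp a b a' b' c d c' d' p q p' q' ac bd ac' bd' v v' u :
  mu MXY (scomp KXYy a c ac) (scomp KXYy b d bd)
         (scomp KXYy a' c' ac') (scomp KXYy b' d' bd') v v'
  = scomp KCy (mu MXY a b a' b' p p') (mu MXY c d c' d' q q') u.
Proof.
assert (e1 : ytY (xsXY a) = ysY (xsXY c)) by (rewrite <- (corner_ss LXY), <- (corner_st LXY); congruence).
assert (e1' : ytY (xsXY a') = ysY (xsXY c')) by (rewrite <- (corner_ss LXY), <- (corner_st LXY); congruence).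
assert (e2 : ytY (xtXY b) = ysY (xtXY d)) by (rewrite <- (corner_ts LXY), <- (corner_tt LXY); congruence).
assert (e2' : ytY (xtXY b') = ysY (xtXY d')) by (rewrite <- (corner_ts LXY), <- (corner_tt LXY); congruence).
apply boundary_eq; cbn.
- assert (e : ytY (pt0 PY (xsXY a) (xsXY a')) = ysY (pt0 PY (xsXY c) (xsXY c')))
    by (faces; congruence).
  rewrite (s1_scomp LXY _ e1), (s1_scomp LXY _ e1'), (scomp_pt0 compY_sm e1 e1' e).
  apply (cid2_scomp LYZ).
- assert (e : ytY (pt0 PY (xtXY b) (xtXY b')) = ysY (pt0 PY (xtXY d) (xtXY d')))
    by (faces; congruence).
  rewrite (t1_scomp LXY _ e2), (t1_scomp LXY _ e2'), (scomp_pt0 compY_sm e2 e2' e).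
  apply (cid2_scomp LYZ).
- apply mu_eq; apply s_scomp.
- apply mu_eq; apply t_scomp.
- assert (i : ytXY (tXY a a') = ysXY (tXY c c')) by (faces; congruence).
  assert (j : ytXY (tXY b b') = ysXY (tXY d d')) by (faces; congruence).
  assert (k : xtXY (scomp KXYy (tXY a a') (tXY c c') i) = xsXY (scomp KXYy (tXY b b') (tXY d d') j)).
  { rewrite <- (scomp_tXY ac ac' i), <- (scomp_tXY bd bd' j); faces; congruence. }
  transitivity (scomp KXYx _ _ k); [apply scomp_eq; apply scomp_tXY|].
  symmetry; apply (interchange LXY).
- assert (I : forall f g h k (fg : xtXY f = xsXY g) (hk : xtXY h = xsXY k),
    ytXY f = ysXY h -> ytXY g = ysXY k ->
    ytXY (scomp KXYx f g fg) = ysXY (scomp KXYx h k hk)).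
  { intros f g h k fg hk E F.
    destruct (ex_t2_scomp LXY fg) as [i ->], (ex_s2_scomp LXY hk) as [j ->].
    now apply scomp_eq. }
  rewrite <- (scomp_tXY (I _ _ _ _ p q ac bd) (I _ _ _ _ p' q' ac' bd')).
  f_equal; symmetry; apply (interchange LXY).
Qed.

Definition boundary_monoidal : symmetric_monoidal (boundary_triple LXY LXZ LYZ) :=
  @SymMonTriple (boundary_cells G) (boundary_triple LXY LXZ LYZ) PO PX PY PXY
    xsX_sm xtX_sm ysY_sm ytY_sm xsXY_sm xtXY_sm ysXY_sm ytXY_sm idY_sm idXY_sm
    compY_sm compXY_sm MX MXY
    (fun _ _ _ _ _ _ _ _ => mu_eq _ _ _ _ eq_refl eq_refl eq_refl eq_refl)
    (fun _ _ _ _ _ _ _ _ => mu_eq _ _ _ _ eq_refl eq_refl eq_refl eq_refl)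
    muXY_cid muXY_scomp.
End CubeMonoidal.

(** * Arrows up to equality of objects *)

Record arr (C : category) := Arr { dom : C; cod : C; amor : hom dom cod }.
Arguments Arr {C dom cod} amor.

Section Untyped.
Context {C : category}.
Implicit Types f g h : arr C.
Implicit Types a b c : C.

Lemma UIP_refl (A : Type) (x : A) (e : x = x) : e = eq_refl.
Proof. apply proof_irrelevance. Qed.

Lemma Arr_inj (a b : C) (f g : hom a b) : Arr f = Arr g -> f = g.
Proof.
intros H.
(* Generalizing over the packed arrow and over the two equations between endpoints makes the
   elimination of the hypothesis well typed; uniqueness of identity proofs then trivializes the
   transports. *)
assert (K : forall x : arr C, Arr f = x -> forall (e1 : a = dom x) (e2 : b = cod x),
  f = eqhom e1 >> amor x >> eqhom (eq_sym e2)).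
{ intros x <- e1 e2; simpl in *.
  rewrite (UIP_refl e1), (UIP_refl e2); simpl.
  now rewrite comp_idr, comp_idl. }
rewrite (K _ H eq_refl eq_refl); simpl.
now rewrite comp_idr, comp_idl.
Qed.

(* Junk value [f] when [f] and [g] are not composable. *)
Definition acomp f g : arr C :=
  match excluded_middle_informative (cod f = dom g) with
  | left e => Arr (amor f >> eqhom e >> amor g)
  | right _ => f
  end.

Definition aid (a : C) : arr C := Arr (idm a).

Lemma acompE a b c (f : hom a b) (g : hom b c) : acomp (Arr f) (Arr g) = Arr (f >> g).
Proof.
unfold acomp; simpl.
destruct excluded_middle_informative as [e|n]; [|now destruct n].
rewrite (UIP_refl e); simpl; now rewrite comp_idr.
Qed.

Lemma dom_acomp f g : dom (acomp f g) = dom f.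
Proof. unfold acomp; now destruct excluded_middle_informative. Qed.

Lemma cod_acomp f g : cod f = dom g -> cod (acomp f g) = cod g.
Proof. intros e; unfold acomp; now destruct excluded_middle_informative. Qed.

Lemma acompA f g h : cod f = dom g -> cod g = dom h ->
  acomp (acomp f g) h = acomp f (acomp g h).
Proof.
destruct f, g, h; simpl; intros -> ->.
now rewrite !acompE, compA.
Qed.

Lemma aid_l a f : dom f = a -> acomp (aid a) f = f.
Proof.
destruct f; simpl; intros ->; unfold aid; now rewrite acompE, comp_idl.
Qed.

Lemma aid_r a f : cod f = a -> acomp f (aid a) = f.
Proof.
destruct f; simpl; intros ->; unfold aid; now rewrite acompE, comp_idr.
Qed.

Lemma Arr_eqhom a b (e : a = b :> C) : Arr (@eqhom C a b e) = aid a.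
Proof. now destruct e. Qed.

Lemma Arr_eqr a b b' (f : hom a b) (e : b = b') : Arr (f >> eqhom e) = Arr f.
Proof. destruct e; simpl; now rewrite comp_idr. Qed.

Lemma Arr_eql a a' b (f : hom a b) (e : a' = a) : Arr (eqhom e >> f) = Arr f.
Proof. destruct e; simpl; now rewrite comp_idl. Qed.
End Untyped.

Ltac dc := repeat first
  [ rewrite dom_acomp | rewrite cod_acomp | progress simpl
  | rewrite tenA | rewrite ten1l | rewrite ten1r ];
  try congruence; auto.

(** * Tensor, symmetry, copying and deletion for untyped arrows *)

Section Markov.
Context {C : markov_category}.
Implicit Types f g h : arr C.
Implicit Types a b c : C.

Definition aten f g : arr C := Arr (tenm (amor f) (amor g)).
Definition cp a : arr C := Arr (copy a).
Definition dl a : arr C := Arr (del a).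
Definition sw a b : arr C := Arr (swap a b).

Lemma atenE a b a' b' (f : hom a b) (g : hom a' b') :
  Arr (tenm f g) = aten (Arr f) (Arr g).
Proof. reflexivity. Qed.

(** Composing with an [eqhom] does not change the packed arrow, so both sides of [tenmA] lose their
    coherence morphism. *)
Lemma atenA f g h : aten (aten f g) h = aten f (aten g h).
Proof.
unfold aten; simpl.
rewrite <- (Arr_eqr _ (tenA _ _ _)), tenmA; apply Arr_eql.
Qed.

Lemma aten1l f : aten (aid one) f = f.
Proof.
destruct f; unfold aten; simpl.
rewrite <- (Arr_eqr _ (ten1l _)), tenm1l; apply Arr_eql.
Qed.

Lemma aten1r f : aten f (aid one) = f.
Proof.
destruct f; unfold aten; simpl.
rewrite <- (Arr_eqr _ (ten1r _)), tenm1r; apply Arr_eql.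
Qed.

Lemma aten_id a b : aten (aid a) (aid b) = aid (a ⊗ b).
Proof. unfold aten, aid; simpl; now rewrite tenm_id. Qed.

Lemma aten_acomp f g f' g' : cod f = dom g -> cod f' = dom g' ->
  aten (acomp f g) (acomp f' g') = acomp (aten f f') (aten g g').
Proof.
destruct f, g, f', g'; simpl; intros -> ->.
unfold aten; rewrite !acompE; simpl; now rewrite tenm_comp.
Qed.

Lemma sw_nat f f' : acomp (aten f f') (sw (cod f) (cod f')) = acomp (sw (dom f) (dom f')) (aten f' f).
Proof.
destruct f, f'; unfold aten, sw; simpl; now rewrite !acompE, swap_nat.
Qed.

Lemma swK a b : acomp (sw a b) (sw b a) = aid (a ⊗ b).
Proof. unfold sw, aid; now rewrite acompE, swapK. Qed.

Lemma sw_hex a b c : sw a (b ⊗ c) = acomp (aten (sw a b) (aid c)) (aten (aid b) (sw a c)).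
Proof.
unfold sw at 1; rewrite swap_hexagon.
rewrite Arr_eqr, <- acompE, Arr_eqr, Arr_eql; reflexivity.
Qed.

Lemma dl_nat f b : cod f = b -> acomp f (dl b) = dl (dom f).
Proof.
destruct f; simpl; intros <-; unfold dl; rewrite acompE; f_equal; apply del_terminal.
Qed.

Lemma dl_one : dl (@one C) = aid one.
Proof. unfold dl, aid; f_equal; symmetry; apply del_terminal. Qed.

Lemma eq_dl f : cod f = one -> f = dl (dom f).
Proof.
destruct f as [a b f]; simpl; intros ->; unfold dl; f_equal; apply del_terminal.
Qed.

Lemma dl_ten a b : dl (a ⊗ b) = aten (dl a) (dl b).
Proof. symmetry; apply eq_dl; simpl; apply ten1l. Qed.

Lemma cp_coassoc a : acomp (cp a) (aten (cp a) (aid a)) = acomp (cp a) (aten (aid a) (cp a)).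
Proof.
unfold cp, aid, aten; simpl; rewrite !acompE.
rewrite <- (Arr_eqr _ (tenA a a a)), copy_coassoc; reflexivity.
Qed.

Lemma cp_dl_l a : acomp (cp a) (aten (dl a) (aid a)) = aid a.
Proof.
unfold cp, aid, aten, dl; simpl; rewrite !acompE.
rewrite <- (Arr_eqr _ (ten1l a)), copy_del; reflexivity.
Qed.

Lemma cp_sw a : acomp (cp a) (sw a a) = cp a.
Proof. unfold cp, sw; now rewrite acompE, copy_swap. Qed.

Lemma cp_one : cp (@one C) = aid one.
Proof. unfold cp; rewrite copy_one, Arr_eqhom; reflexivity. Qed.

Lemma cp_ten a b : cp (a ⊗ b)
  = acomp (aten (cp a) (cp b)) (aten (aid a) (aten (sw a b) (aid b))).
Proof.
unfold cp at 1; rewrite copy_ten, Arr_eqr, <- acompE, Arr_eqr; reflexivity.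
Qed.

(** The hexagon with both remaining objects equal to the unit makes this symmetry idempotent; being
    invertible, it is an identity. *)
Lemma sw_one_r a : sw a one = aid a.
Proof.
assert (H : sw a one = acomp (sw a one) (sw a one)).
{ rewrite <- (ten1l (@one C)) at 1; rewrite sw_hex, aten1r, aten1l; reflexivity. }
assert (K : acomp (sw a one) (acomp (sw a one) (sw one a)) = aid a).
{ rewrite <- acompA; [|dc|dc]; rewrite <- H, swK, ten1r; reflexivity. }
now rewrite swK, ten1r, aid_r in K by (simpl; apply ten1l).
Qed.

Lemma sw_one_l a : sw one a = aid a.
Proof.
pose proof (swK one a) as H.
rewrite sw_one_r, aid_r, ten1l in H by dc; exact H.
Qed.

Lemma cp_dl_r a : acomp (cp a) (aten (aid a) (dl a)) = aid a.
Proof.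
rewrite <- cp_sw, acompA by dc.
pose proof (sw_nat (dl a) (aid a)) as H; simpl in H.
rewrite <- H, sw_one_l.
rewrite aid_r by dc; apply cp_dl_l.
Qed.

(** * Pairing *)

Definition pr f g : arr C := acomp (cp (dom f)) (aten f g).
Definition adet f : Prop := acomp f (cp (cod f)) = acomp (cp (dom f)) (aten f f).
Definition p1 a b : arr C := aten (aid a) (dl b).
Definition p2 a b : arr C := aten (dl a) (aid b).

Lemma dom_pr f g : dom (pr f g) = dom f.
Proof. unfold pr; now rewrite dom_acomp. Qed.

Lemma cod_pr f g : dom f = dom g -> cod (pr f g) = cod f ⊗ cod g.
Proof. intros e; unfold pr; rewrite cod_acomp; simpl; congruence. Qed.

Ltac dcp := repeat first
  [ rewrite dom_acomp | rewrite cod_acomp | rewrite dom_pr | rewrite cod_pr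
  | progress simpl | rewrite tenA | rewrite ten1l | rewrite ten1r ];
  try congruence; auto.

Lemma det_pr u f g : adet u -> cod u = dom f -> dom f = dom g ->
  acomp u (pr f g) = pr (acomp u f) (acomp u g).
Proof.
intros D e e'; unfold pr; rewrite <- acompA; [|dc|dc].
rewrite <- e, D, dom_acomp, acompA; [|dc|dc].
now rewrite <- aten_acomp by congruence.
Qed.

Lemma pr_ten f g h k : cod f = dom h -> cod g = dom k -> dom f = dom g ->
  acomp (pr f g) (aten h k) = pr (acomp f h) (acomp g k).
Proof.
intros e e' e''; unfold pr; rewrite acompA by dc.
now rewrite <- aten_acomp, dom_acomp by congruence.
Qed.

Lemma aten_r f g : aten f g = acomp (aten (aid (dom f)) g) (aten f (aid (cod g))).
Proof. rewrite <- aten_acomp, aid_l, aid_r; auto. Qed.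

Lemma aten_l f g : aten f g = acomp (aten f (aid (dom g))) (aten (aid (cod f)) g).
Proof. rewrite <- aten_acomp, aid_l, aid_r; auto. Qed.

Lemma prA f g h : dom f = dom g -> dom g = dom h -> pr (pr f g) h = pr f (pr g h).
Proof.
intros e e'; unfold pr; rewrite !dom_acomp; simpl.
assert (H : aten (acomp (cp (dom f)) (aten f g)) h
  = acomp (aten (cp (dom f)) (aid (dom h))) (aten (aten f g) h)).
{ rewrite <- aten_acomp, aid_l by dc; reflexivity. }
assert (K : aten f (acomp (cp (dom g)) (aten g h))
  = acomp (aten (aid (dom f)) (cp (dom g))) (aten f (aten g h))).
{ rewrite <- aten_acomp, aid_l by dc; reflexivity. }
rewrite H, K, <- !acompA by dc.
rewrite <- e', <- e, cp_coassoc, atenA; reflexivity.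
Qed.

Lemma pr_sw f g : dom f = dom g -> acomp (pr f g) (sw (cod f) (cod g)) = pr g f.
Proof.
intros e; unfold pr; rewrite acompA by dc.
rewrite sw_nat, <- acompA by dc.
now rewrite <- e, cp_sw.
Qed.

Lemma pr_dl_r f : pr f (dl (dom f)) = f.
Proof.
unfold pr; rewrite aten_r, <- acompA by dc; simpl.
rewrite cp_dl_r, aid_l by dc; apply aten1r.
Qed.

Lemma pr_dl_l f : pr (dl (dom f)) f = f.
Proof.
unfold pr; simpl; rewrite aten_l, <- acompA by dc; simpl.
rewrite cp_dl_l, aid_l by dc; apply aten1l.
Qed.

Lemma pr_p1 f g : dom f = dom g -> acomp (pr f g) (p1 (cod f) (cod g)) = f.
Proof.
intros e; unfold p1; rewrite pr_ten, aid_r, dl_nat, <- e by dc; apply pr_dl_r.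
Qed.

Lemma pr_p2 f g : dom f = dom g -> acomp (pr f g) (p2 (cod f) (cod g)) = g.
Proof.
intros e; unfold p2; rewrite pr_ten, aid_r, dl_nat, e by dc; apply pr_dl_l.
Qed.

Lemma pr_id a : pr (aid a) (aid a) = cp a.
Proof. unfold pr; simpl; rewrite aten_id, aid_r; reflexivity. Qed.

(** It suffices that the projections pair to the identity. By [cp_ten], copying a tensor interleaves
    two copies by a swap; the deletions absorb this swap and then cancel the copies. *)
Lemma aten_p1p2 f g : aten f g = pr (acomp (p1 (dom f) (dom g)) f) (acomp (p2 (dom f) (dom g)) g).
Proof.
assert (H : pr (p1 (dom f) (dom g)) (p2 (dom f) (dom g)) = aid (dom f ⊗ dom g)).
{ unfold pr, p1, p2; simpl; rewrite cp_ten, acompA by dc.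
  rewrite !atenA, <- (atenA (dl (dom g))), <- aten_acomp, aid_l by dc.
  rewrite <- (aten_acomp (f := sw _ _)), aid_l by dc.
  assert (E : acomp (sw (dom f) (dom g)) (aten (dl (dom g)) (dl (dom f))) = aten (dl (dom f)) (dl (dom g))).
  { rewrite <- dl_ten; rewrite (dl_nat (f := sw _ _)) by dc; simpl; apply dl_ten. }
  rewrite E.
  rewrite (atenA (dl _)), <- (atenA (aid _)), <- aten_acomp by dc.
  rewrite cp_dl_l, cp_dl_r; apply aten_id. }
rewrite <- (aid_l (f := aten f g) (a := dom f ⊗ dom g)) by reflexivity.
rewrite <- H, pr_ten; auto; unfold p1, p2; dc.
Qed.

Lemma p1p2_id a b : pr (p1 a b) (p2 a b) = aid (a ⊗ b).
Proof.
pose proof (aten_p1p2 (aid a) (aid b)) as H; simpl in H.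
rewrite aten_id, !aid_r in H by (unfold p1, p2; dc); now symmetry.
Qed.

Lemma det_aid a : adet (aid a).
Proof. unfold adet; simpl; rewrite aten_id, aid_l, aid_r; reflexivity. Qed.

Lemma det_dl a : adet (dl a).
Proof.
unfold adet; simpl; rewrite cp_one, aid_r by reflexivity.
change (dl a = pr (dl (dom (dl a))) (dl a)); now rewrite pr_dl_l.
Qed.

Lemma det_comp f g : adet f -> adet g -> cod f = dom g -> adet (acomp f g).
Proof.
intros D D' e; unfold adet in *.
rewrite cod_acomp, dom_acomp, acompA, D' by dc.
rewrite <- acompA, <- e, D, acompA, <- aten_acomp by dc; reflexivity.
Qed.

Lemma det_ten f g : adet f -> adet g -> adet (aten f g).
Proof.
intros D D'; unfold adet in *; simpl.
rewrite !cp_ten, <- acompA, <- aten_acomp, D, D', aten_acomp by dc.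
rewrite !acompA by dc; f_equal.
transitivity (aten f (aten (acomp (sw (dom f) (dom g)) (aten g f)) g)).
- rewrite <- sw_nat, !atenA, <- (atenA f g), <- aten_acomp by dc.
  rewrite aid_r, <- aten_acomp, aid_r by dc; reflexivity.
- rewrite !atenA, <- (atenA g f), <- aten_acomp by dc.
  rewrite aid_l, <- aten_acomp, aid_l by dc; reflexivity.
Qed.

(** Copying twice gives four equal outputs, and [cp_ten] exchanges the middle two. Coassociativity
    regroups these two as a single copy, which absorbs the swap by cocommutativity. *)
Lemma det_cp a : adet (cp a).
Proof.
unfold adet; simpl; rewrite cp_ten, <- acompA by dc.
set (i := aid a).
assert (H : acomp (cp a) (aten (cp a) (cp a)) = pr i (pr (pr i i) i)).
{ transitivity (pr (pr i i) (pr i i)).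
  - unfold i; rewrite (pr_id a); reflexivity.
  - rewrite !prA by (rewrite ?dom_pr; reflexivity); reflexivity. }
rewrite H, pr_ten by (rewrite ?dom_pr, ?cod_pr; rewrite ?dom_pr, ?cod_pr; dc).
rewrite pr_ten by (rewrite ?dom_pr, ?cod_pr; dc).
pose proof (pr_sw (f := i) (g := i) eq_refl) as K; simpl in K.
rewrite K; unfold i; rewrite !aid_r by reflexivity; reflexivity.
Qed.

Lemma det_pair f g : adet f -> adet g -> dom f = dom g -> adet (pr f g).
Proof.
intros D D' e; unfold pr; apply det_comp; [apply det_cp|now apply det_ten|simpl; congruence].
Qed.

Lemma det_p1 a b : adet (p1 a b).
Proof. apply det_ten; [apply det_aid|apply det_dl]. Qed.

Lemma det_p2 a b : adet (p2 a b).
Proof. apply det_ten; [apply det_dl|apply det_aid]. Qed.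

Lemma p1_id_pr a b : pr (p1 a b) (aid (a ⊗ b)) = aten (cp a) (aid b).
Proof.
rewrite aten_p1p2; simpl; rewrite <- pr_id, det_pr by (apply det_p1 || (unfold p1; dc)).
rewrite !aid_r by (unfold p1, p2; dc).
rewrite prA, p1p2_id by (unfold p1, p2; dc); reflexivity.
Qed.

(* Whatever does not depend on the draw [f] can be computed before it. *)
Lemma let_pr_l f h k : dom f = dom h -> dom k = dom f ⊗ cod f ->
  acomp (pr (aid (dom f)) f) (pr (acomp (p1 (dom f) (cod f)) h) k)
  = pr h (acomp (pr (aid (dom f)) f) k).
Proof.
intros e e'.
assert (H : pr (acomp (p1 (dom f) (cod f)) h) k
  = acomp (aten (cp (dom f)) (aid (cod f))) (aten h k)).
{ rewrite <- p1_id_pr, pr_ten, aid_l by (unfold p1; dc); reflexivity. }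
rewrite H, <- acompA, pr_ten, aid_l, aid_r, <- pr_id by dcp.
rewrite prA, pr_ten, aid_l by dcp; reflexivity.
Qed.

Lemma let_pr_r f h k : dom f = dom h -> dom k = dom f ⊗ cod f ->
  acomp (pr (aid (dom f)) f) (pr k (acomp (p1 (dom f) (cod f)) h))
  = pr (acomp (pr (aid (dom f)) f) k) h.
Proof.
intros e e'.
assert (K : dom (acomp (p1 (dom f) (cod f)) h) = dom k) by (unfold p1; dc).
rewrite <- (pr_sw K), <- acompA, let_pr_l by (unfold p1; dcp).
assert (L : dom h = dom (acomp (pr (aid (dom f)) f) k)) by dcp.
rewrite <- (pr_sw L); f_equal; f_equal; rewrite !cod_acomp; unfold p1; dcp.
Qed.

(** Two draws of which the second ignores the first amount to one pairing, whose factors a symmetry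
    can exchange. *)
Lemma let_let f g : dom f = dom g ->
  acomp (pr (aid (dom f)) f)
        (pr (aid (dom f ⊗ cod f)) (acomp (p1 (dom f) (cod f)) g))
  = pr (aid (dom f)) (pr f g).
Proof.
intros e; rewrite let_pr_r, aid_r, prA by dcp; reflexivity.
Qed.
End Markov.

(** * Structural arrows *)

Section Tuples.
Context {C : markov_category}.
Implicit Types (a b c : C) (l m : list C) (i j k : nat) (js ks : list nat).

(** Unlike [tens], this has no special case for singletons, so that it unfolds to a tensor at every
    [cons]; strict unitality makes both the same object. *)
Fixpoint T l : C := match l with [] => one | a :: l' => a ⊗ T l' end.

Lemma tens_T l : tens l = T l.
Proof.
induction l as [|a l IH]; [reflexivity|]; rewrite tens_cons; simpl; now rewrite IH.
Qed.

Lemma T_app l m : T (l ++ m) = T l ⊗ T m.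
Proof.
induction l as [|a l IH]; simpl; [now rewrite ten1l|now rewrite IH, tenA].
Qed.

Fixpoint pj l i : arr C :=
  match l, i with
  | [], _ => aid one
  | a :: l', 0 => p1 a (T l')
  | a :: l', S j => aten (dl a) (pj l' j)
  end.

Fixpoint tup l js : arr C :=
  match js with
  | [] => dl (T l)
  | j :: js' => pr (pj l j) (tup l js')
  end.

Lemma dom_pj l i : dom (pj l i) = T l.
Proof. revert i; induction l; intros [|i]; simpl; try reflexivity; now rewrite IHl. Qed.

Lemma cod_pj l i : cod (pj l i) = nth i l one.
Proof.
revert i; induction l; intros [|i]; simpl; try reflexivity; [apply ten1r|].
now rewrite IHl, ten1l.
Qed.

Lemma det_pj l i : adet (pj l i).
Proof.
revert i; induction l; intros [|i]; simpl; try apply det_aid; [apply det_p1|].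
apply det_ten; [apply det_dl|apply IHl].
Qed.

Lemma dom_tup l js : dom (tup l js) = T l.
Proof. destruct js; simpl; [reflexivity|]; rewrite dom_pr; apply dom_pj. Qed.

Lemma cod_tup l js : cod (tup l js) = T (map (fun j => nth j l one) js).
Proof.
induction js; simpl; [reflexivity|].
rewrite cod_pr, IHjs, cod_pj by now rewrite dom_pj, dom_tup.
reflexivity.
Qed.

Lemma det_tup l js : adet (tup l js).
Proof.
induction js; simpl; [apply det_dl|].
apply det_pair; [apply det_pj|assumption|now rewrite dom_pj, dom_tup].
Qed.

Lemma Arr_par (l l' m m' : list C) (f : mor l m) (g : mor l' m') :
  Arr (par f g) = aten (Arr f) (Arr g).
Proof. unfold par; now rewrite Arr_eqr, Arr_eql. Qed.

Lemma Arr_mcomp (l m n : list C) (f : mor l m) (g : mor m n) :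
  Arr (f ;; g) = acomp (Arr f) (Arr g).
Proof. unfold mcomp; now rewrite acompE. Qed.

Lemma Arr_idw l : Arr (idw l) = aid (T l).
Proof. unfold idw; now rewrite <- tens_T. Qed.

Lemma Arr_del_tens l : Arr (del (tens l)) = dl (T l).
Proof. now rewrite <- tens_T. Qed.

Lemma Arr_proj l i : Arr (proj l i) = pj l i.
Proof.
revert i; induction l as [|a l IH]; intros [|i]; simpl; try exact (Arr_idw []).
- etransitivity; [exact (@Arr_par [a] l [a] [] (idw [a]) (del (tens l)))|].
  rewrite Arr_idw, Arr_del_tens; simpl; now rewrite ten1r.
- etransitivity; [exact (@Arr_par [a] l [] [nth i l one] (del a) (proj l i))|].
  now rewrite IH.
Qed.

Lemma Arr_wire l js : Arr (wire l js) = tup l js.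
Proof.
induction js as [|j js IH]; simpl.
- apply Arr_del_tens.
- etransitivity; [exact (@Arr_mcomp l (l ++ l) ([nth j l one] ++ map (fun j => nth j l one) js)
    (copy (tens l) >> eqhom (eq_sym (tens_app l l))) (par (proj l j) (wire l js)))|].
  rewrite Arr_eqr, Arr_par, IH, Arr_proj.
  unfold pr; rewrite dom_pj, <- tens_T; reflexivity.
Qed.

Definition inr n js : bool := forallb (fun j => j <? n) js.

Lemma inr_cons n j js : inr n (j :: js) = true <-> j < n /\ inr n js = true.
Proof. simpl; rewrite andb_true_iff, Nat.ltb_lt; tauto. Qed.

Lemma inr_app n js ks : inr n (js ++ ks) = true <-> inr n js = true /\ inr n ks = true.
Proof. unfold inr; rewrite forallb_app, andb_true_iff; tauto. Qed.

Lemma inr_le n n' js : n <= n' -> inr n js = true -> inr n' js = true.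
Proof.
intros L; induction js as [|j js IH]; [reflexivity|].
rewrite !inr_cons; intuition lia.
Qed.

Lemma inr_seq n s k : s + k <= n -> inr n (seq s k) = true.
Proof.
revert s; induction k; intros s L; [reflexivity|].
simpl seq; rewrite inr_cons; split; [lia|]; apply IHk; lia.
Qed.

Lemma tup_pj l js k : k < length js ->
  acomp (tup l js) (pj (map (fun j => nth j l one) js) k) = pj l (nth k js 0).
Proof.
revert k; induction js as [|j js IH]; intros k L; [simpl in L; lia|].
assert (E : dom (pj l j) = dom (tup l js)) by now rewrite dom_pj, dom_tup.
destruct k as [|k]; simpl.
- rewrite <- cod_tup, <- cod_pj; now apply pr_p1.
- rewrite pr_ten, dl_nat, E by (rewrite ?cod_pj, ?cod_tup, ?dom_pj, ?dom_tup; simpl; reflexivity).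
  rewrite IH by (simpl in L; lia).
  rewrite dom_tup, <- (dom_pj l (nth k js 0)); apply pr_dl_l.
Qed.

(** Structural arrows compose like substitutions because the first one is deterministic and
    therefore distributes over the pairing that builds the second. *)
Lemma tup_tup l js ks : inr (length js) ks = true ->
  acomp (tup l js) (tup (map (fun j => nth j l one) js) ks)
  = tup l (map (fun k => nth k js 0) ks).
Proof.
induction ks as [|k ks IH]; simpl map; simpl tup.
- intros _; rewrite dl_nat, dom_tup by apply cod_tup; reflexivity.
- rewrite inr_cons; intros [L R].
  rewrite det_pr, tup_pj, IH; auto; [apply det_tup|..];
    now rewrite ?cod_tup, ?dom_pj, ?dom_tup.
Qed.

Lemma pj_app_l l m i : i < length l -> pj (l ++ m) i = aten (pj l i) (dl (T m)).
Proof.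
revert i; induction l as [|a l IH]; intros i L; simpl in L; [lia|].
destruct i as [|i]; simpl.
- now rewrite T_app; unfold p1; rewrite dl_ten, atenA.
- rewrite IH by lia; now rewrite atenA.
Qed.

Lemma pj_app_r l m i : pj (l ++ m) (length l + i) = aten (dl (T l)) (pj m i).
Proof.
induction l as [|a l IH]; simpl.
- now rewrite dl_one, aten1l.
- now rewrite IH, dl_ten, atenA.
Qed.

Lemma tup_app l js ks : tup l (js ++ ks) = pr (tup l js) (tup l ks).
Proof.
induction js as [|j js IH]; simpl.
- rewrite <- (dom_tup l ks), pr_dl_l; reflexivity.
- rewrite IH, prA; auto; now rewrite ?dom_pj, ?dom_tup.
Qed.

Lemma tup_p1 l m js : inr (length l) js = true ->
  tup (l ++ m) js = acomp (p1 (T l) (T m)) (tup l js).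
Proof.
induction js as [|j js IH].
- intros _; simpl; rewrite dl_nat by apply ten1r; simpl; now rewrite T_app.
- rewrite inr_cons; intros [L R]; simpl.
  rewrite det_pr, IH, pj_app_l; auto using det_p1.
  + f_equal; unfold p1; rewrite aten_l; simpl.
    rewrite <- (aten1r (pj l j)) at 3; rewrite <- !aten_acomp; simpl;
      rewrite ?dom_pj; auto.
    rewrite aid_l, aid_r, aid_r, aid_l by (simpl; rewrite ?dom_pj; auto); reflexivity.
  + simpl; rewrite dom_pj; apply ten1r.
  + now rewrite dom_pj, dom_tup.
Qed.

Lemma p2_acomp a b f : dom f = b -> acomp (p2 a b) f = aten (dl a) f.
Proof.
intros <-; unfold p2; rewrite <- (aten1l f) at 2; rewrite <- aten_acomp by reflexivity.
now rewrite aid_l, aid_r.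
Qed.

Lemma tup_p2 l m js :
  tup (l ++ m) (map (fun j => length l + j) js) = acomp (p2 (T l) (T m)) (tup m js).
Proof.
induction js as [|j js IH]; simpl.
- rewrite dl_nat by apply ten1l; simpl; now rewrite T_app.
- rewrite det_pr, IH, pj_app_r; auto using det_p2.
  + f_equal; unfold p2.
    rewrite <- (aten1l (pj m j)) at 2; rewrite <- !aten_acomp; simpl;
      rewrite ?dom_pj; auto.
    rewrite aid_l, aid_r by (simpl; rewrite ?dom_pj; auto); reflexivity.
  + simpl; rewrite dom_pj; apply ten1l.
  + now rewrite dom_pj, dom_tup.
Qed.

Lemma map_add_seq n s k : map (fun j => n + j) (seq s k) = seq (n + s) k.
Proof.
revert s; induction k; intros s; simpl; [reflexivity|].
rewrite IHk; do 2 f_equal; lia.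
Qed.

Lemma tup_seq l : tup l (seq 0 (length l)) = aid (T l).
Proof.
induction l as [|a l IH]; simpl; [apply dl_one|].
rewrite <- (p1p2_id a (T l)); f_equal.
pose proof (tup_p2 [a] l (seq 0 (length l))) as H; simpl in H.
rewrite IH, ten1r, aid_r in H by apply ten1l.
rewrite <- H; f_equal; now rewrite <- seq_shift.
Qed.

Lemma tup_fst l m : tup (l ++ m) (seq 0 (length l)) = p1 (T l) (T m).
Proof.
rewrite tup_p1 by (apply inr_seq; lia).
rewrite tup_seq, aid_r; [reflexivity|apply ten1r].
Qed.

Lemma tup_snd l m : tup (l ++ m) (seq (length l) (length m)) = p2 (T l) (T m).
Proof.
rewrite <- (Nat.add_0_r (length l)) at 1; rewrite <- map_add_seq, tup_p2, tup_seq, aid_r.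
- reflexivity.
- apply ten1l.
Qed.

Lemma tup_ten l m js : inr (length l) js = true ->
  tup (l ++ m) (js ++ seq (length l) (length m)) = aten (tup l js) (aid (T m)).
Proof.
intros R; rewrite tup_app, tup_p1, tup_snd by assumption.
rewrite aten_p1p2, dom_tup; simpl; rewrite (aid_r (f := p2 _ _)) by apply ten1l.
reflexivity.
Qed.
End Tuples.

(** * Programs denoting string diagrams *)

(* [Let g as p] draws the outputs of the generator [g] from the variables [as]
   and then runs [p]. Variables are de Bruijn levels: the outputs of a [Let] in a
   context of [n] variables are numbered from [n]. *)
Inductive prog :=
| Ret (js : list nat)
| Let (g : nat) (js : list nat) (p : prog).

(* Input sorts, output sorts, and whether the generator is known to be
   deterministic. *)
Definition signature := list (list nat * list nat * bool).

Definition list_eqb (l m : list nat) : bool :=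
  if list_eq_dec Nat.eq_dec l m then true else false.

Lemma list_eqbP l m : list_eqb l m = true <-> l = m.
Proof. unfold list_eqb; destruct list_eq_dec; intuition congruence. Qed.

Fixpoint prog_eqb (p q : prog) : bool :=
  match p, q with
  | Ret js, Ret ks => list_eqb js ks
  | Let g js p', Let h ks q' => (g =? h) && list_eqb js ks && prog_eqb p' q'
  | _, _ => false
  end.

Lemma prog_eqbP p q : prog_eqb p q = true -> p = q.
Proof.
revert q; induction p; intros [|]; simpl; try discriminate.
- now intros ->%list_eqbP.
- rewrite !andb_true_iff; intros [[->%Nat.eqb_eq ->%list_eqbP] H]; f_equal; auto.
Qed.

Section Programs.
Variable sg : signature.

(** By the default value, an index outside the signature names a deterministic generator without
    wires. It is interpreted by [aid one], so that [valid] can range over all numbers. *)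
Definition gin g := fst (fst (nth g sg ([], [], true))).
Definition gout g := snd (fst (nth g sg ([], [], true))).
Definition gdet g := snd (nth g sg ([], [], true)).
Definition gar g := length (gout g).

Definition at_ (G : list nat) (js : list nat) := map (fun j => nth j G 0) js.

Fixpoint wf (G : list nat) (p : prog) : bool :=
  match p with
  | Ret js => inr (length G) js
  | Let g js p' => inr (length G) js && list_eqb (at_ G js) (gin g) && wf (G ++ gout g) p'
  end.

Fixpoint out (G : list nat) (p : prog) : list nat :=
  match p with
  | Ret js => at_ G js
  | Let g js p' => out (G ++ gout g) p'
  end.

Definition sel (js ks : list nat) := map (fun k => nth k js 0) ks.

(* Rename a program along [js], into a context of [n] variables. *)
Fixpoint ren (n : nat) (js : list nat) (p : prog) : prog :=
  match p with
  | Ret ks => Ret (sel js ks)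
  | Let g ks p' => Let g (sel js ks) (ren (n + gar g) (js ++ seq n (gar g)) p')
  end.

(* What remains after the first draw of [g] from [js] when that draw is moved to the
   front, so that its outputs are the variables [n], .., [n + gar g - 1]. *)
Fixpoint pull (n g : nat) (js : list nat) (p : prog) : option prog :=
  match p with
  | Ret _ => None
  | Let h ks p' =>
      if (g =? h) && list_eqb js ks then Some p'
      else match pull (n + gar h) g js p' with
           | Some p'' =>
               Some (Let h ks (ren (n + gar g + gar h)
                 (seq 0 n ++ seq (n + gar g) (gar h) ++ seq n (gar g)) p''))
           | None => None
           end
  end.

Fixpoint dce (G : list nat) (p : prog) : prog :=
  match p with
  | Ret js => p
  | Let g js p' =>
      let n := length G in
      let p1 := dce (G ++ gout g) p' in
      let p0 := ren n (seq 0 n ++ repeat 0 (gar g)) p1 in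
      if prog_eqb (ren (n + gar g) (seq 0 n) p0) p1 && wf G p0 then p0 else Let g js p1
  end.

Fixpoint merge (fuel n : nat) (p : prog) : prog :=
  match fuel, p with
  | S fuel', Let g js p' =>
      let n' := n + gar g in
      if gdet g then
        match pull n' g js p' with
        | Some p'' => merge fuel' n (Let g js (ren n' (seq 0 n' ++ seq n (gar g)) p''))
        | None => Let g js (merge fuel' n' p')
        end
      else Let g js (merge fuel' n' p')
  | _, _ => p
  end.

(** Each draw of [q] is brought to the front of [p], wherever it stands. The levels of the variables
    then agree, so that the final outputs can be compared literally. *)
Fixpoint eqv (n : nat) (q p : prog) : bool :=
  match q with
  | Ret js => prog_eqb p q
  | Let g js q' =>
      match pull n g js p with
      | Some p' => inr n js && eqv (n + gar g) q' p'
      | None => false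
      end
  end.

Fixpoint psize (p : prog) : nat :=
  match p with Ret _ => 0 | Let _ _ p' => S (psize p') end.

(** Every call of [merge] either fuses two draws or passes under one, and recurs on a program with
    one draw less; the fuel is therefore ample. Soundness holds for any fuel. *)
Definition norm (G : list nat) (p : prog) : prog :=
  dce G (merge (2 * psize p) (length G) p).

Definition equivb (G : list nat) (p q : prog) : bool :=
  wf G p && wf G q && eqv (length G) (norm G q) (norm G p).

Fixpoint seqp (n : nat) (p q : prog) : prog :=
  match p with
  | Ret js => ren n js q
  | Let g js p' => Let g js (seqp (n + gar g) p' q)
  end.

Fixpoint prep (js : list nat) (q : prog) : prog :=
  match q with
  | Ret ks => Ret (js ++ ks)
  | Let g ks q' => Let g ks (prep js q')
  end.

Fixpoint pairp (n : nat) (p q : prog) : prog :=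
  match p with
  | Ret js => prep js q
  | Let g js p' => Let g js (pairp (n + gar g) p' (ren (n + gar g) (seq 0 n) q))
  end.

Definition parp (n m : nat) (p q : prog) : prog :=
  pairp (n + m) (ren (n + m) (seq 0 n) p) (ren (n + m) (seq n m) q).

(** ** Soundness *)

Context {C : markov_category} (ov : nat -> C) (gv : nat -> arr C).

Definition TS (G : list nat) : C := T (map ov G).

Definition valid : Prop := forall g,
  dom (gv g) = TS (gin g) /\ cod (gv g) = TS (gout g) /\
  (gdet g = true -> adet (gv g)).

Definition tupS (G : list nat) js := tup (map ov G) js.

Fixpoint den (G : list nat) (p : prog) : arr C :=
  match p with
  | Ret js => tupS G js
  | Let g js p' =>
      acomp (pr (aid (TS G)) (acomp (tupS G js) (gv g))) (den (G ++ gout g) p')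
  end.

Hypothesis V : valid.

Lemma TS_app G H : TS (G ++ H) = TS G ⊗ TS H.
Proof. unfold TS; now rewrite map_app, T_app. Qed.

Lemma at_map G js : inr (length G) js = true ->
  map (fun j => nth j (map ov G) one) js = map ov (at_ G js).
Proof.
unfold at_; intros R; rewrite map_map; apply map_ext_in; intros j I.
apply (proj1 (forallb_forall _ _) R) in I; apply Nat.ltb_lt in I.
rewrite nth_indep with (d' := ov 0) by (rewrite length_map; auto).
apply map_nth.
Qed.

Lemma dom_tupS G js : dom (tupS G js) = TS G.
Proof. apply dom_tup. Qed.

Lemma cod_tupS G js : inr (length G) js = true -> cod (tupS G js) = TS (at_ G js).
Proof. intros R; unfold tupS; now rewrite cod_tup, at_map. Qed.

Lemma tupS_tupS G js ks : inr (length G) js = true -> inr (length js) ks = true ->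
  acomp (tupS G js) (tupS (at_ G js) ks) = tupS G (sel js ks).
Proof. intros R R'; unfold tupS; rewrite <- at_map by auto; now apply tup_tup. Qed.

Lemma tupS_fst G H : tupS (G ++ H) (seq 0 (length G)) = p1 (TS G) (TS H).
Proof. unfold tupS; rewrite map_app, <- (length_map ov G); apply tup_fst. Qed.

Lemma tupS_snd G H : tupS (G ++ H) (seq (length G) (length H)) = p2 (TS G) (TS H).
Proof.
unfold tupS; rewrite map_app, <- (length_map ov G), <- (length_map ov H); apply tup_snd.
Qed.

Lemma tupS_id G : tupS G (seq 0 (length G)) = aid (TS G).
Proof. unfold tupS; rewrite <- (length_map ov G); apply tup_seq. Qed.

Lemma tupS_ten G H js : inr (length G) js = true ->
  tupS (G ++ H) (js ++ seq (length G) (length H)) = aten (tupS G js) (aid (TS H)).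
Proof.
intros R; unfold tupS; rewrite map_app, <- (length_map ov G), <- (length_map ov H).
apply tup_ten; now rewrite length_map.
Qed.

Lemma tupS_app G js ks : tupS G (js ++ ks) = pr (tupS G js) (tupS G ks).
Proof. apply tup_app. Qed.

Lemma det_tupS G js : adet (tupS G js).
Proof. apply det_tup. Qed.

Lemma tupS_p1 G H js : inr (length G) js = true ->
  tupS (G ++ H) js = acomp (p1 (TS G) (TS H)) (tupS G js).
Proof. intros R; unfold tupS; rewrite map_app; apply tup_p1; now rewrite length_map. Qed.

Lemma length_at G js : length (at_ G js) = length js.
Proof. apply length_map. Qed.

Lemma at_sel G js ks : inr (length js) ks = true -> at_ G (sel js ks) = at_ (at_ G js) ks.
Proof.
unfold at_, sel; intros R; rewrite map_map; apply map_ext_in; intros k I.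
apply (proj1 (forallb_forall _ _) R) in I; apply Nat.ltb_lt in I.
rewrite (nth_indep (map (fun j => nth j G 0) js) (n := k) 0 (nth 0 G 0)) by (rewrite length_map; auto).
now rewrite (map_nth (fun j => nth j G 0)).
Qed.

Lemma at_app_l G H js : inr (length G) js = true -> at_ (G ++ H) js = at_ G js.
Proof.
unfold at_; intros R; apply map_ext_in; intros j I.
apply (proj1 (forallb_forall _ _) R) in I; apply Nat.ltb_lt in I; now apply app_nth1.
Qed.

Lemma at_app G js ks : at_ G (js ++ ks) = at_ G js ++ at_ G ks.
Proof. apply map_app. Qed.

Lemma at_seq_shift A G H : at_ (A ++ G ++ H) (seq (length A) (length G)) = G.
Proof.
unfold at_; revert A; induction G as [|x G IH]; intros A; [reflexivity|]; simpl.
rewrite nth_middle; f_equal.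
specialize (IH (A ++ [x])); rewrite length_app, Nat.add_1_r in IH; simpl in IH.
rewrite <- app_assoc in IH; exact IH.
Qed.

Lemma at_seq G : at_ G (seq 0 (length G)) = G.
Proof. pose proof (at_seq_shift [] G []) as H; now rewrite app_nil_r in H. Qed.

Lemma at_seq_snd G H : at_ (G ++ H) (seq (length G) (length H)) = H.
Proof. pose proof (at_seq_shift G H []) as K; now rewrite app_nil_r in K. Qed.

Lemma at_seq_fst G H : at_ (G ++ H) (seq 0 (length G)) = G.
Proof. apply (at_seq_shift [] G H). Qed.

Lemma inr_sel n js ks : inr n js = true -> inr (length js) ks = true -> inr n (sel js ks) = true.
Proof.
intros R; induction ks as [|k ks IH]; [reflexivity|]; simpl sel; rewrite !inr_cons.
intros [L R']; split; auto.
apply (nth_In js 0) in L; apply (proj1 (forallb_forall _ _) R) in L.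
now apply Nat.ltb_lt.
Qed.

Lemma wf_ren p G D js : wf G p = true -> inr (length D) js = true -> at_ D js = G ->
  wf D (ren (length D) js p) = true.
Proof.
revert G D js; induction p as [ks|g ks p IH]; intros G D js; simpl; intros W R <-.
- rewrite length_at in W; now apply inr_sel.
- rewrite !andb_true_iff in *; destruct W as [[W1 W2%list_eqbP] W3].
  rewrite length_at in W1; repeat split.
  + now apply inr_sel.
  + now apply list_eqbP; rewrite at_sel.
  + unfold gar at 1; rewrite <- length_app.
    refine (IH _ _ _ W3 _ _).
    * rewrite length_app; apply inr_app; split; [eapply inr_le; [|eassumption]; lia|].
      now apply inr_seq.
    * rewrite at_app, at_app_l by assumption; f_equal; apply at_seq_snd.
Qed.

Lemma dom_den G p : dom (den G p) = TS G.
Proof. destruct p; simpl; [apply dom_tupS|]; now rewrite dom_acomp, dom_pr. Qed.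

Lemma dom_gv g : dom (gv g) = TS (gin g).
Proof. apply V. Qed.

Lemma cod_gv g : cod (gv g) = TS (gout g).
Proof. apply V. Qed.

Definition draw G g js : arr C := acomp (tupS G js) (gv g).

Lemma dom_draw G g js : dom (draw G g js) = TS G.
Proof. unfold draw; now rewrite dom_acomp, dom_tupS. Qed.

Lemma composable G g js : inr (length G) js = true -> at_ G js = gin g ->
  cod (tupS G js) = dom (gv g).
Proof. intros R e; now rewrite cod_tupS, dom_gv, e. Qed.

Lemma cod_draw G g js : inr (length G) js = true -> at_ G js = gin g ->
  cod (draw G g js) = TS (gout g).
Proof. intros R e; unfold draw; rewrite cod_acomp, cod_gv; auto using composable. Qed.

Lemma den_Let G g js p : den G (Let g js p)
  = acomp (pr (aid (TS G)) (draw G g js)) (den (G ++ gout g) p).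
Proof. reflexivity. Qed.

Lemma let_composable G g js p : inr (length G) js = true -> at_ G js = gin g ->
  cod (pr (aid (TS G)) (draw G g js)) = dom (den (G ++ gout g) p).
Proof.
intros R e; rewrite cod_pr, cod_draw, dom_den, TS_app; auto; now rewrite dom_draw.
Qed.

Lemma cod_den G p : wf G p = true -> cod (den G p) = TS (out G p).
Proof.
revert G; induction p as [ks|g ks p IH]; intros G; simpl wf; [apply cod_tupS|].
rewrite !andb_true_iff; intros [[W1 W2%list_eqbP] W3].
rewrite den_Let, cod_acomp by now apply let_composable.
now apply IH.
Qed.

Lemma draw_ren G D g js ks : inr (length D) js = true -> at_ D js = G ->
  inr (length G) ks = true -> at_ G ks = gin g ->
  acomp (tupS D js) (draw G g ks) = draw D g (sel js ks).
Proof.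
intros R <- R' e; unfold draw; rewrite length_at in R'.
rewrite <- tupS_tupS, acompA; auto.
- now rewrite cod_tupS, dom_tupS.
- apply composable; auto; now rewrite length_at.
Qed.

(** A renaming acts as precomposition with a deterministic arrow, which passes through the copy of
    the context made by each draw. *)
Lemma den_ren p G D js : wf G p = true -> inr (length D) js = true -> at_ D js = G ->
  acomp (tupS D js) (den G p) = den D (ren (length D) js p).
Proof.
revert G D js; induction p as [ks|g ks p IH]; intros G D js; simpl wf; intros W R e.
- subst G; rewrite length_at in W; now apply tupS_tupS.
- rewrite !andb_true_iff in W; destruct W as [[W1 W2%list_eqbP] W3].
  simpl ren; rewrite !den_Let.
  assert (J : inr (length (D ++ gout g)) (js ++ seq (length D) (gar g)) = true).
  { rewrite length_app; apply inr_app; split;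
      [eapply inr_le; [|eassumption]; lia|now apply inr_seq]. }
  assert (K : at_ (D ++ gout g) (js ++ seq (length D) (gar g)) = G ++ gout g).
  { rewrite at_app, at_app_l, e by assumption; f_equal; apply at_seq_snd. }
  unfold gar at 1; rewrite <- length_app, <- (IH (G ++ gout g)) by assumption.
  unfold gar; rewrite tupS_ten by assumption.
  assert (cU : cod (tupS D js) = TS G) by (rewrite cod_tupS, e; auto).
  assert (I1 : inr (length D) (sel js ks) = true).
  { apply inr_sel; auto; subst G; now rewrite length_at in W1. }
  assert (I2 : at_ D (sel js ks) = gin g).
  { subst G; rewrite length_at in W1; now rewrite at_sel. }
  rewrite <- acompA; [|now rewrite dom_pr|now apply let_composable].
  rewrite det_pr, draw_ren, aid_r; auto using det_tupS; try (now rewrite dom_draw).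
  rewrite <- acompA.
  + f_equal; rewrite pr_ten, aid_l, aid_r; auto using dom_tupS, cod_draw.
    now rewrite dom_draw.
  + rewrite cod_pr, cod_draw; auto; simpl; [now rewrite dom_tupS|now rewrite dom_draw].
  + simpl; now rewrite cU, dom_den, TS_app.
Qed.

Lemma tupS_par G H js ks : inr (length G) js = true ->
  tupS (G ++ H) (js ++ map (fun j => length G + j) ks) = aten (tupS G js) (tupS H ks).
Proof.
intros R; rewrite tupS_app, tupS_p1, aten_p1p2, !dom_tupS by assumption; f_equal.
unfold tupS, TS; rewrite map_app, <- (length_map ov G); apply tup_p2.
Qed.

(** This identifies the renaming inserted by [pull] with a symmetry. *)
Lemma tupS_exchange G H K :
  tupS ((G ++ K) ++ H)
    (seq 0 (length G) ++ seq (length G + length K) (length H) ++ seq (length G) (length K))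
  = aten (aid (TS G)) (sw (TS K) (TS H)).
Proof.
rewrite <- app_assoc.
assert (E : seq (length G + length K) (length H) ++ seq (length G) (length K)
  = map (fun j => length G + j) (seq (length K) (length H) ++ seq 0 (length K))).
{ now rewrite map_app, !map_add_seq, Nat.add_0_r. }
rewrite E, tupS_par, tupS_id by (apply inr_seq; lia).
f_equal; rewrite tupS_app, tupS_fst, tupS_snd.
rewrite <- pr_sw by reflexivity.
rewrite p1p2_id; unfold p1, p2; simpl; rewrite ten1l, ten1r; apply aid_l; reflexivity.
Qed.

Lemma den_Let_Let G g js h ks p :
  inr (length G) js = true -> at_ G js = gin g ->
  inr (length G) ks = true -> at_ G ks = gin h ->
  den G (Let h ks (Let g js p))
  = acomp (pr (aid (TS G)) (pr (draw G h ks) (draw G g js)))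
      (den ((G ++ gout h) ++ gout g) p).
Proof.
intros Rj ej Rk ek; rewrite !den_Let.
assert (E : draw (G ++ gout h) g js = acomp (p1 (TS G) (TS (gout h))) (draw G g js)).
{ unfold draw; rewrite tupS_p1, acompA; auto using composable.
  rewrite dom_tupS; apply ten1r. }
rewrite E, TS_app, <- acompA.
- pose proof (let_let (f := draw G h ks) (g := draw G g js)) as H.
  rewrite !dom_draw, cod_draw in H by assumption; now rewrite H.
- rewrite cod_pr, dom_pr, cod_draw; auto; now rewrite dom_draw.
- rewrite cod_pr, cod_acomp, cod_draw, dom_den, !TS_app; auto; simpl.
  + rewrite dom_draw; apply ten1r.
  + now rewrite dom_acomp.
Qed.

(** By induction the wanted draw comes directly after that of [h]. Its arguments lie in the context
    [G], before the outputs of [h], so the two draws form a pairing, and exchanging its factors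
    costs one symmetry. *)
Lemma pull_sound p G g js p' : wf G p = true -> inr (length G) js = true ->
  at_ G js = gin g -> pull (length G) g js p = Some p' ->
  wf (G ++ gout g) p' = true /\ den G p = den G (Let g js p').
Proof.
revert G p'; induction p as [ks|h ks p IH]; intros G p'; simpl wf; intros W R e;
  [discriminate|].
rewrite !andb_true_iff in W; destruct W as [[W1 W2%list_eqbP] W3]; simpl.
destruct ((g =? h) && list_eqb js ks) eqn:E.
- apply andb_true_iff in E; destruct E as [->%Nat.eqb_eq ->%list_eqbP].
  intros [= ->]; auto.
- clear E; destruct pull as [p2|] eqn:E; [|discriminate]; intros [= <-].
  unfold gar in E; rewrite <- length_app in E.
  apply IH in E; auto;
    [|eapply inr_le; [|eassumption]; rewrite length_app; lia|now rewrite at_app_l].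
  destruct E as [W4 E].
  set (s := seq 0 (length G) ++ _).
  assert (Rs : inr (length ((G ++ gout g) ++ gout h)) s = true).
  { unfold s, gar; rewrite !length_app, !inr_app; repeat split; apply inr_seq; lia. }
  assert (es : at_ ((G ++ gout g) ++ gout h) s = (G ++ gout h) ++ gout g).
  { unfold s, gar; rewrite <- !app_assoc, !at_app, at_seq_fst, at_seq_shift.
    do 2 f_equal; rewrite app_assoc, <- length_app; apply at_seq_snd. }
  assert (Ws : wf ((G ++ gout g) ++ gout h)
    (ren (length G + gar g + gar h) s p2) = true).
  { unfold gar; rewrite <- !length_app; eapply wf_ren; eassumption. }
  assert (R2 : inr (length (G ++ gout g)) ks = true).
  { eapply inr_le; [|eassumption]; rewrite length_app; lia. }
  split.
  + cbn [wf]; rewrite R2, Ws; rewrite !andb_true_iff; repeat split.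
    apply list_eqbP; now rewrite at_app_l.
  + change (den G (Let h ks p) = den G (Let g js (Let h ks (ren (length G + gar g + gar h) s p2)))).
    rewrite den_Let, E, <- (den_Let G h ks (Let g js p2)), !den_Let_Let; auto.
    unfold gar; rewrite <- !length_app, <- (den_ren W4 Rs es).
    unfold s, gar; rewrite tupS_exchange.
    assert (e1 : dom (draw G h ks) = dom (draw G g js)) by now rewrite !dom_draw.
    rewrite <- acompA.
    * rewrite pr_ten, aid_l; simpl; auto; [|now rewrite cod_pr, !cod_draw
        |now rewrite dom_pr, dom_draw].
      rewrite <- (cod_draw R e), <- (cod_draw W1 W2), pr_sw by auto; reflexivity.
    * rewrite !cod_pr, !cod_draw by (auto; now rewrite ?dom_pr, ?dom_draw); reflexivity.
    * simpl; rewrite dom_den, !TS_app, tenA; reflexivity.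
Qed.

(** For a deterministic generator two equal draws are one draw followed by a copy, and that copy is
    the renaming along [s]. *)
Lemma den_merge G g js p : inr (length G) js = true -> at_ G js = gin g ->
  gdet g = true -> wf ((G ++ gout g) ++ gout g) p = true ->
  let n' := length G + gar g in
  let p' := ren n' (seq 0 n' ++ seq (length G) (gar g)) p in
  wf (G ++ gout g) p' = true /\ den G (Let g js (Let g js p)) = den G (Let g js p').
Proof.
intros R e D W n' p'; unfold p', n', gar; rewrite <- length_app.
set (s := seq 0 _ ++ _).
assert (Rs : inr (length (G ++ gout g)) s = true).
{ unfold s; apply inr_app; split; apply inr_seq; rewrite length_app; lia. }
assert (es : at_ (G ++ gout g) s = (G ++ gout g) ++ gout g).
{ unfold s; now rewrite at_app, at_seq, at_seq_snd. }
split; [eapply wf_ren; eassumption|].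
rewrite den_Let_Let by assumption.
rewrite den_Let, <- (den_ren W Rs es).
assert (F : adet (draw G g js)).
{ apply det_comp; [apply det_tupS|now apply V|now apply composable]. }
assert (Es : tupS (G ++ gout g) s = aten (aid (TS G)) (cp (TS (gout g)))).
{ unfold s; rewrite tupS_app, tupS_id, tupS_snd, TS_app, <- p1p2_id, prA by reflexivity.
  rewrite aten_p1p2; simpl; rewrite aid_r by apply ten1r; f_equal.
  rewrite <- pr_id, det_pr, aid_r by (try apply det_p2; try apply ten1l; reflexivity).
  reflexivity. }
rewrite Es, <- acompA.
- rewrite pr_ten, aid_l by (auto; simpl; now rewrite ?cod_draw, ?dom_draw).
  rewrite <- (cod_draw R e), F; reflexivity.
- rewrite cod_pr, cod_draw by (auto; now rewrite dom_draw); reflexivity.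
- simpl; now rewrite dom_den, !TS_app, tenA.
Qed.

Lemma merge_sound fuel p G : wf G p = true ->
  wf G (merge fuel (length G) p) = true /\ den G (merge fuel (length G) p) = den G p.
Proof.
revert p G; induction fuel as [|fuel IH]; intros [ks|g ks p] G W; auto.
pose proof W as W0; simpl in W0; rewrite !andb_true_iff in W0.
destruct W0 as [[W1 W2%list_eqbP] W3].
assert (K : wf G (Let g ks (merge fuel (length G + gar g) p)) = true /\
  den G (Let g ks (merge fuel (length G + gar g) p)) = den G (Let g ks p)).
{ unfold gar; rewrite <- length_app; destruct (IH p (G ++ gout g) W3) as [A B].
  simpl wf; rewrite A, W1, (proj2 (list_eqbP _ _) W2); now rewrite !den_Let, B. }
simpl merge; destruct (gdet g) eqn:D; [|exact K].
destruct pull as [p2|] eqn:E; [|exact K].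
unfold gar in E; rewrite <- length_app in E; apply pull_sound in E; auto;
  [|eapply inr_le; [|eassumption]; rewrite length_app; lia|now rewrite at_app_l].
destruct E as [W4 E].
destruct (den_merge W1 W2 D W4) as [A B].
destruct (IH (Let g ks (ren (length G + gar g)
  (seq 0 (length G + gar g) ++ seq (length G) (gar g)) p2)) G) as [A' B'].
{ simpl wf; now rewrite A, W1, (proj2 (list_eqbP _ _) W2). }
split; [exact A'|].
rewrite B', <- B, (den_Let G g ks p), E; reflexivity.
Qed.

Lemma dce_sound p G : wf G p = true ->
  wf G (dce G p) = true /\ den G (dce G p) = den G p.
Proof.
revert G; induction p as [ks|g ks p IH]; intros G W; auto.
pose proof W as W0; simpl in W0; rewrite !andb_true_iff in W0.
destruct W0 as [[W1 W2%list_eqbP] W3].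
destruct (IH _ W3) as [A B]; simpl dce.
set (p0 := ren _ _ (dce _ p)); destruct (_ && _) eqn:E.
- apply andb_true_iff in E; destruct E as [E%prog_eqbP W0]; split; [exact W0|].
  rewrite den_Let, <- B, <- E; unfold gar; rewrite <- length_app.
  rewrite <- (den_ren W0); [|apply inr_seq; rewrite length_app; lia|apply at_seq_fst].
  rewrite tupS_fst, <- acompA.
  + rewrite <- (cod_draw W1 W2).
    pose proof (pr_p1 (f := aid (TS G)) (g := draw G g ks)) as H; simpl in H.
    rewrite H by now rewrite dom_draw.
    rewrite aid_l; auto using dom_den.
  + rewrite cod_pr, cod_draw by (auto; now rewrite dom_draw); reflexivity.
  + rewrite dom_den; apply ten1r.
- simpl wf; rewrite A, W1, (proj2 (list_eqbP _ _) W2); now rewrite !den_Let, B.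
Qed.

Lemma norm_sound p G : wf G p = true ->
  wf G (norm G p) = true /\ den G (norm G p) = den G p.
Proof.
intros W; unfold norm.
destruct (merge_sound (2 * psize p) W) as [A B], (dce_sound A) as [A' B'].
now rewrite B'.
Qed.

Lemma eqv_sound q p G : wf G q = true -> wf G p = true -> eqv (length G) q p = true ->
  den G q = den G p.
Proof.
revert p G; induction q as [ks|g ks q IH]; intros p G Wq Wp E.
- simpl in E; now apply prog_eqbP in E; subst.
- simpl in Wq; rewrite !andb_true_iff in Wq; destruct Wq as [[W1 W2%list_eqbP] W3].
  simpl in E; destruct pull as [p'|] eqn:P; [|discriminate].
  apply pull_sound in P; auto; destruct P as [W4 ->].
  apply andb_true_iff in E; destruct E as [_ E].
  rewrite !den_Let; f_equal; apply IH; auto; now rewrite length_app.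
Qed.

Lemma equivb_sound G p q : equivb G p q = true -> den G p = den G q.
Proof.
unfold equivb; rewrite !andb_true_iff; intros [[Wp Wq] E].
destruct (norm_sound Wp) as [Wp' <-], (norm_sound Wq) as [Wq' <-].
symmetry; now apply eqv_sound.
Qed.

Lemma seqp_sound p q G : wf G p = true -> wf (out G p) q = true ->
  den G (seqp (length G) p q) = acomp (den G p) (den (out G p) q).
Proof.
revert G; induction p as [ks|g ks p IH]; intros G W Wq.
- symmetry; now apply den_ren.
- simpl in W; rewrite !andb_true_iff in W; destruct W as [[W1 W2%list_eqbP] W3].
  simpl seqp; rewrite !den_Let; unfold gar; rewrite <- length_app, IH by assumption.
  rewrite acompA; auto using let_composable.
  now rewrite cod_den, dom_den.
Qed.

Lemma prep_sound js q G : wf G q = true -> inr (length G) js = true ->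
  den G (prep js q) = pr (tupS G js) (den G q).
Proof.
revert G; induction q as [ks|g ks q IH]; intros G W R; [apply tupS_app|].
simpl in W; rewrite !andb_true_iff in W; destruct W as [[W1 W2%list_eqbP] W3].
simpl prep; rewrite !den_Let, IH, tupS_p1; auto;
  [|eapply inr_le; [|eassumption]; rewrite length_app; lia].
pose proof (let_pr_l (f := draw G g ks) (h := tupS G js) (k := den (G ++ gout g) q)) as H.
rewrite dom_draw, cod_draw in H by assumption; apply H.
- now rewrite dom_tupS.
- now rewrite dom_den, TS_app.
Qed.

Lemma pairp_sound p q G : wf G p = true -> wf G q = true ->
  den G (pairp (length G) p q) = pr (den G p) (den G q).
Proof.
revert q G; induction p as [ks|g ks p IH]; intros q G W Wq; [now apply prep_sound|].
simpl in W; rewrite !andb_true_iff in W; destruct W as [[W1 W2%list_eqbP] W3].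
assert (R : inr (length (G ++ gout g)) (seq 0 (length G)) = true)
  by (apply inr_seq; rewrite length_app; lia).
simpl pairp; rewrite !den_Let; unfold gar; rewrite <- length_app, IH;
  [|assumption|eapply wf_ren; eauto using at_seq_fst].
rewrite <- (den_ren Wq R (at_seq_fst _ _)), tupS_fst.
pose proof (let_pr_r (f := draw G g ks) (h := den G q) (k := den (G ++ gout g) p)) as H.
rewrite dom_draw, cod_draw in H by assumption; apply H.
- now rewrite dom_den.
- now rewrite dom_den, TS_app.
Qed.

Lemma parp_sound p q G H : wf G p = true -> wf H q = true ->
  den (G ++ H) (parp (length G) (length H) p q) = aten (den G p) (den H q).
Proof.
intros W W'; unfold parp; rewrite <- length_app.
assert (R : inr (length (G ++ H)) (seq 0 (length G)) = true)
  by (apply inr_seq; rewrite length_app; lia).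
assert (R' : inr (length (G ++ H)) (seq (length G) (length H)) = true)
  by (apply inr_seq; rewrite length_app; lia).
rewrite pairp_sound;
  [|eapply wf_ren; eauto using at_seq_fst|eapply wf_ren; eauto using at_seq_snd].
rewrite <- (den_ren W R (at_seq_fst _ _)), <- (den_ren W' R' (at_seq_snd _ _)).
now rewrite tupS_fst, tupS_snd, aten_p1p2, !dom_den.
Qed.
End Programs.

(** * Deciding equations between string diagrams *)

Inductive tm :=
| TGen (g : nat)
| TRet (G js : list nat)
| TComp (t u : tm)
| TPar (t u : tm).

Section Search.
Variable sg : signature.

(** Well-formedness of each result is tested here, which replaces a proof that [seqp] and [parp]
    preserve it. *)
Fixpoint compile (t : tm) : option (list nat * prog) :=
  match t with
  | TGen g =>
      let n := length (gin sg g) in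
      Some (gin sg g, Let g (seq 0 n) (Ret (seq n (gar sg g))))
  | TRet G js => if inr (length G) js then Some (G, Ret js) else None
  | TComp t u =>
      match compile t, compile u with
      | Some (G, p), Some (H, q) =>
          let r := seqp sg (length G) p q in
          if list_eqb (out sg G p) H && wf sg G r then Some (G, r) else None
      | _, _ => None
      end
  | TPar t u =>
      match compile t, compile u with
      | Some (G, p), Some (H, q) =>
          let r := parp sg (length G) (length H) p q in
          if wf sg (G ++ H) r then Some (G ++ H, r) else None
      | _, _ => None
      end
  end.

(* The draws [A], then the program [p] on the variables [js], then [b]. *)
Fixpoint plug (n : nat) (A : list (nat * list nat)) (js : list nat) (p b : prog) : prog :=
  match A with
  | [] => seqp sg n (prep (seq 0 n) (ren sg n js p)) b
  | (g, ks) :: A' => Let g ks (plug (n + gar sg g) A' js p b)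
  end.

Fixpoint plug_ok (G : list nat) (A : list (nat * list nat)) (js D : list nat)
    (p q b : prog) : bool :=
  match A with
  | [] =>
      let p' := prep (seq 0 (length G)) (ren sg (length G) js p) in
      let q' := prep (seq 0 (length G)) (ren sg (length G) js q) in
      inr (length G) js && list_eqb (at_ G js) D && wf sg D p && wf sg D q
      && list_eqb (out sg G p') (out sg G q') && wf sg G p' && wf sg G q'
      && wf sg (out sg G p') b
  | (g, ks) :: A' => plug_ok (G ++ gout sg g) A' js D p q b
  end.

(* Search for an instance of the program [l], with inputs of sorts [D], in the
   program [p]. Nothing is proved about it: the decompositions found are checked
   afterwards. *)
Definition draw_ : Type := nat * list nat * list nat.

Fixpoint draws (n : nat) (p : prog) : list draw_ :=
  match p with
  | Ret _ => []
  | Let g js p' => (g, js, seq n (gar sg g)) :: draws (n + gar sg g) p'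
  end.

Fixpoint rets (p : prog) : list nat :=
  match p with Ret js => js | Let _ _ p' => rets p' end.

Fixpoint assoc (s : list (nat * nat)) (x : nat) : option nat :=
  match s with
  | [] => None
  | (y, z) :: s' => if x =? y then Some z else assoc s' x
  end.

Fixpoint unify (s : list (nat * nat)) (xs ys : list nat) : option (list (nat * nat)) :=
  match xs, ys with
  | [], [] => Some s
  | x :: xs', y :: ys' =>
      match assoc s x with
      | Some z => if y =? z then unify s xs' ys' else None
      | None => unify ((x, y) :: s) xs' ys'
      end
  | _, _ => None
  end.

Definition mem (x : nat) (l : list nat) : bool := existsb (Nat.eqb x) l.
Definition meets (l m : list nat) : bool := existsb (fun x => mem x m) l.

Fixpoint all_some (l : list (option nat)) : option (list nat) :=
  match l with
  | [] => Some []
  | Some x :: l' => option_map (cons x) (all_some l')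
  | None :: _ => None
  end.

(* Matches of the draws [ls] among the draws [ps]; [ms] collects the first
   outputs of the matched draws. Draws that do not occur in [ps] are given
   names from [fresh] on, as they can always be added. *)
Fixpoint matches (fresh : nat) (ls ps : list draw_) (s : list (nat * nat))
    (ms : list (list nat)) : list (list (nat * nat) * list (list nat)) :=
  match ls with
  | [] => [(s, ms)]
  | (g, xs, zs) :: ls' =>
      let found := flat_map (fun d =>
        let '(h, ys, os) := d in
        if (g =? h) && negb (existsb (list_eqb os) ms) then
          match unify s xs ys with
          | Some s' => match unify s' zs os with
                       | Some s2 => [(s2, os :: ms)]
                       | None => []
                       end
          | None => []
          end
        else []) ps in
      match found with
      | [] =>
          match all_some (map (assoc s) xs) with
          | Some _ => matches (fresh + length zs) ls' ps
              (combine zs (seq fresh (length zs)) ++ s) ms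
          | None => []
          end
      | _ => flat_map (fun r => matches fresh ls' ps (fst r) (snd r)) found
      end
  end.

(* Split [ps] into the draws before and after the matched ones. *)
Fixpoint split_draws (ps : list draw_) (ms : list (list nat)) (sv bv : list nat)
    : option (list draw_ * list draw_) :=
  match ps with
  | [] => Some ([], [])
  | (g, js, os) :: ps' =>
      let dep := meets js sv || meets js bv in
      if existsb (list_eqb os) ms && (negb (gdet sg g) || dep) then
        if meets js bv then None else split_draws ps' ms (os ++ sv) bv
      else if dep then
        option_map (fun r => (fst r, (g, js, os) :: snd r)) (split_draws ps' ms sv (os ++ bv))
      else
        option_map (fun r => ((g, js, os) :: fst r, snd r)) (split_draws ps' ms sv bv)
  end.

Fixpoint relevel (n : nat) (e : list (nat * nat)) (ds : list draw_)
    : option (nat * list (nat * nat) * list (nat * list nat)) :=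
  match ds with
  | [] => Some (n, e, [])
  | (g, js, os) :: ds' =>
      match all_some (map (assoc e) js) with
      | Some ks =>
          option_map (fun r => (fst r, (g, ks) :: snd r))
            (relevel (n + length os) (combine os (seq n (length os)) ++ e) ds')
      | None => None
      end
  end.

Fixpoint to_prog (ds : list (nat * list nat)) (js : list nat) : prog :=
  match ds with
  | [] => Ret js
  | (g, ks) :: ds' => Let g ks (to_prog ds' js)
  end.

Fixpoint index_of (x n : nat) (l : list nat) : nat :=
  match l with
  | [] => n
  | y :: l' => if x =? y then n else index_of x (S n) l'
  end.

Definition decompose (G D : list nat) (l p : prog) (r : list (nat * nat) * list (list nat))
    : option (list (nat * list nat) * list nat * prog) :=
  let (s, ms) := r in
  let ps := draws (length G) p in
  match split_draws ps ms [] [] with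
  | Some (da, db) =>
      let e0 := combine (seq 0 (length G)) (seq 0 (length G)) in
      match relevel (length G) e0 da with
      | Some (n, e, A) =>
          let sorts := fold_left (fun G' d => G' ++ gout sg (fst (fst d))) da G in
          let arg i :=
            match assoc s i with
            | Some v => assoc e v
            (* An input that no draw of the pattern constrains: the first variable of its sort is
               tried, and the check in [try_all] rejects a wrong guess. *)
            | None => Some (index_of (nth i D 0) 0 sorts)
            end in
          match all_some (map arg (seq 0 (length D))) with
          | Some js =>
              let ls := rets l in
              let e' := e ++ flat_map (fun i =>
                match assoc s (nth i ls 0) with Some v => [(v, n + i)] | None => [] end)
                (seq 0 (length ls)) in
              match relevel (n + length ls) e' db with
              | Some (_, e2, B) =>
                  match all_some (map (assoc e2) (rets p)) with
                  | Some ks => Some (A, js, to_prog B ks)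
                  | None => None
                  end
              | None => None
              end
          | None => None
          end
      | None => None
      end
  | None => None
  end.

Fixpoint try_all (G D : list nat) (l r p : prog)
    (cs : list (list (nat * nat) * list (list nat))) : option prog :=
  match cs with
  | [] => None
  | c :: cs' =>
      match decompose G D l p c with
      | Some (A, js, b) =>
          if equivb sg G p (plug (length G) A js l b) && plug_ok G A js D l r b
             && wf sg G (plug (length G) A js r b)
          then Some (norm sg G (plug (length G) A js r b))
          else try_all G D l r p cs'
      | None => try_all G D l r p cs'
      end
  end.

Definition rewrite_step (G D : list nat) (l r p : prog) : option prog :=
  (* [N] is the number of variables of [p], so names from [N] on are fresh for the added draws. *)
  let N := length G + fold_right (fun d n => length (snd d) + n) 0 (draws (length G) p) in
  try_all G D l r p (matches N (draws (length D) l) (draws (length G) p) [] []).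

Fixpoint rewrite_steps (G : list nat) (p : prog) (hs : list (tm * tm)) : option prog :=
  match hs with
  | [] => Some p
  | (t, u) :: hs' =>
      match compile t, compile u with
      | Some (D, l), Some (D', r) =>
          if list_eqb D D' then
            match rewrite_step G D (norm sg D l) r p with
            | Some p' => rewrite_steps G p' hs'
            | None => None
            end
          else None
      | _, _ => None
      end
  end.

Definition check (t u : tm) (hs ks : list (tm * tm)) : bool :=
  match compile t, compile u with
  | Some (G, p), Some (H, q) =>
      list_eqb G H && wf sg G p && wf sg G q &&
      match rewrite_steps G (norm sg G p) hs, rewrite_steps G (norm sg G q) ks with
      | Some p', Some q' => equivb sg G p' q'
      | _, _ => false
      end
  | _, _ => false
  end.

Context {C : markov_category} (ov : nat -> C) (gv : nat -> arr C).
Hypothesis V : valid sg ov gv.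

Fixpoint tden (t : tm) : arr C :=
  match t with
  | TGen g => gv g
  | TRet G js => tupS ov G js
  | TComp t u => acomp (tden t) (tden u)
  | TPar t u => aten (tden t) (tden u)
  end.

Lemma compile_sound t G p : compile t = Some (G, p) ->
  wf sg G p = true /\ tden t = den sg ov gv G p.
Proof.
revert G p; induction t as [g|G0 js|t IHt u IHu|t IHt u IHu]; simpl; intros G p.
- intros [= <- <-]; unfold gar.
  assert (R : inr (length (gin sg g)) (seq 0 (length (gin sg g))) = true) by (apply inr_seq; lia).
  split.
  + simpl; rewrite R, at_seq, (proj2 (list_eqbP _ _) eq_refl); simpl.
    apply inr_seq; rewrite length_app; lia.
  + simpl; rewrite tupS_snd, tupS_id, aid_l by apply (dom_gv V).
    pose proof (pr_p2 (f := aid (TS ov (gin sg g))) (g := gv g)) as H; simpl in H.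
    rewrite (cod_gv V), (dom_gv V) in H; symmetry; now apply H.
- destruct inr eqn:R; [|discriminate]; intros [= <- <-]; auto.
- destruct (compile t) as [[G1 p1]|]; [|discriminate].
  destruct (compile u) as [[G2 p2]|]; [|discriminate].
  destruct (IHt _ _ eq_refl) as [W1 ->], (IHu _ _ eq_refl) as [W2 ->].
  destruct (_ && _) eqn:E; [|discriminate]; intros [= <- <-].
  apply andb_true_iff in E; destruct E as [<-%list_eqbP E]; split; auto.
  now rewrite seqp_sound.
- destruct (compile t) as [[G1 p1]|]; [|discriminate].
  destruct (compile u) as [[G2 p2]|]; [|discriminate].
  destruct (IHt _ _ eq_refl) as [W1 ->], (IHu _ _ eq_refl) as [W2 ->].
  destruct (wf sg (G1 ++ G2) _) eqn:E; [|discriminate]; intros [= <- <-]; split; auto.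
  now rewrite parp_sound.
Qed.

(** At the hole the program enters only through its denotation: it is run on selected wires, and
    [prep] keeps all the surrounding variables alongside its outputs. *)
Lemma plug_sound A G js D p q b : den sg ov gv D p = den sg ov gv D q ->
  plug_ok G A js D p q b = true ->
  den sg ov gv G (plug (length G) A js p b) = den sg ov gv G (plug (length G) A js q b).
Proof.
intros E; revert G; induction A as [|[g ks] A IH]; intros G; cbn [plug plug_ok]; cbv zeta.
- rewrite !andb_true_iff.
  intros [[[[[[[R e%list_eqbP] Wp] Wq] o%list_eqbP] Wp'] Wq'] Wb].
  rewrite !seqp_sound, <- o by (auto; now rewrite <- o).
  assert (R' : inr (length G) (seq 0 (length G)) = true) by (apply inr_seq; lia).
  assert (W : wf sg G (ren sg (length G) js p) = true) by (eapply wf_ren; eauto).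
  assert (W' : wf sg G (ren sg (length G) js q) = true) by (eapply wf_ren; eauto).
  rewrite !prep_sound by assumption.
  rewrite <- (den_ren V Wp R e), <- (den_ren V Wq R e), E; reflexivity.
- intros H; cbn [den]; f_equal; unfold gar; rewrite <- length_app; now apply IH.
Qed.

Lemma rewrite_step_sound G D l r p p' :
  den sg ov gv D l = den sg ov gv D r -> rewrite_step G D l r p = Some p' ->
  wf sg G p' = true /\ den sg ov gv G p = den sg ov gv G p'.
Proof.
intros E; unfold rewrite_step; generalize (matches
  (length G + fold_right (fun d n => length (snd d) + n) 0 (draws (length G) p))
  (draws (length D) l) (draws (length G) p) [] []) as cs.
induction cs as [|c cs IH]; simpl; [discriminate|].
destruct decompose as [[[A js] b]|]; [|exact IH].
destruct (_ && _) eqn:H; [|exact IH]; intros [= <-].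
rewrite !andb_true_iff in H; destruct H as [[H1 H2] H3].
rewrite (equivb_sound V H1), (plug_sound E H2).
destruct (norm_sound V H3); auto.
Qed.

Definition hyp_ok (h : tm * tm) : Prop := tden (fst h) = tden (snd h).

Lemma rewrite_steps_sound hs G p p' : Forall hyp_ok hs -> wf sg G p = true ->
  rewrite_steps G p hs = Some p' -> den sg ov gv G p = den sg ov gv G p'.
Proof.
intros F; revert p; induction F as [|[t u] hs E F IH]; intros p W; simpl.
- now intros [= <-].
- destruct (compile t) as [[D l]|] eqn:Et; [|discriminate].
  destruct (compile u) as [[D' r]|] eqn:Eu; [|discriminate].
  destruct list_eqb eqn:L; [|discriminate]; apply list_eqbP in L; subst D'.
  destruct rewrite_step as [p2|] eqn:S; [|discriminate].
  apply compile_sound in Et; destruct Et as [Wl Et].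
  apply compile_sound in Eu; destruct Eu as [_ Eu].
  assert (E' : den sg ov gv D (norm sg D l) = den sg ov gv D r).
  { destruct (norm_sound V Wl) as [_ ->]; now rewrite <- Et, <- Eu. }
  destruct (rewrite_step_sound E' S) as [W2 ->]; auto.
Qed.

Lemma check_sound t u hs ks : Forall hyp_ok hs -> Forall hyp_ok ks ->
  check t u hs ks = true -> tden t = tden u.
Proof.
intros F F'; unfold check.
destruct (compile t) as [[G p]|] eqn:Et; [|discriminate].
destruct (compile u) as [[H q]|] eqn:Eu; [|discriminate].
rewrite !andb_true_iff; intros [[[<-%list_eqbP W] W'] E].
apply compile_sound in Et; destruct Et as [_ ->].
apply compile_sound in Eu; destruct Eu as [_ ->].
destruct (rewrite_steps G (norm sg G p) hs) as [p'|] eqn:S; [|discriminate].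
destruct (rewrite_steps G (norm sg G q) ks) as [q'|] eqn:S'; [|discriminate].
destruct (norm_sound V W) as [Wn <-], (norm_sound V W') as [Wn' <-].
rewrite (rewrite_steps_sound F Wn S), (rewrite_steps_sound F' Wn' S').
now apply equivb_sound.
Qed.
End Search.

(** ** Reification *)

Section Reification.
Context {C : markov_category} (ov : nat -> C) (gv : nat -> arr C).
Notation td := (tden ov gv).

(** An entry of a wire list may itself be a tensor and then stands for a block of atomic wires;
    selecting it selects consecutive atoms. At the level of atoms [group] and [ungroup] become
    identities. *)
Definition block_wires (bl : list (list nat)) (js : list nat) : list nat :=
  concat (map (fun j => seq (length (concat (firstn j bl))) (length (nth j bl []))) js).

Lemma T_concat bl : T (map (TS ov) bl) = TS ov (concat bl).
Proof. induction bl as [|b bl IH]; simpl; [reflexivity|]; now rewrite TS_app, IH. Qed.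

Lemma pj_block bl j : pj (map (TS ov) bl) j
  = tupS ov (concat bl) (seq (length (concat (firstn j bl))) (length (nth j bl []))).
Proof.
revert j; induction bl as [|b bl IH]; intros [|j]; simpl.
1, 2: symmetry; apply dl_one.
- now rewrite T_concat, tupS_fst.
- rewrite IH, length_app, <- map_add_seq.
  unfold tupS; rewrite map_app, <- (length_map ov b), tup_p2, p2_acomp; [reflexivity|].
  apply dom_tup.
Qed.

Lemma tup_blocks bl js : tup (map (TS ov) bl) js = tupS ov (concat bl) (block_wires bl js).
Proof.
induction js as [|j js IH]; simpl.
- unfold tupS; simpl; f_equal; apply T_concat.
- unfold block_wires; simpl; now rewrite tupS_app, <- pj_block, IH.
Qed.

Lemma r_comp (a b c : C) (f : hom a b) (g : hom b c) t u :
  Arr f = td t -> Arr g = td u -> Arr (f >> g) = td (TComp t u).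
Proof. simpl; intros <- <-; symmetry; apply acompE. Qed.

Lemma r_ten (a b a' b' : C) (f : hom a b) (g : hom a' b') t u :
  Arr f = td t -> Arr g = td u -> Arr (tenm f g) = td (TPar t u).
Proof. simpl; intros <- <-; apply atenE. Qed.

Lemma r_par (l l' m m' : list C) (f : mor l m) (g : mor l' m') t u :
  Arr f = td t -> Arr g = td u -> Arr (par f g) = td (TPar t u).
Proof. simpl; intros <- <-; apply Arr_par. Qed.

Lemma r_wire (l : list C) js bl : l = map (TS ov) bl ->
  Arr (wire l js) = td (TRet (concat bl) (block_wires bl js)).
Proof. simpl; intros ->; now rewrite Arr_wire, tup_blocks. Qed.

Lemma r_id (a : C) G : a = TS ov G -> Arr (idm a) = td (TRet G (seq 0 (length G))).
Proof. simpl; intros ->; now rewrite tupS_id. Qed.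

Lemma r_eqhom (a b : C) (e : a = b) G : a = TS ov G ->
  Arr (eqhom e) = td (TRet G (seq 0 (length G))).
Proof. rewrite Arr_eqhom; apply r_id. Qed.

Lemma r_copy (a : C) G : a = TS ov G ->
  Arr (copy a) = td (TRet G (seq 0 (length G) ++ seq 0 (length G))).
Proof. simpl; intros ->; rewrite tupS_app, tupS_id, pr_id; reflexivity. Qed.

Lemma r_del (a : C) G : a = TS ov G -> Arr (del a) = td (TRet G []).
Proof. simpl; intros ->; reflexivity. Qed.

Lemma r_swap (a b : C) G H : a = TS ov G -> b = TS ov H ->
  Arr (swap a b)
  = td (TRet (G ++ H) (seq (length G) (length H) ++ seq 0 (length G))).
Proof.
simpl; intros -> ->; rewrite tupS_app, tupS_fst, tupS_snd, <- pr_sw by reflexivity.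
rewrite p1p2_id; unfold p1, p2; simpl; rewrite ten1l, ten1r, aid_l; reflexivity.
Qed.

Lemma det_Arr (a b : C) (f : hom a b) : deterministic f -> adet (Arr f).
Proof.
unfold deterministic, adet, cp; simpl; rewrite acompE, <- atenE, acompE; congruence.
Qed.
End Reification.

Lemma valid_list {C : markov_category} (sg : signature) (ov : nat -> C) (gl : list (arr C)) :
  Forall2 (fun (s : list nat * list nat * bool) (f : arr C) =>
    dom f = TS ov (fst (fst s)) /\ cod f = TS ov (snd (fst s)) /\
    (snd s = true -> adet f)) sg gl ->
  valid sg ov (fun g => nth g gl (aid one)).
Proof.
intros F; induction F as [|s f sg gl H F IH]; intros [|g]; unfold gin, gout, gdet; simpl;
  auto using det_aid.
Qed.

Lemma r_idw {C : markov_category} ov gv (l : list C) G : tens l = TS ov G ->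
  Arr (idw l) = tden ov gv (TRet G (seq 0 (length G))).
Proof. intros e; exact (r_id gv e). Qed.

Lemma r_group {C : markov_category} ov gv (ll : list (list C)) G : tens (concat ll) = TS ov G ->
  Arr (group ll) = tden ov gv (TRet G (seq 0 (length G))).
Proof. intros e; exact (r_eqhom gv (tens_concat ll) e). Qed.

Lemma r_ungroup {C : markov_category} ov gv (ll : list (list C)) G :
  tens (map tens ll) = TS ov G ->
  Arr (ungroup ll) = tden ov gv (TRet G (seq 0 (length G))).
Proof. intros e; exact (r_eqhom gv (eq_sym (tens_concat ll)) e). Qed.

Ltac ob_nf o := eval cbn [tens map concat app nth dom cod] in o.

Ltac add_new x l :=
  let rec go m :=
    lazymatch m with
    | nil => constr:(x :: l)
    | x :: _ => l
    | _ :: ?m' => go m'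
    end in go l.

Ltac index x l :=
  let rec go m n :=
    lazymatch m with
    | x :: _ => n
    | _ :: ?m' => go m' (S n)
    end in go l O.

Ltac atoms o l :=
  lazymatch o with
  | one => l
  | ten ?a ?b => let l := atoms a l in atoms b l
  | _ => add_new o l
  end.

Ltac atoms_of o l := let o := ob_nf o in atoms o l.

Ltac flat o l :=
  lazymatch o with
  | one => constr:(@nil nat)
  | ten ?a ?b => let x := flat a l in let y := flat b l in eval cbv [app] in (x ++ y)
  | _ => let i := index o l in constr:([i])
  end.

Ltac flat_of o l := let o := ob_nf o in flat o l.

Ltac flat_list os l :=
  lazymatch os with
  | nil => constr:(@nil (list nat))
  | ?o :: ?os' => let x := flat_of o l in let y := flat_list os' l in constr:(x :: y)
  end.

(** Two tables grow together, that of atomic objects and that of generators; continuation passing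
    returns both. Anything that is not a recognised combinator becomes a generator. *)
Ltac collect f ol gl k :=
  lazymatch f with
  | comp ?g ?h => collect g ol gl ltac:(fun ol gl => collect h ol gl k)
  | mcomp ?g ?h => collect g ol gl ltac:(fun ol gl => collect h ol gl k)
  | tenm ?g ?h => collect g ol gl ltac:(fun ol gl => collect h ol gl k)
  | par ?g ?h => collect g ol gl ltac:(fun ol gl => collect h ol gl k)
  | wire ?l _ => let ol := atoms_of (tens l) ol in k ol gl
  | idw ?l => let ol := atoms_of (tens l) ol in k ol gl
  | group ?ll => let ol := atoms_of (tens (concat ll)) ol in k ol gl
  | ungroup ?ll => let ol := atoms_of (tens (concat ll)) ol in k ol gl
  | idm ?a => let ol := atoms_of a ol in k ol gl
  | @eqhom _ ?a _ _ => let ol := atoms_of a ol in k ol gl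
  | copy ?a => let ol := atoms_of a ol in k ol gl
  | del ?a => let ol := atoms_of a ol in k ol gl
  | swap ?a ?b => let ol := atoms_of (ten a b) ol in k ol gl
  | _ =>
      let ol := atoms_of (dom (Arr f)) ol in
      let ol := atoms_of (cod (Arr f)) ol in
      let rec go m :=
        lazymatch m with
        | nil => constr:(Arr f :: gl)
        | @Arr _ _ _ f :: _ => gl
        | _ :: ?m' => go m'
        end in
      let gl := go gl in k ol gl
  end.

Ltac gen_index f gl :=
  let rec go m n :=
    lazymatch m with
    | @Arr _ _ _ f :: _ => n
    | _ :: ?m' => go m' (S n)
    end in go gl O.

Ltac quote_tm f ol gl :=
  lazymatch f with
  | comp ?g ?h => let t := quote_tm g ol gl in let u := quote_tm h ol gl in constr:(TComp t u)
  | mcomp ?g ?h => let t := quote_tm g ol gl in let u := quote_tm h ol gl in constr:(TComp t u)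
  | tenm ?g ?h => let t := quote_tm g ol gl in let u := quote_tm h ol gl in constr:(TPar t u)
  | par ?g ?h => let t := quote_tm g ol gl in let u := quote_tm h ol gl in constr:(TPar t u)
  | wire ?l ?js =>
      let l := eval cbn [app map nth concat] in l in
      let bl := flat_list l ol in
      let G := eval cbv [concat app] in (concat bl) in
      let ks := eval compute in (block_wires bl js) in
      constr:(TRet G ks)
  | idw ?l => let G := flat_of (tens l) ol in quote_id G
  | group ?ll => let G := flat_of (tens (concat ll)) ol in quote_id G
  | ungroup ?ll => let G := flat_of (tens (concat ll)) ol in quote_id G
  | idm ?a => let G := flat_of a ol in quote_id G
  | @eqhom _ ?a _ _ => let G := flat_of a ol in quote_id G
  | copy ?a => let G := flat_of a ol in
      let js := eval compute in (seq 0 (length G) ++ seq 0 (length G)) in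
      constr:(TRet G js)
  | del ?a => let G := flat_of a ol in constr:(TRet G (@nil nat))
  | swap ?a ?b =>
      let G := flat_of a ol in let H := flat_of b ol in
      let K := eval cbv [app] in (G ++ H) in
      let js := eval compute in (seq (length G) (length H) ++ seq 0 (length G)) in
      constr:(TRet K js)
  | _ => let i := gen_index f gl in constr:(TGen i)
  end
with quote_id G := let js := eval compute in (seq 0 (length G)) in constr:(TRet G js).

Ltac solve_ob :=
  cbn [TS T map nth tens concat app dom cod fst snd];
  rewrite ?tenA, ?ten1l, ?ten1r; reflexivity.

Ltac prove_quote ol :=
  lazymatch goal with
  | |- Arr ?f = tden ?ov ?gv ?t =>
      lazymatch f with
      | @comp _ ?a ?b ?c ?g ?h =>
          lazymatch t with TComp ?t1 ?t2 =>
            refine (@r_comp _ ov gv a b c g h t1 t2 _ _); prove_quote ol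
          end
      | @mcomp _ ?l ?m ?n ?g ?h =>
          lazymatch t with TComp ?t1 ?t2 =>
            refine (@r_comp _ ov gv (tens l) (tens m) (tens n) g h t1 t2 _ _); prove_quote ol
          end
      | @tenm _ ?a ?b ?a' ?b' ?g ?h =>
          lazymatch t with TPar ?t1 ?t2 =>
            refine (@r_ten _ ov gv a b a' b' g h t1 t2 _ _); prove_quote ol
          end
      | @par _ ?l ?l' ?m ?m' ?g ?h =>
          lazymatch t with TPar ?t1 ?t2 =>
            refine (@r_par _ ov gv l l' m m' g h t1 t2 _ _); prove_quote ol
          end
      | wire ?l ?js =>
          let l' := eval cbn [app map nth concat] in l in
          let bl := flat_list l' ol in
          refine (@r_wire _ ov gv l js bl _);
          cbn [map]; repeat (apply f_equal2); solve [solve_ob]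
      | idw ?l => let G := flat_of (tens l) ol in refine (@r_idw _ ov gv l G _); solve_ob
      | group ?ll =>
          let G := flat_of (tens (concat ll)) ol in refine (@r_group _ ov gv ll G _); solve_ob
      | ungroup ?ll =>
          let G := flat_of (tens (concat ll)) ol in refine (@r_ungroup _ ov gv ll G _); solve_ob
      | idm ?a => let G := flat_of a ol in refine (@r_id _ ov gv a G _); solve_ob
      | @eqhom _ ?a ?b ?e => let G := flat_of a ol in refine (@r_eqhom _ ov gv a b e G _); solve_ob
      | copy ?a => let G := flat_of a ol in refine (@r_copy _ ov gv a G _); solve_ob
      | del ?a => let G := flat_of a ol in refine (@r_del _ ov gv a G _); solve_ob
      | swap ?a ?b =>
          let G := flat_of a ol in let H := flat_of b ol in
          refine (@r_swap _ ov gv a b G H _ _); solve_ob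
      | _ => reflexivity
      end
  end.

Ltac is_det f :=
  match goal with
  | H : deterministic f |- _ => constr:(true)
  | _ => constr:(false)
  end.

Ltac make_sg gl ol :=
  lazymatch gl with
  | nil => constr:(@nil (list nat * list nat * bool))
  | @Arr _ ?a ?b ?f :: ?gl' =>
      let x := flat_of a ol in let y := flat_of b ol in
      let d := is_det f in
      let s := make_sg gl' ol in
      constr:((x, y, d) :: s)
  end.

Ltac prove_valid :=
  apply valid_list;
  repeat (apply Forall2_cons;
    [split; [solve_ob|split; [solve_ob|]];
     cbn [fst snd]; try discriminate; intros _; apply det_Arr; assumption|]);
  apply Forall2_nil.

(* [hs] is a nested tuple of equations, ending with [tt]. *)
Ltac collect_hyps hs ol gl k :=
  lazymatch hs with
  | tt => k ol gl
  | (?h, ?hs') =>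
      lazymatch type of h with
      | @Arr _ _ _ ?f = @Arr _ _ _ ?g =>
          collect f ol gl ltac:(fun ol gl => collect g ol gl ltac:(fun ol gl =>
            collect_hyps hs' ol gl k))
      | ?f = ?g =>
          collect f ol gl ltac:(fun ol gl => collect g ol gl ltac:(fun ol gl =>
            collect_hyps hs' ol gl k))
      end
  end.

Ltac quote_hyps hs ol gl :=
  lazymatch hs with
  | tt => constr:(@nil (tm * tm))
  | (?h, ?hs') =>
      lazymatch type of h with
      | @Arr _ _ _ ?f = @Arr _ _ _ ?g =>
          let t := quote_tm f ol gl in let u := quote_tm g ol gl in
          let r := quote_hyps hs' ol gl in constr:((t, u) :: r)
      | ?f = ?g =>
          let t := quote_tm f ol gl in let u := quote_tm g ol gl in
          let r := quote_hyps hs' ol gl in constr:((t, u) :: r)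
      end
  end.

Ltac prove_hyps hs ol :=
  lazymatch hs with
  | tt => apply Forall_nil
  | (?h, ?hs') =>
      apply Forall_cons; [unfold hyp_ok; cbn [fst snd]|prove_hyps hs' ol];
      lazymatch type of h with
      | @Arr _ _ _ ?f = @Arr _ _ _ ?g =>
          transitivity (Arr f); [symmetry; prove_quote ol|];
          transitivity (Arr g); [exact h|prove_quote ol]
      | ?f = ?g =>
          transitivity (Arr f); [symmetry; prove_quote ol|];
          transitivity (Arr g); [exact (f_equal (fun x => Arr x) h)|prove_quote ol]
      end
  end.

(** The equations [hs] rewrite the left side, in the listed order and one occurrence each, and [ks]
    the right side. Generators count as deterministic when the context contains a hypothesis saying
    so. *)
Ltac diagram_with hs ks :=
  lazymatch goal with
  | |- @Arr ?C _ _ ?f = @Arr _ _ _ ?g =>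
      collect f (@nil C) (@nil (arr C)) ltac:(fun ol gl => collect g ol gl ltac:(fun ol gl =>
      collect_hyps hs ol gl ltac:(fun ol gl => collect_hyps ks ol gl ltac:(fun ol gl =>
        let t := quote_tm f ol gl in
        let u := quote_tm g ol gl in
        let hl := quote_hyps hs ol gl in
        let kl := quote_hyps ks ol gl in
        let s := make_sg gl ol in
        let ov := constr:(fun i => nth i ol (@one C)) in
        let gv := constr:(fun i => nth i gl (aid (@one C))) in
        let V := fresh "V" in
        assert (V : valid s ov gv) by prove_valid;
        transitivity (tden ov gv t); [prove_quote ol|];
        transitivity (tden ov gv u); [|symmetry; prove_quote ol];
        apply (check_sound V (hs := hl) (ks := kl));
          [prove_hyps hs ol|prove_hyps ks ol|vm_compute; reflexivity]))))
  end.

Ltac to_Arr :=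
  lazymatch goal with
  | |- @eq (arr _) _ _ => idtac
  | |- @eq (hom _ _) _ _ => apply Arr_inj
  | |- @eq (mor _ _) _ _ => apply Arr_inj
  end.

Ltac to_list hs acc :=
  lazymatch hs with
  | (?hs', ?h) => to_list hs' (h, acc)
  | ?h => constr:((h, acc))
  end.

Tactic Notation "diagram" := to_Arr; diagram_with tt tt.
Tactic Notation "diagram" "using" constr(hs) :=
  let l := to_list hs tt in to_Arr; diagram_with l tt.
Tactic Notation "diagram" "using" constr(hs) "and" constr(ks) :=
  let l := to_list hs tt in let m := to_list ks tt in to_Arr; diagram_with l m.

(** * Arena data *)

Ltac split_laws := repeat match goal with
  | H : xylaw _ |- _ => destruct H as (? & ? & ? & ?)
  | H : xzlaw _ _ _ |- _ => destruct H as (? & ? & ?)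
  | H : ylaw _ |- _ => destruct H
  | H : zlaw _ |- _ => destruct H
  end.

Section ArenaData.
Context {C : markov_category}.
Implicit Types o : arob C.

Definition zid o : zdata o o := ZData (idw [ar_c o]) (idw [ar_a o]).

Definition yid o : ydata o o := YData (idw [ar_c o]) (wire [ar_c o; ar_a o] [1]).

Definition xyid o1 o2 (d : xdata o1 o2) : xydata d d (yid o1) (yid o2) :=
  @XYData _ _ _ _ _ d d (yid o1) (yid o2) (yid (xpar d)) (xfb d).

Definition ounit : arob C := Arob one one.

(** Both components are identities of the unit; the [eqhom]s are needed because the tensor powers of
    [one] equal [one] only propositionally. *)
Definition xunit : xdata ounit ounit :=
  @XData _ ounit ounit ounit (eqhom (eq_sym (ten1l one)))
    (eqhom (f_equal (ten one) (eq_sym (eq_trans (f_equal (ten one) (ten1l one)) (ten1l one))))).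

End ArenaData.

Ltac nf_arena :=
  unfold xlaw, xylaw, xzlaw, yzlaw in *; unfold ylaw, zlaw;
  unfold oswap, xmu, shuffle6;
  cbn [xcomp xten ycomp yten zcomp zten xy_xcomp xy_ten oten oswap xmu shuffle6
       zid yid xyid ounit xunit
       xf xfb xpar yf ysh zf zg xyy xys ar_a ar_c] in *.

Ltac laws := intros; split_laws; nf_arena; repeat split; unfold deterministic.

(** * Closure of the equations of cells under composition and tensor *)

Section ArenaLaws.
Context {C : markov_category}.
Implicit Types o : arob C.

Lemma zlaw_zid o : zlaw (zid o).
Proof. laws; diagram. Qed.

Lemma ylaw_yid o : ylaw (yid o).
Proof. laws; diagram. Qed.

Lemma zlaw_zcomp o1 o2 o3 (z : zdata o1 o2) (w : zdata o2 o3) :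
  zlaw z -> zlaw w -> zlaw (zcomp z w).
Proof. laws; diagram. Qed.

Lemma zlaw_zten o1 o2 o1' o2' (z : zdata o1 o2) (z' : zdata o1' o2') :
  zlaw z -> zlaw z' -> zlaw (zten z z').
Proof. laws; diagram. Qed.

Lemma ylaw_ycomp o1 o2 o3 (l : ydata o1 o2) (m : ydata o2 o3) :
  ylaw l -> ylaw m -> ylaw (ycomp l m).
Proof. laws; diagram. Qed.

Lemma ylaw_yten o1 o2 o1' o2' (l : ydata o1 o2) (l' : ydata o1' o2') :
  ylaw l -> ylaw l' -> ylaw (yten l l').
Proof. laws; diagram. Qed.

Lemma xlaw_xunit : xlaw (@xunit C).
Proof. laws; diagram. Qed.

Lemma xlaw_xcomp o1 o2 o3 (d : xdata o1 o2) (e : xdata o2 o3) :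
  xlaw d -> xlaw e -> xlaw (xcomp d e).
Proof.
laws; diagram using (H0, H). Qed.

Lemma xlaw_xten o1 o2 o1' o2' (d : xdata o1 o2) (d' : xdata o1' o2') :
  xlaw d -> xlaw d' -> xlaw (xten d d').
Proof. laws; diagram using (H, H0). Qed.

Lemma xylaw_xyid o1 o2 (d : xdata o1 o2) : xlaw d -> xylaw (xyid d).
Proof. laws; diagram. Qed.

Lemma xylaw_xy_xcomp o1 o2 o3 o4 o5 o6
    (d12 : xdata o1 o2) (d23 : xdata o2 o3) (d45 : xdata o4 o5) (d56 : xdata o5 o6)
    (l14 : ydata o1 o4) (l25 : ydata o2 o5) (l36 : ydata o3 o6)
    (q : xydata d12 d45 l14 l25) (r : xydata d23 d56 l25 l36) :
  ylaw l14 -> ylaw l25 -> ylaw l36 -> xylaw q -> xylaw r -> xylaw (xy_xcomp q r).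
Proof.
intros h14 h25 h36 (hy & qa & qb & qc) (hy' & ra & rb & rc); laws.
1, 2: diagram.
(* For (a) and (b) the equation of [r] goes first: after it the wire [ar_c o2] is read only through
   [yf l25], as the left side of the equation of [q] requires. For (c) the order is reversed, since
   the backward map of [l25], on which the equation of [r] starts, appears only after rewriting with
   that of [q]. *)
- diagram using (ra, qa).
- diagram using (rb, qb).
- diagram using (qc, rc).
Qed.

Lemma xylaw_xy_ten o1 o2 o3 o4 o1' o2' o3' o4'
    (d12 : xdata o1 o2) (d34 : xdata o3 o4) (l13 : ydata o1 o3) (l24 : ydata o2 o4)
    (d12' : xdata o1' o2') (d34' : xdata o3' o4')
    (l13' : ydata o1' o3') (l24' : ydata o2' o4')
    (q : xydata d12 d34 l13 l24) (q' : xydata d12' d34' l13' l24') :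
  ylaw l13 -> ylaw l24 -> ylaw l13' -> ylaw l24' ->
  xylaw q -> xylaw q' -> xylaw (xy_ten q q').
Proof.
intros h13 h24 h13' h24' (hy & qa & qb & qc) (hy' & ra & rb & rc); laws.
1, 2: diagram.
- diagram using (qa, ra).
- diagram using (qb, rb).
- diagram using (qc, rc).
Qed.

Lemma xzlaw_zid o1 o2 (d : xdata o1 o2) : xzlaw (zid o1) (zid o2) (zid (xpar d)).
Proof. laws; diagram. Qed.

Lemma xzlaw_zcomp o1 o2 o3 o4 o5 o6
    (d12 : xdata o1 o2) (d34 : xdata o3 o4) (d56 : xdata o5 o6)
    (z13 : zdata o1 o3) (z24 : zdata o2 o4) (z35 : zdata o3 o5) (z46 : zdata o4 o6)
    (q : zdata (xpar d12) (xpar d34)) (r : zdata (xpar d34) (xpar d56)) :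
  zlaw z13 -> zlaw z24 -> zlaw z35 -> zlaw z46 ->
  xzlaw z13 z24 q -> xzlaw z35 z46 r ->
  xzlaw (zcomp z13 z35) (zcomp z24 z46) (zcomp q r).
Proof.
intros h13 h24 h35 h46 (hy & qa & qb) (hy' & ra & rb); laws.
1, 2: diagram.
- diagram using (qa, ra).
- diagram using (qb, rb).
Qed.

Lemma xzlaw_xcomp o1 o2 o3 o4 o5 o6
    (d12 : xdata o1 o2) (d23 : xdata o2 o3) (d45 : xdata o4 o5) (d56 : xdata o5 o6)
    (z14 : zdata o1 o4) (z25 : zdata o2 o5) (z36 : zdata o3 o6)
    (q : zdata (xpar d12) (xpar d45)) (r : zdata (xpar d23) (xpar d56)) :
  zlaw z14 -> zlaw z25 -> zlaw z36 -> xzlaw z14 z25 q -> xzlaw z25 z36 r ->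
  @xzlaw _ _ _ _ _ (xcomp d12 d23) (xcomp d45 d56) z14 z36 (zten q (zten z25 r)).
Proof.
intros h13 h24 h35 (hy & qa & qb) (hy' & ra & rb); laws.
1, 2: diagram.
- diagram using (ra, qa).
- diagram using (rb, qb).
Qed.

Lemma xzlaw_xten o1 o2 o3 o4 o1' o2' o3' o4'
    (d12 : xdata o1 o2) (d34 : xdata o3 o4) (d12' : xdata o1' o2') (d34' : xdata o3' o4')
    (z13 : zdata o1 o3) (z24 : zdata o2 o4) (z13' : zdata o1' o3') (z24' : zdata o2' o4')
    (q : zdata (xpar d12) (xpar d34)) (q' : zdata (xpar d12') (xpar d34')) :
  zlaw z13 -> zlaw z24 -> zlaw z13' -> zlaw z24' ->
  xzlaw z13 z24 q -> xzlaw z13' z24' q' ->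
  @xzlaw _ _ _ _ _ (xten d12 d12') (xten d34 d34') (zten z13 z13') (zten z24 z24') (zten q q').
Proof.
intros h13 h24 h35 h46 (hy & qa & qb) (hy' & ra & rb); laws.
1, 2: diagram.
- diagram using (ra, qa).
- diagram using (rb, qb).
Qed.

Lemma zlaw_oswap o o' : zlaw (oswap o o').
Proof. laws; diagram. Qed.

Lemma xzlaw_oswap o1 o2 o1' o2' (d : xdata o1 o2) (d' : xdata o1' o2') :
  @xzlaw _ _ _ _ _ (xten d d') (xten d' d) (oswap o1 o1') (oswap o2 o2')
    (oswap (xpar d) (xpar d')).
Proof. laws; diagram. Qed.

Lemma xzlaw_xmu o1 o2 o3 o1' o2' o3' (d : xdata o1 o2) (e : xdata o2 o3)
    (d' : xdata o1' o2') (e' : xdata o2' o3') :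
  xzlaw (zid (oten o1 o1')) (zid (oten o3 o3')) (xmu d e d' e').
Proof. laws; diagram. Qed.

Definition shuffle6_inv (c12 c12' c2 c2' c23 c23' : C) :
    mor [tens [tens [c12; c2; c23]; tens [c12'; c2'; c23']]]
        [tens [tens [c12; c12']; tens [c2; c2']; tens [c23; c23']]] :=
  ungroup [[tens [c12; c2; c23]; tens [c12'; c2'; c23']]]
  ;; ungroup [[c12; c2; c23]; [c12'; c2'; c23']]
  ;; wire [c12; c2; c23; c12'; c2'; c23'] [0; 3; 1; 4; 2; 5]
  ;; group [[c12; c12']; [c2; c2']; [c23; c23']]
  ;; group [[tens [c12; c12']; tens [c2; c2']; tens [c23; c23']]].

Definition xmu_inv o1 o2 o3 o1' o2' o3' (d : xdata o1 o2) (e : xdata o2 o3)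
    (d' : xdata o1' o2') (e' : xdata o2' o3') :
    zdata (xpar (xten (xcomp d e) (xcomp d' e')))
          (xpar (xcomp (xten d d') (xten e e'))) :=
  @ZData _ (xpar (xten (xcomp d e) (xcomp d' e')))
         (xpar (xcomp (xten d d') (xten e e')))
    (shuffle6_inv (ar_c (xpar d)) (ar_c (xpar d')) (ar_c o2) (ar_c o2')
              (ar_c (xpar e)) (ar_c (xpar e')))
    (shuffle6_inv (ar_a (xpar d)) (ar_a (xpar d')) (ar_a o2) (ar_a o2')
              (ar_a (xpar e)) (ar_a (xpar e'))).

Lemma xzlaw_xmu_inv o1 o2 o3 o1' o2' o3' (d : xdata o1 o2) (e : xdata o2 o3)
    (d' : xdata o1' o2') (e' : xdata o2' o3') :
  xzlaw (zid (oten o1 o1')) (zid (oten o3 o3')) (xmu_inv d e d' e').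
Proof. unfold xmu_inv; laws; unfold shuffle6_inv; diagram. Qed.
End ArenaLaws.

(** * Conditional products *)

Section CondProduct.
Context {C : markov_category} {A X Y Z : C} (f : mor [A] [X; Y]) (g : mor [A] [Y; Z]).

Lemma cond_product_l (kf : mor [A; Y] [X]) (kg : mor [A; Y] [Z]) :
  is_conditional (f ;; wire [X; Y] [1; 0]) kf ->
  cond_product_of (f ;; wire [X; Y] [1]) kf kg
  = wire [A] [0; 0] ;; (idw [A] ⊠ f) ;; wire [A; X; Y] [1; 2; 0; 2] ;; (idw [X; Y] ⊠ kg).
Proof. unfold is_conditional, cond_product_of; intros H; symmetry; diagram using H. Qed.

Hypothesis M : f ;; wire [X; Y] [1] = g ;; wire [Y; Z] [0].

Lemma cond_product_r (kf : mor [A; Y] [X]) (kg : mor [A; Y] [Z]) :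
  is_conditional g kg ->
  cond_product_of (f ;; wire [X; Y] [1]) kf kg
  = wire [A] [0; 0] ;; (idw [A] ⊠ g) ;; wire [A; Y; Z] [0; 1; 1; 2] ;; (kf ⊠ idw [Y; Z]).
Proof.
unfold is_conditional, cond_product_of; intros H; rewrite M; symmetry; diagram using H.
Qed.

Lemma cond_product_unique (kf kf' : mor [A; Y] [X]) (kg kg' : mor [A; Y] [Z]) :
  is_conditional (f ;; wire [X; Y] [1; 0]) kf -> is_conditional g kg ->
  is_conditional (f ;; wire [X; Y] [1; 0]) kf' -> is_conditional g kg' ->
  cond_product_of (f ;; wire [X; Y] [1]) kf kg
  = cond_product_of (f ;; wire [X; Y] [1]) kf' kg'.
Proof.
intros hf hg hf' hg'.
rewrite (cond_product_l kg hf), <- (cond_product_l kg hf').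
now rewrite (cond_product_r kf' hg), <- (cond_product_r kf' hg').
Qed.

(** By uniqueness, the quantification over all conditionals can be tested on a single pair. This is
    what allows conditionals to be prescribed. *)
Lemma is_cond_productE (kf : mor [A; Y] [X]) (kg : mor [A; Y] [Z]) p :
  is_conditional (f ;; wire [X; Y] [1; 0]) kf -> is_conditional g kg ->
  is_cond_product f g p <-> p = cond_product_of (f ;; wire [X; Y] [1]) kf kg.
Proof.
intros hf hg; split; [intros [_ H]; auto|intros ->; split; [exact M|]].
intros kf' kg' hf' hg'; now apply cond_product_unique.
Qed.
End CondProduct.

Lemma xydata_ext {C : markov_category} (o1 o2 o3 o4 : arob C) (d12 : xdata o1 o2)
    (d34 : xdata o3 o4) (l13 : ydata o1 o3) (l24 : ydata o2 o4) (q r : xydata d12 d34 l13 l24) :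
  xyy q = xyy r -> xys q = xys r -> q = r.
Proof. destruct q, r; simpl; intros -> ->; reflexivity. Qed.

(** * The y-composite of two xy-squares for given conditionals *)

Section YComposites.
Context {C : markov_category} {o1 o2 o3 o4 o5 o6 : arob C}
  {d12 : xdata o1 o2} {d34 : xdata o3 o4} {d56 : xdata o5 o6}
  {l13 : ydata o1 o3} {l24 : ydata o2 o4} {l35 : ydata o3 o5} {l46 : ydata o4 o6}
  (q : xydata d12 d34 l13 l24) (r : xydata d34 d56 l35 l46).

Notation U := (xy_ycomp_upper (l35 := l35) q).
Notation L := (xy_ycomp_lower (l13 := l13) r).
Notation A := (tens [ar_c o1; ar_a o5]).
Notation B0 := (tens [ar_c (xpar d12); ar_c o2]).
Notation B1 := (tens [ar_c (xpar d34); ar_c o4; ar_a (xpar d34); ar_a o4]).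
Notation B2 := (tens [ar_a (xpar d56); ar_a o6]).

Definition xy_ycomp_with (kf : mor [A; B1] [B0]) (kg : mor [A; B1] [B2]) :
    xydata d12 d56 (ycomp l13 l35) (ycomp l24 l46) :=
  @XYData _ _ _ _ _ d12 d56 (ycomp l13 l35) (ycomp l24 l46) (ycomp (xyy q) (xyy r))
    (group [[ar_c o1; ar_a o5]] ;; cond_product_of (U ;; wire [B0; B1] [1]) kf kg
     ;; wire [B0; B1; B2] [0; 2]
     ;; ungroup [[ar_c (xpar d12); ar_c o2]; [ar_a (xpar d56); ar_a o6]]).

Definition conditionals (kf : mor [A; B1] [B0]) (kg : mor [A; B1] [B2]) : Prop :=
  is_conditional (U ;; wire [B0; B1] [1; 0]) kf /\ is_conditional L kg.

Lemma exists_conditionals : has_conditionals C -> exists kf kg, conditionals kf kg.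
Proof.
intros HC; destruct (HC _ _ _ (U ;; wire [B0; B1] [1; 0])) as [kf hf].
destruct (HC _ _ _ L) as [kg hg]; now exists kf, kg.
Qed.

Definition ycomposable : Prop :=
  (ylaw l13 /\ ylaw l24 /\ ylaw l35 /\ ylaw l46) /\ xylaw q /\ xylaw r.

(** Equation (b) of [q] and equation (c) of [r] turn both marginals into the same morphism: apply
    [yf l13], pull [a5] back along [l35], then run [xfb d34]. *)
Lemma ycomp_marginals : ycomposable -> U ;; wire [B0; B1] [1] = L ;; wire [B1; B2] [0].
Proof.
intros ((h13 & h24 & h35 & h46) & (hy & qa & qb & qc) & (hy' & ra & rb & rc)); split_laws.
unfold xy_ycomp_upper, xy_ycomp_lower; nf_arena.
diagram using (qb, rc).
Qed.

Lemma is_xy_ycompE kf kg w : ycomposable -> conditionals kf kg ->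
  is_xy_ycomp q r w <-> w = xy_ycomp_with kf kg.
Proof.
intros Hqr [hf hg]; pose proof (is_cond_productE (ycomp_marginals Hqr)) as E.
split.
- intros [Hy (p & Hp & Hs)]; apply (E kf kg p hf hg) in Hp; subst p.
  now apply xydata_ext.
- intros ->; split; [reflexivity|].
  exists (cond_product_of (U ;; wire [B0; B1] [1]) kf kg); split; [|reflexivity].
  now apply (E kf kg _ hf hg).
Qed.

Lemma xylaw_ycomp kf kg : ycomposable -> conditionals kf kg -> xylaw (xy_ycomp_with kf kg).
Proof.
intros Hqr [hf hg]; pose proof (ycomp_marginals Hqr) as M.
unfold is_conditional in hf, hg.
destruct Hqr as ((h13 & h24 & h35 & h46) & (hy & qa & qb & qc) & (hy' & ra & rb & rc)).
unfold xy_ycomp_with, cond_product_of, xy_ycomp_upper, xy_ycomp_lower in *.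
laws.
1, 2: diagram.
- diagram using (qa, ra).
(* In the restored upper morphism the forward images of the top outputs are already components of
   the middle row. Only the marginal is then read; [M] moves it to the lower morphism, where [kg] is
   absorbed and equation (b) of [r] applies. *)
- diagram using (eq_sym hf, M, eq_sym hg, rb).
(* The upper joint morphism identifies the forward images of [c12 c2] with [c34 c4], then the lower
   one identifies the backward images of [a56 a6] with [a34 a4]. After this the outputs of [kg] are
   no longer read, and the way back to the upper morphism ends with equation (c) of [q]. *)
- symmetry; diagram using
    (eq_sym hf, hf, M, eq_sym hg, hg, eq_sym M, eq_sym hf, eq_sym qc).
Qed.
End YComposites.

Ltac nf_ycomp :=
  unfold conditionals, is_conditional, xy_ycomp_with, cond_product_of,
    xy_ycomp_upper, xy_ycomp_lower in *;
  nf_arena.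

Section YUnits.
Context {C : markov_category} {o1 o2 o3 o4 : arob C}
  {d12 : xdata o1 o2} {d34 : xdata o3 o4} {l13 : ydata o1 o3} {l24 : ydata o2 o4}
  (q : xydata d12 d34 l13 l24).

(** The forward maps of an identity square are identities, so the outputs above are already part of
    the middle row; [kf] is discarded and the lower morphism remains. On the other side the backward
    maps are projections, and [kg] is discarded in the same way. *)
Lemma xys_ycomp_idl kf kg : ycomposable (xyid d12) q -> conditionals (xyid d12) q kf kg ->
  xys (xy_ycomp_with (xyid d12) q kf kg) = xys q.
Proof.
intros H [hf hg]; pose proof (ycomp_marginals H) as M.
destruct H as (? & _ & ? & _); nf_ycomp; split_laws.
diagram using (eq_sym hf, hf, M, eq_sym hg).
Qed.

Lemma xys_ycomp_idr kf kg : ycomposable q (xyid d34) -> conditionals q (xyid d34) kf kg ->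
  xys (xy_ycomp_with q (xyid d34) kf kg) = xys q.
Proof.
intros H [hf hg]; pose proof (ycomp_marginals H) as M.
destruct H as ((? & ? & ?) & (? & _) & _); nf_ycomp; split_laws.
diagram using (eq_sym hf, hf, M, eq_sym hg, hg, eq_sym M, eq_sym hf).
Qed.
End YUnits.

(** * Associativity of the y-composition *)

Section YAssoc.
Context {C : markov_category} {o1 o2 o3 o4 o5 o6 o7 o8 : arob C}
  {d12 : xdata o1 o2} {d34 : xdata o3 o4} {d56 : xdata o5 o6} {d78 : xdata o7 o8}
  {l13 : ydata o1 o3} {l24 : ydata o2 o4} {l35 : ydata o3 o5} {l46 : ydata o4 o6}
  {l57 : ydata o5 o7} {l68 : ydata o6 o8}
  (q : xydata d12 d34 l13 l24) (r : xydata d34 d56 l35 l46) (t : xydata d56 d78 l57 l68).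

Notation B12 := (tens [ar_c (xpar d12); ar_c o2]).
Notation B34 := (tens [ar_c (xpar d34); ar_c o4; ar_a (xpar d34); ar_a o4]).
Notation B56 := (tens [ar_c (xpar d56); ar_c o6; ar_a (xpar d56); ar_a o6]).
Notation B78 := (tens [ar_a (xpar d78); ar_a o8]).

(* Precomposing with a deterministic map preserves conditionals. *)
Definition lower_assoc (kg : mor [tens [ar_c o3; ar_a o7]; B56] [B78]) :
    mor [tens [ar_c o1; ar_a o7]; B56] [B78] :=
  ungroup [[ar_c o1; ar_a o7]; [B56]] ;; (yf l13 ⊠ idw [ar_a o7; B56])
  ;; group [[ar_c o3; ar_a o7]; [B56]] ;; kg.

Definition upper_assoc (kf : mor [tens [ar_c o1; ar_a o5]; B34] [B12]) :
    mor [tens [ar_c o1; ar_a o7]; B34] [B12] :=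
  ungroup [[ar_c o1; ar_a o7]; [B34]] ;; wire [ar_c o1; ar_a o7; B34] [0; 0; 1; 2]
  ;; (idw [ar_c o1] ⊠ yf l13 ⊠ idw [ar_a o7; B34])
  ;; (idw [ar_c o1] ⊠ yf l35 ⊠ idw [ar_a o7; B34])
  ;; (idw [ar_c o1] ⊠ ysh l57 ⊠ idw [B34])
  ;; group [[ar_c o1; ar_a o5]; [B34]] ;; kf.

Lemma lower_assoc_conditional (w : xydata d12 d56 (ycomp l13 l35) (ycomp l24 l46)) kg :
  ycomposable q r -> ycomposable r t ->
  is_conditional (xy_ycomp_lower (l13 := l35) t) kg ->
  is_conditional (xy_ycomp_lower (l13 := ycomp l13 l35) t) (lower_assoc kg).
Proof.
intros ((? & ? & ? & ?) & ? & ?) ((_ & _ & ? & ?) & _ & ?) hg.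
unfold lower_assoc; nf_ycomp; split_laws; diagram using hg.
Qed.

Lemma upper_assoc_conditional kf :
  ycomposable q r -> ycomposable r t ->
  is_conditional (xy_ycomp_upper (l35 := l35) q ;; wire [B12; B34] [1; 0]) kf ->
  is_conditional (xy_ycomp_upper (l35 := ycomp l35 l57) q ;; wire [B12; B34] [1; 0])
    (upper_assoc kf).
Proof.
intros ((? & ? & ? & ?) & ? & ?) ((_ & _ & ? & ?) & _ & ?) hf.
unfold upper_assoc; nf_ycomp; split_laws; diagram using hf.
Qed.

(** Both bracketings reduce to one diagram: the middle square [r] drawn once, with [kf] producing
    the outputs above it and [k3g] those below it. The conditionals [k1f] and [k2g] attached to
    composite squares are absorbed into joint morphisms. *)
Lemma xys_ycompA kf kg k1f k2g k3f k3g
    (w := xy_ycomp_with q r kf kg) (v := xy_ycomp_with r t k3f k3g) :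
  ycomposable q r -> ycomposable r t ->
  conditionals q r kf kg -> conditionals r t k3f k3g ->
  conditionals w t k1f (lower_assoc k3g) -> conditionals q v (upper_assoc kf) k2g ->
  xys (xy_ycomp_with w t k1f (lower_assoc k3g)) = xys (xy_ycomp_with q v (upper_assoc kf) k2g).
Proof.
intros Hqr Hrt H H3 [h1f _] [_ h2g].
assert (Hqv : ycomposable q v).
{ pose proof (xylaw_ycomp Hrt H3) as Wv.
  destruct Hqr as ((? & ? & ? & ?) & ? & ?), Hrt as ((_ & _ & ? & ?) & _ & ?).
  unfold ycomposable; repeat match goal with |- _ /\ _ => split end; auto using ylaw_ycomp; exact Wv. }
destruct H as [hf hg], H3 as [h3f h3g].
pose proof (ycomp_marginals Hqr) as Mqr; pose proof (ycomp_marginals Hrt) as Mrt.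
pose proof (ycomp_marginals Hqv) as Mqv.
destruct Hqr as ((? & ? & ? & ?) & (? & _) & (? & _)), Hrt as ((_ & _ & ? & ?) & _ & (? & _)).
clear Hqv; subst w v; unfold lower_assoc, upper_assoc in *; nf_ycomp; split_laws.
diagram using (eq_sym h1f, eq_sym hf, hf, Mqr, eq_sym hg)
  and (Mqv, eq_sym h2g, eq_sym h3f, h3f, Mrt, eq_sym h3g, h3g, eq_sym Mrt, eq_sym h3f).
Qed.
End YAssoc.

(** * Interchange of x- and y-composition *)

Section Interchange.
Context {C : markov_category} {o1 o2 o3 o4 o5 o6 o7 o8 o9 : arob C}
  {d12 : xdata o1 o2} {d23 : xdata o2 o3} {d45 : xdata o4 o5} {d56 : xdata o5 o6}
  {d78 : xdata o7 o8} {d89 : xdata o8 o9}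
  {l14 : ydata o1 o4} {l25 : ydata o2 o5} {l36 : ydata o3 o6}
  {l47 : ydata o4 o7} {l58 : ydata o5 o8} {l69 : ydata o6 o9}
  (q : xydata d12 d45 l14 l25) (r : xydata d23 d56 l25 l36)
  (q' : xydata d45 d78 l47 l58) (r' : xydata d56 d89 l58 l69).

Notation c2 := (ar_c o2).
Notation c5 := (ar_c o5).
Notation c6 := (ar_c o6).
Notation a5 := (ar_a o5).
Notation a6 := (ar_a o6).
Notation a8 := (ar_a o8).
Notation c45 := (ar_c (xpar d45)).
Notation c56 := (ar_c (xpar d56)).
Notation a45 := (ar_a (xpar d45)).
Notation a56 := (ar_a (xpar d56)).
Notation B12 := (tens [ar_c (xpar d12); c2]).
Notation B45 := (tens [c45; c5; a45; a5]).
Notation B78 := (tens [ar_a (xpar d78); a8]).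
Notation B23 := (tens [ar_c (xpar d23); ar_c o3]).
Notation B56 := (tens [c56; c6; a56; a6]).
Notation B89 := (tens [ar_a (xpar d89); ar_a o9]).
Notation A1 := (tens [ar_c o1; ar_a o7]).
Notation A2 := (tens [c2; a8]).
Notation B13 := (tens [tens [ar_c (xpar d12); c2; ar_c (xpar d23)]; ar_c o3]).
Notation B46 := (tens [tens [c45; c5; c56]; c6; tens [a45; a5; a56]; a6]).
Notation B79 := (tens [tens [ar_a (xpar d78); a8; ar_a (xpar d89)]; ar_a o9]).

(* The conditionals of the second column can be taken to depend on its inputs
   c2, a8 only through c2 and the backward map into a5, respectively through the
   forward map into c5 and a8. These stage-wise inputs are available in the outputs of
   the middle row of the first column. *)
Definition upper_col (ru : mor [tens [c2; a5]; B56] [B23]) : mor [A2; B56] [B23] :=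
  ungroup [[c2; a8]; [B56]] ;; wire [c2; a8; B56] [0; 0; 1; 2]
  ;; (idw [c2] ⊠ yf l25 ⊠ idw [a8; B56]) ;; (idw [c2] ⊠ ysh l58 ⊠ idw [B56])
  ;; group [[c2; a5]; [B56]] ;; ru.

Definition lower_col (rl : mor [tens [c5; a8]; B56] [B89]) : mor [A2; B56] [B89] :=
  ungroup [[c2; a8]; [B56]] ;; (yf l25 ⊠ idw [a8; B56])
  ;; group [[c5; a8]; [B56]] ;; rl.

(** [kf] recovers the first column and in particular [c2]; then [ru] recovers the second from this
    [c2] and from the [a5] of the middle row, whence the duplicated [a5]. In [lower_row] the wires
    [a8] and [c5] take these places. *)
Definition upper_row (kf : mor [A1; B45] [B12]) (ru : mor [tens [c2; a5]; B56] [B23]) :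
    mor [A1; B46] [B13] :=
  ungroup [[A1]; [tens [c45; c5; c56]; c6; tens [a45; a5; a56]; a6]]
  ;; ungroup [[A1]; [c45; c5; c56]; [c6]; [a45; a5; a56]; [a6]]
  ;; wire [A1; c45; c5; c56; c6; a45; a5; a56; a6] [0; 1; 2; 5; 6; 6; 3; 4; 7; 8]
  ;; group [[A1]; [c45; c5; a45; a5]; [a5]; [c56; c6; a56; a6]]
  ;; (kf ⊠ idw [a5; B56]) ;; ungroup [[ar_c (xpar d12); c2]; [a5]; [B56]]
  ;; wire [ar_c (xpar d12); c2; a5; B56] [0; 1; 1; 2; 3]
  ;; group [[ar_c (xpar d12)]; [c2]; [c2; a5]; [B56]]
  ;; (idw [ar_c (xpar d12); c2] ⊠ ru)
  ;; ungroup [[ar_c (xpar d12)]; [c2]; [ar_c (xpar d23); ar_c o3]]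
  ;; group [[ar_c (xpar d12); c2; ar_c (xpar d23)]; [ar_c o3]]
  ;; group [[tens [ar_c (xpar d12); c2; ar_c (xpar d23)]; ar_c o3]].

Definition lower_row (kg : mor [A1; B45] [B78]) (rl : mor [tens [c5; a8]; B56] [B89]) :
    mor [A1; B46] [B79] :=
  ungroup [[A1]; [tens [c45; c5; c56]; c6; tens [a45; a5; a56]; a6]]
  ;; ungroup [[A1]; [c45; c5; c56]; [c6]; [a45; a5; a56]; [a6]]
  ;; wire [A1; c45; c5; c56; c6; a45; a5; a56; a6] [0; 1; 2; 5; 6; 2; 3; 4; 7; 8]
  ;; group [[A1]; [c45; c5; a45; a5]; [c5]; [c56; c6; a56; a6]]
  ;; (kg ⊠ idw [c5; B56]) ;; ungroup [[ar_a (xpar d78); a8]; [c5]; [B56]]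
  ;; wire [ar_a (xpar d78); a8; c5; B56] [0; 1; 2; 1; 3]
  ;; group [[ar_a (xpar d78)]; [a8]; [c5; a8]; [B56]]
  ;; (idw [ar_a (xpar d78); a8] ⊠ rl)
  ;; ungroup [[ar_a (xpar d78)]; [a8]; [ar_a (xpar d89); ar_a o9]]
  ;; group [[ar_a (xpar d78); a8; ar_a (xpar d89)]; [ar_a o9]]
  ;; group [[tens [ar_a (xpar d78); a8; ar_a (xpar d89)]; ar_a o9]].

Hypotheses (H1 : ycomposable q q') (H2 : ycomposable r r').

(** This is the upper morphism of the second column from the point where [a5] is available. The
    middle row is listed first because [ru] conditions on it. *)
Definition upper_stage : mor [tens [c2; a5]] [B56; B23] :=
  ungroup [[c2; a5]] ;; xys r
  ;; wire [ar_c (xpar d23); ar_c o3; a56; a6] [0; 1; 2; 3; 0; 1]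
  ;; (yf (xyy r) ⊠ yf l36 ⊠ idw [a56; a6; ar_c (xpar d23); ar_c o3])
  ;; group [[c56; c6; a56; a6]; [ar_c (xpar d23); ar_c o3]].

Definition lower_stage : mor [tens [c5; a8]] [B56; B89] :=
  ungroup [[c5; a8]] ;; xys r'
  ;; wire [c56; c6; ar_a (xpar d89); ar_a o9] [0; 1; 0; 2; 1; 3; 2; 3]
  ;; (idw [c56; c6] ⊠ ysh (xyy r') ⊠ ysh l69 ⊠ idw [ar_a (xpar d89); ar_a o9])
  ;; group [[c56; c6; a56; a6]; [ar_a (xpar d89); ar_a o9]].

Lemma upper_col_conditional ru : is_conditional upper_stage ru ->
  is_conditional (xy_ycomp_upper (l35 := l58) r ;; wire [B23; B56] [1; 0]) (upper_col ru).
Proof.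
pose proof H1 as ((? & ? & ? & ?) & (? & _) & (? & _)).
pose proof H2 as ((_ & ? & _ & ?) & (? & _) & (? & _)).
clear H1 H2; intros h; unfold upper_col, upper_stage in *; nf_ycomp; split_laws.
diagram using h.
Qed.
Lemma lower_col_conditional rl : is_conditional lower_stage rl ->
  is_conditional (xy_ycomp_lower (l13 := l25) r') (lower_col rl).
Proof.
pose proof H1 as ((? & ? & ? & ?) & (? & _) & (? & _)).
pose proof H2 as ((_ & ? & _ & ?) & (? & _) & (? & _)).
clear H1 H2; intros h; unfold lower_col, lower_stage in *; nf_ycomp; split_laws.
diagram using h.
Qed.

(** By equation (b) of [r], the second middle row depends on [c2] only through its image [c5], which
    belongs to the first middle row. It can therefore be drawn before [kf] recovers [c2]. *)
Lemma upper_row_conditional kf ru :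
  is_conditional (xy_ycomp_upper (l35 := l47) q ;; wire [B12; B45] [1; 0]) kf ->
  is_conditional upper_stage ru ->
  is_conditional (xy_ycomp_upper (l35 := l47) (xy_xcomp q r) ;; wire [B13; B46] [1; 0])
    (upper_row kf ru).
Proof.
pose proof H1 as ((? & ? & ? & ?) & (? & _) & (? & _)).
pose proof H2 as ((_ & ? & _ & ?) & (? & _ & rb & _) & (? & _)).
clear H1 H2; intros hf h; unfold upper_row, upper_stage in *; nf_ycomp; split_laws.
diagram using (h, rb, hf) and rb.
Qed.

(** Dually, equation (c) of [r'] makes the second middle row depend on [a8] only through [a5], so
    that it can be drawn before [kg] recovers [a8]. *)
Lemma lower_row_conditional kg rl :
  is_conditional (xy_ycomp_lower (l13 := l14) q') kg ->
  is_conditional lower_stage rl ->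
  is_conditional (xy_ycomp_lower (l13 := l14) (xy_xcomp q' r')) (lower_row kg rl).
Proof.
pose proof H1 as ((? & ? & ? & ?) & (? & _) & (? & _)).
pose proof H2 as ((_ & ? & _ & ?) & (? & _) & (? & _ & _ & rc)).
clear H1 H2; intros hf h; unfold lower_row, lower_stage in *; nf_ycomp; split_laws.
diagram using (h, eq_sym rc, hf) and (eq_sym rc).
Qed.

(** The composite of the columns computes [c5] and [a5] afresh from [c2] and [a8]. The two joint
    morphisms of the first column show that they coincide with the wires [c5] and [a5] of its middle
    row, which is what the composite of the rows reads. *)
Lemma xys_interchange kf kg ru rl :
  conditionals q q' kf kg -> is_conditional upper_stage ru -> is_conditional lower_stage rl ->
  xys (xy_ycomp_with (xy_xcomp q r) (xy_xcomp q' r') (upper_row kf ru) (lower_row kg rl))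
  = xys (xy_xcomp (xy_ycomp_with q q' kf kg)
           (xy_ycomp_with r r' (upper_col ru) (lower_col rl))).
Proof.
intros [hf hg] hu hl; pose proof (ycomp_marginals H1) as M.
pose proof H1 as ((? & ? & ? & ?) & (? & _) & (? & _)).
pose proof H2 as ((_ & ? & _ & ?) & (? & _ & rb & _) & (? & _)).
clear H1 H2 hu hl; unfold upper_row, lower_row, upper_col, lower_col; nf_ycomp; split_laws.
diagram using rb and (rb, eq_sym hf, hf, M, eq_sym hg, hg, eq_sym M).
Qed.
End Interchange.

(** * Tensor products of y-composites *)

Section YTensor.
Context {C : markov_category} {o1 o2 o3 o4 o5 o6 o1' o2' o3' o4' o5' o6' : arob C}
  {d12 : xdata o1 o2} {d34 : xdata o3 o4} {d56 : xdata o5 o6}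
  {l13 : ydata o1 o3} {l24 : ydata o2 o4} {l35 : ydata o3 o5} {l46 : ydata o4 o6}
  {d12' : xdata o1' o2'} {d34' : xdata o3' o4'} {d56' : xdata o5' o6'}
  {l13' : ydata o1' o3'} {l24' : ydata o2' o4'} {l35' : ydata o3' o5'} {l46' : ydata o4' o6'}
  (q : xydata d12 d34 l13 l24) (r : xydata d34 d56 l35 l46)
  (q' : xydata d12' d34' l13' l24') (r' : xydata d34' d56' l35' l46').

Notation A := (tens [ar_c o1; ar_a o5]).
Notation B0 := (tens [ar_c (xpar d12); ar_c o2]).
Notation B1 := (tens [ar_c (xpar d34); ar_c o4; ar_a (xpar d34); ar_a o4]).
Notation B2 := (tens [ar_a (xpar d56); ar_a o6]).
Notation A' := (tens [ar_c o1'; ar_a o5']).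
Notation B0' := (tens [ar_c (xpar d12'); ar_c o2']).
Notation B1' := (tens [ar_c (xpar d34'); ar_c o4'; ar_a (xpar d34'); ar_a o4']).
Notation B2' := (tens [ar_a (xpar d56'); ar_a o6']).
Notation P x y := (tens [x; y]).
Notation AA := (tens [P (ar_c o1) (ar_c o1'); P (ar_a o5) (ar_a o5')]).
Notation BB0 := (tens [P (ar_c (xpar d12)) (ar_c (xpar d12')); P (ar_c o2) (ar_c o2')]).
Notation BB1 := (tens [P (ar_c (xpar d34)) (ar_c (xpar d34')); P (ar_c o4) (ar_c o4');
  P (ar_a (xpar d34)) (ar_a (xpar d34')); P (ar_a o4) (ar_a o4')]).
Notation BB2 := (tens [P (ar_a (xpar d56)) (ar_a (xpar d56')); P (ar_a o6) (ar_a o6')]).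

Definition conditional_ten X Y X' Y' (k : mor [A; B1] [P X Y]) (k' : mor [A'; B1'] [P X' Y']) :
    mor [AA; BB1] [P (P X X') (P Y Y')] :=
  ungroup [[P (ar_c o1) (ar_c o1'); P (ar_a o5) (ar_a o5')];
           [P (ar_c (xpar d34)) (ar_c (xpar d34')); P (ar_c o4) (ar_c o4');
            P (ar_a (xpar d34)) (ar_a (xpar d34')); P (ar_a o4) (ar_a o4')]]
  ;; ungroup [[ar_c o1; ar_c o1']; [ar_a o5; ar_a o5'];
              [ar_c (xpar d34); ar_c (xpar d34')]; [ar_c o4; ar_c o4'];
              [ar_a (xpar d34); ar_a (xpar d34')]; [ar_a o4; ar_a o4']]
  ;; wire [ar_c o1; ar_c o1'; ar_a o5; ar_a o5'; ar_c (xpar d34); ar_c (xpar d34');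
           ar_c o4; ar_c o4'; ar_a (xpar d34); ar_a (xpar d34'); ar_a o4; ar_a o4']
       [0; 2; 4; 6; 8; 10; 1; 3; 5; 7; 9; 11]
  ;; group [[ar_c o1; ar_a o5]; [ar_c (xpar d34); ar_c o4; ar_a (xpar d34); ar_a o4];
            [ar_c o1'; ar_a o5']; [ar_c (xpar d34'); ar_c o4'; ar_a (xpar d34'); ar_a o4']]
  ;; (k ⊠ k') ;; ungroup [[X; Y]; [X'; Y']] ;; wire [X; Y; X'; Y'] [0; 2; 1; 3]
  ;; group [[X; X']; [Y; Y']] ;; group [[P X X'; P Y Y']].

Lemma conditionals_ten kf kg kf' kg' :
  ycomposable q r -> ycomposable q' r' ->
  conditionals q r kf kg -> conditionals q' r' kf' kg' ->
  conditionals (xy_ten q q') (xy_ten r r')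
    (conditional_ten kf kf') (conditional_ten kg kg').
Proof.
intros ((? & ? & ? & ?) & (? & _) & (? & _)) ((? & ? & ? & ?) & (? & _) & (? & _))
  [hf hg] [hf' hg']; split; unfold conditional_ten; nf_ycomp; split_laws.
- diagram using (hf, hf').
- diagram using (hg, hg').
Qed.

Lemma xys_ycomp_ten kf kg kf' kg' :
  ycomposable q r -> ycomposable q' r' ->
  xys (xy_ycomp_with (xy_ten q q') (xy_ten r r') (conditional_ten kf kf') (conditional_ten kg kg'))
  = xys (xy_ten (xy_ycomp_with q r kf kg) (xy_ycomp_with q' r' kf' kg')).
Proof.
intros ((? & ? & ? & ?) & (? & _) & (? & _)) ((? & ? & ? & ?) & (? & _) & (? & _));
  unfold conditional_ten; nf_ycomp; split_laws; diagram.
Qed.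
End YTensor.

(** * Laws of the y-composition, independently of the conditionals *)

Section YLaws.
Context {C : markov_category} (HC : has_conditionals C).

Lemma is_ycomposable (o1 o2 o3 o4 o5 o6 : arob C)
    (d12 : xdata o1 o2) (d34 : xdata o3 o4) (d56 : xdata o5 o6)
    (l13 : ydata o1 o3) (l24 : ydata o2 o4) (l35 : ydata o3 o5) (l46 : ydata o4 o6)
    (q : xydata d12 d34 l13 l24) (r : xydata d34 d56 l35 l46) :
  ylaw l13 -> ylaw l24 -> ylaw l35 -> ylaw l46 -> xylaw q -> xylaw r -> ycomposable q r.
Proof. unfold ycomposable; auto 10. Qed.

Lemma exists_ycomp (o1 o2 o3 o4 o5 o6 : arob C)
    (d12 : xdata o1 o2) (d34 : xdata o3 o4) (d56 : xdata o5 o6)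
    (l13 : ydata o1 o3) (l24 : ydata o2 o4) (l35 : ydata o3 o5) (l46 : ydata o4 o6)
    (q : xydata d12 d34 l13 l24) (r : xydata d34 d56 l35 l46) :
  ycomposable q r -> exists w, is_xy_ycomp q r w /\ xylaw w.
Proof.
intros H; destruct (exists_conditionals q r HC) as (kf & kg & K).
exists (xy_ycomp_with q r kf kg); split; [now apply (is_xy_ycompE _ H K)|].
now apply xylaw_ycomp.
Qed.

Lemma is_xy_ycomp_idl (o1 o2 o3 o4 : arob C) (d12 : xdata o1 o2) (d34 : xdata o3 o4)
    (l13 : ydata o1 o3) (l24 : ydata o2 o4) (q : xydata d12 d34 l13 l24) w :
  xlaw d12 -> ylaw l13 -> ylaw l24 -> xylaw q ->
  is_xy_ycomp (xyid d12) q w -> xys w = xys q.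
Proof.
intros hd h13 h24 hq Hw.
assert (H : ycomposable (xyid d12) q)
  by (apply is_ycomposable; auto using ylaw_yid, xylaw_xyid).
destruct (exists_conditionals (xyid d12) q HC) as (kf & kg & K).
apply (is_xy_ycompE _ H K) in Hw; subst w; now apply xys_ycomp_idl.
Qed.

Lemma is_xy_ycomp_idr (o1 o2 o3 o4 : arob C) (d12 : xdata o1 o2) (d34 : xdata o3 o4)
    (l13 : ydata o1 o3) (l24 : ydata o2 o4) (q : xydata d12 d34 l13 l24) w :
  xlaw d34 -> ylaw l13 -> ylaw l24 -> xylaw q ->
  is_xy_ycomp q (xyid d34) w -> xys w = xys q.
Proof.
intros hd h13 h24 hq Hw.
assert (H : ycomposable q (xyid d34))
  by (apply is_ycomposable; auto using ylaw_yid, xylaw_xyid).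
destruct (exists_conditionals q (xyid d34) HC) as (kf & kg & K).
apply (is_xy_ycompE _ H K) in Hw; subst w; now apply xys_ycomp_idr.
Qed.

Lemma is_xy_ycompA (o1 o2 o3 o4 o5 o6 o7 o8 : arob C)
    (d12 : xdata o1 o2) (d34 : xdata o3 o4) (d56 : xdata o5 o6) (d78 : xdata o7 o8)
    (l13 : ydata o1 o3) (l24 : ydata o2 o4) (l35 : ydata o3 o5) (l46 : ydata o4 o6)
    (l57 : ydata o5 o7) (l68 : ydata o6 o8)
    (q : xydata d12 d34 l13 l24) (r : xydata d34 d56 l35 l46) (t : xydata d56 d78 l57 l68)
    w v x y :
  ycomposable q r -> ycomposable r t ->
  is_xy_ycomp q r w -> is_xy_ycomp w t x -> is_xy_ycomp r t v -> is_xy_ycomp q v y ->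
  xys x = xys y.
Proof.
intros Hqr Hrt Hw Hx Hv Hy.
destruct (exists_conditionals q r HC) as (kf & kg & K).
destruct (exists_conditionals r t HC) as (k3f & k3g & K3).
apply (is_xy_ycompE _ Hqr K) in Hw; apply (is_xy_ycompE _ Hrt K3) in Hv.
assert (Hwt : ycomposable w t).
{ subst w; pose proof (xylaw_ycomp Hqr K).
  destruct Hqr as ((? & ? & ? & ?) & ? & ?), Hrt as ((_ & _ & ? & ?) & _ & ?).
  apply is_ycomposable; auto using ylaw_ycomp. }
assert (Hqv : ycomposable q v).
{ subst v; pose proof (xylaw_ycomp Hrt K3).
  destruct Hqr as ((? & ? & ? & ?) & ? & ?), Hrt as ((_ & _ & ? & ?) & _ & ?).
  apply is_ycomposable; auto using ylaw_ycomp. }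
destruct (exists_conditionals w t HC) as (k1f & k1g & K1).
destruct (exists_conditionals q v HC) as (k2f & k2g & K2).
(* Only one half of each pair is prescribed, the one that comes from [q, r] or from [r, t]; the
   other half can be any conditional. *)
assert (L1 : conditionals w t k1f (lower_assoc (l13 := l13) k3g)).
{ split; [apply K1|apply (lower_assoc_conditional w Hqr Hrt); apply K3]. }
assert (L2 : conditionals q v (upper_assoc (l13 := l13) (l35 := l35) (l57 := l57) kf) k2g).
{ split; [apply (upper_assoc_conditional Hqr Hrt); apply K|apply K2]. }
apply (is_xy_ycompE _ Hwt L1) in Hx; apply (is_xy_ycompE _ Hqv L2) in Hy.
subst x y w v; now apply xys_ycompA.
Qed.

Lemma is_xy_ycomp_interchange (o1 o2 o3 o4 o5 o6 o7 o8 o9 : arob C)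
    (d12 : xdata o1 o2) (d23 : xdata o2 o3) (d45 : xdata o4 o5) (d56 : xdata o5 o6)
    (d78 : xdata o7 o8) (d89 : xdata o8 o9)
    (l14 : ydata o1 o4) (l25 : ydata o2 o5) (l36 : ydata o3 o6)
    (l47 : ydata o4 o7) (l58 : ydata o5 o8) (l69 : ydata o6 o9)
    (q : xydata d12 d45 l14 l25) (r : xydata d23 d56 l25 l36)
    (q' : xydata d45 d78 l47 l58) (r' : xydata d56 d89 l58 l69) w1 w2 w :
  ycomposable q q' -> ycomposable r r' ->
  is_xy_ycomp q q' w1 -> is_xy_ycomp r r' w2 ->
  is_xy_ycomp (xy_xcomp q r) (xy_xcomp q' r') w ->
  xys w = xys (xy_xcomp w1 w2).
Proof.
intros H1 H2 Hw1 Hw2 Hw.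
destruct (exists_conditionals q q' HC) as (kf & kg & K).
(* These conditionals of the two stages are the common source of the conditionals for the second
   column and for the composite rows. *)
destruct (HC (upper_stage r)) as [ru hu].
destruct (HC (lower_stage r')) as [rl hl].
assert (K2 : conditionals r r' (upper_col (l25 := l25) (l58 := l58) ru) (lower_col (l25 := l25) rl)).
{ split; [now apply (upper_col_conditional H1 H2)|now apply (lower_col_conditional H1 H2)]. }
assert (K3 : conditionals (xy_xcomp q r) (xy_xcomp q' r') (upper_row kf ru) (lower_row kg rl)).
{ destruct K; split; [now apply (upper_row_conditional H1 H2)|now apply (lower_row_conditional H1 H2)]. }
assert (H3 : ycomposable (xy_xcomp q r) (xy_xcomp q' r')).
{ destruct H1 as ((? & ? & ? & ?) & ? & ?), H2 as ((? & ? & ? & ?) & ? & ?).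
  apply is_ycomposable; auto using xylaw_xy_xcomp. }
apply (is_xy_ycompE _ H1 K) in Hw1; apply (is_xy_ycompE _ H2 K2) in Hw2.
apply (is_xy_ycompE _ H3 K3) in Hw; subst w1 w2 w.
now apply xys_interchange.
Qed.

Lemma is_xy_ycomp_ten (o1 o2 o3 o4 o5 o6 o1' o2' o3' o4' o5' o6' : arob C)
    (d12 : xdata o1 o2) (d34 : xdata o3 o4) (d56 : xdata o5 o6)
    (l13 : ydata o1 o3) (l24 : ydata o2 o4) (l35 : ydata o3 o5) (l46 : ydata o4 o6)
    (d12' : xdata o1' o2') (d34' : xdata o3' o4') (d56' : xdata o5' o6')
    (l13' : ydata o1' o3') (l24' : ydata o2' o4') (l35' : ydata o3' o5') (l46' : ydata o4' o6')
    (q : xydata d12 d34 l13 l24) (r : xydata d34 d56 l35 l46)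
    (q' : xydata d12' d34' l13' l24') (r' : xydata d34' d56' l35' l46') w w' x :
  ycomposable q r -> ycomposable q' r' ->
  is_xy_ycomp q r w -> is_xy_ycomp q' r' w' ->
  is_xy_ycomp (xy_ten q q') (xy_ten r r') x -> xys x = xys (xy_ten w w').
Proof.
intros H H' Hw Hw' Hx.
destruct (exists_conditionals q r HC) as (kf & kg & K).
destruct (exists_conditionals q' r' HC) as (kf' & kg' & K').
pose proof (conditionals_ten H H' K K') as K2.
assert (H2 : ycomposable (xy_ten q q') (xy_ten r r')).
{ destruct H as ((? & ? & ? & ?) & ? & ?), H' as ((? & ? & ? & ?) & ? & ?).
  apply is_ycomposable; auto using ylaw_yten, xylaw_xy_ten. }
apply (is_xy_ycompE _ H K) in Hw; apply (is_xy_ycompE _ H' K') in Hw'.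
apply (is_xy_ycompE _ H2 K2) in Hx; subst w w' x.
now apply xys_ycomp_ten.
Qed.
End YLaws.

(** * Cells of the triple category *)

Ltac irr := repeat match goal with
  | h : ?P, k : ?P |- _ => destruct (proof_irrelevance P h k)
  end.

Section Cells.
Context {C : markov_category}.
Implicit Types o : arob C.

Lemma MkX_inj o1 o2 (d d' : xdata o1 o2) h h' : MkX (X_d := d) h = MkX (X_d := d') h' -> d = d'.
Proof. intros e; injection e as e; now repeat apply inj_pair2 in e. Qed.

Lemma MkY_inj o1 o2 (l l' : ydata o1 o2) h h' : MkY (Y_d := l) h = MkY (Y_d := l') h' -> l = l'.
Proof. intros e; injection e as e; now repeat apply inj_pair2 in e. Qed.

Lemma MkZ_inj o1 o2 (z z' : zdata o1 o2) h h' : MkZ (Z_d := z) h = MkZ (Z_d := z') h' -> z = z'.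
Proof. intros e; injection e as e; now repeat apply inj_pair2 in e. Qed.
End Cells.

Ltac subst_eq e :=
  match type of e with
  | ?a = ?a => clear e
  | ?a = ?b => first [is_var a; subst a | is_var b; subst b]
  end.

(* Identify objects, and the data of cells [MkX], [MkY] or [MkZ], known to be equal. *)
Ltac glue :=
  repeat match goal with
  | p : ?a = ?b :> arob _ |- _ =>
      tryif constr_eq a b then fail else idtac;
      is_var b; first [is_var a | lazymatch a with oten _ _ => idtac end]; destruct p
  | p : @MkX _ _ _ ?d _ = @MkX _ _ _ ?d' _ |- _ =>
      tryif constr_eq d d' then fail else idtac;
      let e := fresh in
      pose proof (f_equal (@X_s _) p) as e; cbn [X_s] in e; subst_eq e;
      pose proof (f_equal (@X_t _) p) as e; cbn [X_t] in e; subst_eq e;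
      pose proof (MkX_inj p) as e; try clear p; subst_eq e
  | p : @MkY _ _ _ ?d _ = @MkY _ _ _ ?d' _ |- _ =>
      tryif constr_eq d d' then fail else idtac;
      let e := fresh in
      pose proof (f_equal (@Y_s _) p) as e; cbn [Y_s] in e; subst_eq e;
      pose proof (f_equal (@Y_t _) p) as e; cbn [Y_t] in e; subst_eq e;
      pose proof (MkY_inj p) as e; try clear p; subst_eq e
  | p : @MkZ _ _ _ ?d _ = @MkZ _ _ _ ?d' _ |- _ =>
      tryif constr_eq d d' then fail else idtac;
      let e := fresh in
      pose proof (f_equal (@Z_s _) p) as e; cbn [Z_s] in e; subst_eq e;
      pose proof (f_equal (@Z_t _) p) as e; cbn [Z_t] in e; subst_eq e;
      pose proof (MkZ_inj p) as e; try clear p; subst_eq e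
  end.

Section CellExt.
Context {C : markov_category}.
Implicit Types o : arob C.

Lemma MkX_eq o1 o2 o1' o2' (d : xdata o1 o2) h (d' : xdata o1' o2') h' :
  o1 = o1' -> o2 = o2' -> xpar d = xpar d' ->
  Arr (xf d) = Arr (xf d') -> Arr (xfb d) = Arr (xfb d') ->
  MkX (X_d := d) h = MkX (X_d := d') h'.
Proof.
intros <- <-; destruct d, d'; cbn; intros <- e%Arr_inj e'%Arr_inj; subst.
irr; reflexivity.
Qed.

Lemma MkY_eq o1 o2 o1' o2' (l : ydata o1 o2) h (l' : ydata o1' o2') h' :
  o1 = o1' -> o2 = o2' ->
  Arr (yf l) = Arr (yf l') -> Arr (ysh l) = Arr (ysh l') ->
  MkY (Y_d := l) h = MkY (Y_d := l') h'.
Proof.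
intros <- <-; destruct l, l'; cbn; intros e%Arr_inj e'%Arr_inj; subst.
irr; reflexivity.
Qed.

Lemma MkZ_eq o1 o2 o1' o2' (z : zdata o1 o2) h (z' : zdata o1' o2') h' :
  o1 = o1' -> o2 = o2' ->
  Arr (zf z) = Arr (zf z') -> Arr (zg z) = Arr (zg z') ->
  MkZ (Z_d := z) h = MkZ (Z_d := z') h'.
Proof.
intros <- <-; destruct z, z'; cbn; intros e%Arr_inj e'%Arr_inj; subst.
irr; reflexivity.
Qed.

Notation sq := (arena_squares (C := C)).

Lemma XY_eq (q r : ArXY (C := C)) :
  xsXY (s := sq) q = xsXY (s := sq) r -> xtXY (s := sq) q = xtXY (s := sq) r ->
  ysXY (s := sq) q = ysXY (s := sq) r -> ytXY (s := sq) q = ytXY (s := sq) r ->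
  Arr (yf (xyy (XY_d q))) = Arr (yf (xyy (XY_d r))) ->
  Arr (ysh (xyy (XY_d q))) = Arr (ysh (xyy (XY_d r))) ->
  Arr (xys (XY_d q)) = Arr (xys (XY_d r)) -> q = r.
Proof.
destruct q as [o1 o2 o3 o4 d h d' h' l hl l' hl' [[f g] s] hq],
  r as [p1 p2 p3 p4 e k e' k' m hm m' hm' [[f' g'] s'] hr]; cbn.
intros E1 E2 E3 E4; glue; intros e1%Arr_inj e2%Arr_inj e3%Arr_inj; subst.
irr; reflexivity.
Qed.

Lemma XZ_eq (q r : ArXZ (C := C)) :
  xsXZ (s := sq) q = xsXZ (s := sq) r -> xtXZ (s := sq) q = xtXZ (s := sq) r ->
  zsXZ (s := sq) q = zsXZ (s := sq) r -> ztXZ (s := sq) q = ztXZ (s := sq) r ->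
  Arr (zf (XZ_d q)) = Arr (zf (XZ_d r)) -> Arr (zg (XZ_d q)) = Arr (zg (XZ_d r)) -> q = r.
Proof.
destruct q as [o1 o2 o3 o4 d h d' h' l hl l' hl' [f g] hq],
  r as [p1 p2 p3 p4 e k e' k' m hm m' hm' [f' g'] hr]; cbn.
intros E1 E2 E3 E4; glue; intros e1%Arr_inj e2%Arr_inj; subst.
irr; reflexivity.
Qed.

Lemma YZ_eq (q r : ArYZ (C := C)) :
  ysYZ (s := sq) q = ysYZ (s := sq) r -> ytYZ (s := sq) q = ytYZ (s := sq) r ->
  zsYZ (s := sq) q = zsYZ (s := sq) r -> ztYZ (s := sq) q = ztYZ (s := sq) r -> q = r.
Proof.
destruct q as [o1 o2 o3 o4 d h d' h' l hl l' hl' hq],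
  r as [p1 p2 p3 p4 e k e' k' m hm m' hm' hr]; cbn.
intros E1 E2 E3 E4; glue; irr; reflexivity.
Qed.

(** ** Composable cells *)

(** This and its analogues below eliminate composable pairs: only cells that literally share their
    common boundary need be treated. They are transparent and compute on reflexive proofs, so that
    compositions can be defined by them. *)
Definition glue_X (P : ArX (C := C) -> ArX (C := C) -> Type)
    (F : forall o1 o2 o3 (d : xdata o1 o2) hd (e : xdata o2 o3) he,
      P (MkX (X_d := d) hd) (MkX (X_d := e) he))
    f g (p : X_t f = X_s g) : P f g.
Proof.
destruct f as [o1 o2 d hd], g as [o2' o3 e he]; cbn in p; destruct p; apply F.
Defined.

Definition glue_Y (P : ArY (C := C) -> ArY (C := C) -> Type)
    (F : forall o1 o2 o3 (d : ydata o1 o2) hd (e : ydata o2 o3) he,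
      P (MkY (Y_d := d) hd) (MkY (Y_d := e) he))
    f g (p : Y_t f = Y_s g) : P f g.
Proof.
destruct f as [o1 o2 d hd], g as [o2' o3 e he]; cbn in p; destruct p; apply F.
Defined.

Definition glue_Z (P : ArZ (C := C) -> ArZ (C := C) -> Type)
    (F : forall o1 o2 o3 (d : zdata o1 o2) hd (e : zdata o2 o3) he,
      P (MkZ (Z_d := d) hd) (MkZ (Z_d := e) he))
    f g (p : Z_t f = Z_s g) : P f g.
Proof.
destruct f as [o1 o2 d hd], g as [o2' o3 e he]; cbn in p; destruct p; apply F.
Defined.

Definition glue_XYx (P : ArXY (C := C) -> ArXY (C := C) -> Type)
    (F : forall o1 o2 o3 o4 o5 o6 (d12 : xdata o1 o2) h12 (d23 : xdata o2 o3) h23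
      (d45 : xdata o4 o5) h45 (d56 : xdata o5 o6) h56
      (l14 : ydata o1 o4) h14 (l25 : ydata o2 o5) h25 (l36 : ydata o3 o6) h36
      (q : xydata d12 d45 l14 l25) hq (r : xydata d23 d56 l25 l36) hr,
      P (@MkXY _ _ _ _ _ d12 h12 d45 h45 l14 h14 l25 h25 q hq)
        (@MkXY _ _ _ _ _ d23 h23 d56 h56 l25 h25 l36 h36 r hr))
    q r (p : xtXY (s := sq) q = xsXY (s := sq) r) : P q r.
Proof.
destruct r as [o2 o3 o5 o6 d23 h23 d56 h56 l25 h25 l36 h36 r hr]; cbn in p.
revert o3 o6 d23 h23 d56 h56 l36 h36 r hr.
(* The right square is stated over an arbitrary packed lens [y], through its projections. For the
   given lens these compute to the original data, and matching on [p] puts the right side of [q] in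
   its place. *)
refine (match p in _ = y return
  forall o3 o6 (d23 : xdata (Y_s y) o3) h23 (d56 : xdata (Y_t y) o6) h56
    (l36 : ydata o3 o6) h36 (r : xydata d23 d56 (Y_d y) l36) hr,
  P q (@MkXY _ _ _ _ _ d23 h23 d56 h56 (Y_d y) (Y_ok y) l36 h36 r hr)
  with eq_refl => _ end).
destruct q; intros; apply F.
Defined.

Definition glue_XYy (P : ArXY (C := C) -> ArXY (C := C) -> Type)
    (F : forall o1 o2 o3 o4 o5 o6 (d12 : xdata o1 o2) h12 (d34 : xdata o3 o4) h34
      (d56 : xdata o5 o6) h56
      (l13 : ydata o1 o3) h13 (l24 : ydata o2 o4) h24
      (l35 : ydata o3 o5) h35 (l46 : ydata o4 o6) h46
      (q : xydata d12 d34 l13 l24) hq (r : xydata d34 d56 l35 l46) hr,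
      P (@MkXY _ _ _ _ _ d12 h12 d34 h34 l13 h13 l24 h24 q hq)
        (@MkXY _ _ _ _ _ d34 h34 d56 h56 l35 h35 l46 h46 r hr))
    q r (p : ytXY (s := sq) q = ysXY (s := sq) r) : P q r.
Proof.
destruct r as [o3 o4 o5 o6 d34 h34 d56 h56 l35 h35 l46 h46 r hr]; cbn in p.
revert o5 o6 d56 h56 l35 h35 l46 h46 r hr.
refine (match p in _ = x return
  forall o5 o6 (d56 : xdata o5 o6) h56 (l35 : ydata (X_s x) o5) h35
    (l46 : ydata (X_t x) o6) h46 (r : xydata (X_d x) d56 l35 l46) hr,
  P q (@MkXY _ _ _ _ _ (X_d x) (X_ok x) d56 h56 l35 h35 l46 h46 r hr)
  with eq_refl => _ end).
destruct q; intros; apply F.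
Defined.

Definition glue_XZx (P : ArXZ (C := C) -> ArXZ (C := C) -> Type)
    (F : forall o1 o2 o3 o4 o5 o6 (d12 : xdata o1 o2) h12 (d23 : xdata o2 o3) h23
      (d45 : xdata o4 o5) h45 (d56 : xdata o5 o6) h56
      (l14 : zdata o1 o4) h14 (l25 : zdata o2 o5) h25 (l36 : zdata o3 o6) h36
      (q : zdata (xpar d12) (xpar d45)) hq (r : zdata (xpar d23) (xpar d56)) hr,
      P (@MkXZ _ _ _ _ _ d12 h12 d45 h45 l14 h14 l25 h25 q hq)
        (@MkXZ _ _ _ _ _ d23 h23 d56 h56 l25 h25 l36 h36 r hr))
    q r (p : xtXZ (s := sq) q = xsXZ (s := sq) r) : P q r.
Proof.
destruct r as [o2 o3 o5 o6 d23 h23 d56 h56 l25 h25 l36 h36 r hr]; cbn in p.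
revert o3 o6 d23 h23 d56 h56 l36 h36 r hr.
refine (match p in _ = y return
  forall o3 o6 (d23 : xdata (Z_s y) o3) h23 (d56 : xdata (Z_t y) o6) h56
    (l36 : zdata o3 o6) h36 (r : zdata (xpar d23) (xpar d56)) (hr : xzlaw (Z_d y) l36 r),
  P q (@MkXZ _ _ _ _ _ d23 h23 d56 h56 (Z_d y) (Z_ok y) l36 h36 r hr)
  with eq_refl => _ end).
destruct q; intros; apply F.
Defined.

Definition glue_XZz (P : ArXZ (C := C) -> ArXZ (C := C) -> Type)
    (F : forall o1 o2 o3 o4 o5 o6 (d12 : xdata o1 o2) h12 (d34 : xdata o3 o4) h34
      (d56 : xdata o5 o6) h56
      (l13 : zdata o1 o3) h13 (l24 : zdata o2 o4) h24
      (l35 : zdata o3 o5) h35 (l46 : zdata o4 o6) h46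
      (q : zdata (xpar d12) (xpar d34)) hq (r : zdata (xpar d34) (xpar d56)) hr,
      P (@MkXZ _ _ _ _ _ d12 h12 d34 h34 l13 h13 l24 h24 q hq)
        (@MkXZ _ _ _ _ _ d34 h34 d56 h56 l35 h35 l46 h46 r hr))
    q r (p : ztXZ (s := sq) q = zsXZ (s := sq) r) : P q r.
Proof.
destruct r as [o3 o4 o5 o6 d34 h34 d56 h56 l35 h35 l46 h46 r hr]; cbn in p.
revert o5 o6 d56 h56 l35 h35 l46 h46 r hr.
refine (match p in _ = x return
  forall o5 o6 (d56 : xdata o5 o6) h56 (l35 : zdata (X_s x) o5) h35
    (l46 : zdata (X_t x) o6) h46 (r : zdata (xpar (X_d x)) (xpar d56)) (hr : xzlaw l35 l46 r),
  P q (@MkXZ _ _ _ _ _ (X_d x) (X_ok x) d56 h56 l35 h35 l46 h46 r hr)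
  with eq_refl => _ end).
destruct q; intros; apply F.
Defined.

Definition glue_YZy (P : ArYZ (C := C) -> ArYZ (C := C) -> Type)
    (F : forall o1 o2 o3 o4 o5 o6 (l13 : ydata o1 o3) h13 (l24 : ydata o2 o4) h24
      (l35 : ydata o3 o5) h35 (l46 : ydata o4 o6) h46
      (z12 : zdata o1 o2) h12 (z34 : zdata o3 o4) h34 (z56 : zdata o5 o6) h56 hq hr,
      P (@MkYZ _ _ _ _ _ l13 h13 l24 h24 z12 h12 z34 h34 hq)
        (@MkYZ _ _ _ _ _ l35 h35 l46 h46 z34 h34 z56 h56 hr))
    q r (p : ytYZ (s := sq) q = ysYZ (s := sq) r) : P q r.
Proof.
destruct r as [o3 o4 o5 o6 l35 h35 l46 h46 z34 h34 z56 h56 hr]; cbn in p.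
revert o5 o6 l35 h35 l46 h46 z56 h56 hr.
refine (match p in _ = x return
  forall o5 o6 (l35 : ydata (Z_s x) o5) h35 (l46 : ydata (Z_t x) o6) h46
    (z56 : zdata o5 o6) h56 (hr : yzlaw l35 l46 (Z_d x) z56),
  P q (@MkYZ _ _ _ _ _ l35 h35 l46 h46 (Z_d x) (Z_ok x) z56 h56 hr)
  with eq_refl => _ end).
destruct q; intros; apply F.
Defined.

Definition glue_YZz (P : ArYZ (C := C) -> ArYZ (C := C) -> Type)
    (F : forall o1 o2 o3 o4 o5 o6 (l14 : ydata o1 o4) h14 (l25 : ydata o2 o5) h25
      (l36 : ydata o3 o6) h36
      (z12 : zdata o1 o2) h12 (z23 : zdata o2 o3) h23
      (z45 : zdata o4 o5) h45 (z56 : zdata o5 o6) h56 hq hr,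
      P (@MkYZ _ _ _ _ _ l14 h14 l25 h25 z12 h12 z45 h45 hq)
        (@MkYZ _ _ _ _ _ l25 h25 l36 h36 z23 h23 z56 h56 hr))
    q r (p : ztYZ (s := sq) q = zsYZ (s := sq) r) : P q r.
Proof.
destruct r as [o2 o3 o5 o6 l25 h25 l36 h36 z23 h23 z56 h56 hr]; cbn in p.
revert o3 o6 l36 h36 z23 h23 z56 h56 hr.
refine (match p in _ = y return
  forall o3 o6 (l36 : ydata o3 o6) h36 (z23 : zdata (Y_s y) o3) h23
    (z56 : zdata (Y_t y) o6) h56 (hr : yzlaw (Y_d y) l36 z23 z56),
  P q (@MkYZ _ _ _ _ _ (Y_d y) (Y_ok y) l36 h36 z23 h23 z56 h56 hr)
  with eq_refl => _ end).
destruct q; intros; apply F.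
Defined.
End CellExt.

(** * Compositions of cells *)

(** Once the proofs of the cell equations are identified, composability is a loop, hence
    reflexivity, and the gluing eliminators reduce. *)
Ltac glued p := irr; rewrite (UIP_refl p).

Section Compositions.
Context {C : markov_category}.
Notation sq := (arena_squares (C := C)).

Definition scompX (f g : X sq) (p : xtX f = xsX g) : X sq :=
  @glue_X C (fun _ _ => ArX) (fun _ _ _ d hd e he => MkX (xlaw_xcomp hd he)) f g p.

Definition scompY (f g : Y sq) (p : ytY f = ysY g) : Y sq :=
  @glue_Y C (fun _ _ => ArY) (fun _ _ _ d hd e he => MkY (ylaw_ycomp hd he)) f g p.

Definition scompZ (f g : Z sq) (p : ztZ f = zsZ g) : Z sq :=
  @glue_Z C (fun _ _ => ArZ) (fun _ _ _ d hd e he => MkZ (zlaw_zcomp hd he)) f g p.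

Definition scompXYx (q r : XY sq) (p : xtXY q = xsXY r) : XY sq :=
  @glue_XYx C (fun _ _ => ArXY)
    (fun _ _ _ _ _ _ _ h12 _ h23 _ h45 _ h56 _ h14 _ h25 _ h36 _ hq _ hr =>
      MkXY (xlaw_xcomp h12 h23) (xlaw_xcomp h45 h56) h14 h36
        (xylaw_xy_xcomp h14 h25 h36 hq hr)) q r p.

Definition scompXZx (q r : XZ sq) (p : xtXZ q = xsXZ r) : XZ sq :=
  @glue_XZx C (fun _ _ => ArXZ)
    (fun _ _ _ _ _ _ _ h12 _ h23 _ h45 _ h56 _ h14 _ h25 _ h36 _ hq _ hr =>
      MkXZ (xlaw_xcomp h12 h23) (xlaw_xcomp h45 h56) h14 h36
        (xzlaw_xcomp h14 h25 h36 hq hr)) q r p.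

Definition scompXZz (q r : XZ sq) (p : ztXZ q = zsXZ r) : XZ sq :=
  @glue_XZz C (fun _ _ => ArXZ)
    (fun _ _ _ _ _ _ _ h12 _ h34 _ h56 _ h13 _ h24 _ h35 _ h46 _ hq _ hr =>
      MkXZ h12 h56 (zlaw_zcomp h13 h35) (zlaw_zcomp h24 h46)
        (xzlaw_zcomp h13 h24 h35 h46 hq hr)) q r p.

Lemma yzlaw_ycomp (o1 o2 o3 o4 o5 o6 : arob C) (l13 : ydata o1 o3) (l24 : ydata o2 o4)
    (l35 : ydata o3 o5) (l46 : ydata o4 o6)
    (z12 : zdata o1 o2) (z34 : zdata o3 o4) (z56 : zdata o5 o6) :
  yzlaw l13 l24 z12 z34 -> yzlaw l35 l46 z34 z56 ->
  yzlaw (ycomp l13 l35) (ycomp l24 l46) z12 z56.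
Proof. intros H K; nf_arena; diagram using (K, H). Qed.

Lemma yzlaw_zcomp (o1 o2 o3 o4 o5 o6 : arob C) (l14 : ydata o1 o4) (l25 : ydata o2 o5)
    (l36 : ydata o3 o6) (z12 : zdata o1 o2) (z23 : zdata o2 o3)
    (z45 : zdata o4 o5) (z56 : zdata o5 o6) :
  yzlaw l14 l25 z12 z45 -> yzlaw l25 l36 z23 z56 ->
  yzlaw l14 l36 (zcomp z12 z23) (zcomp z45 z56).
Proof. intros H K; nf_arena; diagram using (H, K). Qed.

Definition scompYZy (q r : YZ sq) (p : ytYZ q = ysYZ r) : YZ sq :=
  @glue_YZy C (fun _ _ => ArYZ)
    (fun _ _ _ _ _ _ _ h13 _ h24 _ h35 _ h46 _ h12 _ h34 _ h56 hq hr =>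
      MkYZ (ylaw_ycomp h13 h35) (ylaw_ycomp h24 h46) h12 h56 (yzlaw_ycomp hq hr)) q r p.

Definition scompYZz (q r : YZ sq) (p : ztYZ q = zsYZ r) : YZ sq :=
  @glue_YZz C (fun _ _ => ArYZ)
    (fun _ _ _ _ _ _ _ h14 _ h25 _ h36 _ h12 _ h23 _ h45 _ h56 hq hr =>
      MkYZ h14 h36 (zlaw_zcomp h12 h23) (zlaw_zcomp h45 h56) (yzlaw_zcomp hq hr)) q r p.

Section Equations.
Context {o1 o2 o3 o4 o5 o6 : arob C}.

Lemma scompXE (d : xdata o1 o2) (e : xdata o2 o3) hd he p :
  exists h, scompX (f := MkX (X_d := d) hd) (g := MkX (X_d := e) he) p
    = MkX (X_d := xcomp d e) h.
Proof. cbn in p; glued p; eexists; reflexivity. Qed.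

Lemma scompYE (l : ydata o1 o2) (m : ydata o2 o3) hl hm p :
  exists h, scompY (f := MkY (Y_d := l) hl) (g := MkY (Y_d := m) hm) p
    = MkY (Y_d := ycomp l m) h.
Proof. cbn in p; glued p; eexists; reflexivity. Qed.

Lemma scompZE (z : zdata o1 o2) (w : zdata o2 o3) hz hw p :
  exists h, scompZ (f := MkZ (Z_d := z) hz) (g := MkZ (Z_d := w) hw) p
    = MkZ (Z_d := zcomp z w) h.
Proof. cbn in p; glued p; eexists; reflexivity. Qed.

Lemma scompXYxE (d12 : xdata o1 o2) (d23 : xdata o2 o3) (d45 : xdata o4 o5) (d56 : xdata o5 o6)
    (l14 : ydata o1 o4) (l25 : ydata o2 o5) (l36 : ydata o3 o6)
    h12 h23 h45 h56 h14 h25 h25' h36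
    (q : xydata d12 d45 l14 l25) (r : xydata d23 d56 l25 l36) hq hr p :
  exists h13 h46 h,
    scompXYx (q := @MkXY _ _ _ _ _ d12 h12 d45 h45 l14 h14 l25 h25 q hq)
             (r := @MkXY _ _ _ _ _ d23 h23 d56 h56 l25 h25' l36 h36 r hr) p
    = @MkXY _ _ _ _ _ (xcomp d12 d23) h13 (xcomp d45 d56) h46 l14 h14 l36 h36 (xy_xcomp q r) h.
Proof. cbn in p; glued p; do 3 eexists; reflexivity. Qed.

Lemma scompXZxE (d12 : xdata o1 o2) (d23 : xdata o2 o3) (d45 : xdata o4 o5) (d56 : xdata o5 o6)
    (z14 : zdata o1 o4) (z25 : zdata o2 o5) (z36 : zdata o3 o6)
    h12 h23 h45 h56 h14 h25 h25' h36
    (q : zdata (xpar d12) (xpar d45)) (r : zdata (xpar d23) (xpar d56)) hq hr p :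
  exists h13 h46 h,
    scompXZx (q := @MkXZ _ _ _ _ _ d12 h12 d45 h45 z14 h14 z25 h25 q hq)
             (r := @MkXZ _ _ _ _ _ d23 h23 d56 h56 z25 h25' z36 h36 r hr) p
    = @MkXZ _ _ _ _ _ (xcomp d12 d23) h13 (xcomp d45 d56) h46 z14 h14 z36 h36
        (zten q (zten z25 r)) h.
Proof. cbn in p; glued p; do 3 eexists; reflexivity. Qed.

Lemma scompXZzE (d12 : xdata o1 o2) (d34 : xdata o3 o4) (d56 : xdata o5 o6)
    (z13 : zdata o1 o3) (z24 : zdata o2 o4) (z35 : zdata o3 o5) (z46 : zdata o4 o6)
    h12 h34 h34' h56 h13 h24 h35 h46
    (q : zdata (xpar d12) (xpar d34)) (r : zdata (xpar d34) (xpar d56)) hq hr p :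
  exists h15 h26 h,
    scompXZz (q := @MkXZ _ _ _ _ _ d12 h12 d34 h34 z13 h13 z24 h24 q hq)
             (r := @MkXZ _ _ _ _ _ d34 h34' d56 h56 z35 h35 z46 h46 r hr) p
    = @MkXZ _ _ _ _ _ d12 h12 d56 h56 (zcomp z13 z35) h15 (zcomp z24 z46) h26 (zcomp q r) h.
Proof. cbn in p; glued p; do 3 eexists; reflexivity. Qed.

Lemma scompYZyE (l13 : ydata o1 o3) (l24 : ydata o2 o4) (l35 : ydata o3 o5) (l46 : ydata o4 o6)
    (z12 : zdata o1 o2) (z34 : zdata o3 o4) (z56 : zdata o5 o6)
    h13 h24 h35 h46 h12 h34 h34' h56 hq hr p :
  exists h15 h26 h,
    scompYZy (q := @MkYZ _ _ _ _ _ l13 h13 l24 h24 z12 h12 z34 h34 hq)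
             (r := @MkYZ _ _ _ _ _ l35 h35 l46 h46 z34 h34' z56 h56 hr) p
    = @MkYZ _ _ _ _ _ (ycomp l13 l35) h15 (ycomp l24 l46) h26 z12 h12 z56 h56 h.
Proof. cbn in p; glued p; do 3 eexists; reflexivity. Qed.

Lemma scompYZzE (l14 : ydata o1 o4) (l25 : ydata o2 o5) (l36 : ydata o3 o6)
    (z12 : zdata o1 o2) (z23 : zdata o2 o3) (z45 : zdata o4 o5) (z56 : zdata o5 o6)
    h14 h25 h25' h36 h12 h23 h45 h56 hq hr p :
  exists h13 h46 h,
    scompYZz (q := @MkYZ _ _ _ _ _ l14 h14 l25 h25 z12 h12 z45 h45 hq)
             (r := @MkYZ _ _ _ _ _ l25 h25' l36 h36 z23 h23 z56 h56 hr) p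
    = @MkYZ _ _ _ _ _ l14 h14 l36 h36 (zcomp z12 z23) h13 (zcomp z45 z56) h46 h.
Proof. cbn in p; glued p; do 3 eexists; reflexivity. Qed.
End Equations.

Section WithConditionals.
Hypothesis HC : has_conditionals C.

(** Existence of a composite is a mere proposition, so the square is extracted by description; the
    lemmas below use only that it satisfies [is_xy_ycomp] and the square equations. *)
Definition scompXYy (q r : XY sq) (p : ytXY q = ysXY r) : XY sq :=
  @glue_XYy C (fun _ _ => ArXY)
    (fun _ _ _ _ _ _ _ h12 _ h34 _ h56 _ h13 _ h24 _ h35 _ h46 q hq r hr =>
      let w := constructive_indefinite_description _
        (exists_ycomp HC (is_ycomposable h13 h24 h35 h46 hq hr)) in
      @MkXY _ _ _ _ _ _ h12 _ h56 _ (ylaw_ycomp h13 h35) _ (ylaw_ycomp h24 h46)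
        (proj1_sig w) (proj2 (proj2_sig w))) q r p.

Lemma scompXYyE (o1 o2 o3 o4 o5 o6 : arob C)
    (d12 : xdata o1 o2) (d34 : xdata o3 o4) (d56 : xdata o5 o6)
    (l13 : ydata o1 o3) (l24 : ydata o2 o4) (l35 : ydata o3 o5) (l46 : ydata o4 o6)
    h12 h34 h34' h56 h13 h24 h35 h46
    (q : xydata d12 d34 l13 l24) (r : xydata d34 d56 l35 l46) hq hr p :
  exists h15 h26 w h, is_xy_ycomp q r w /\
    scompXYy (q := @MkXY _ _ _ _ _ d12 h12 d34 h34 l13 h13 l24 h24 q hq)
             (r := @MkXY _ _ _ _ _ d34 h34' d56 h56 l35 h35 l46 h46 r hr) p
    = @MkXY _ _ _ _ _ d12 h12 d56 h56 (ycomp l13 l35) h15 (ycomp l24 l46) h26 w h.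
Proof.
cbn in p; glued p; do 4 eexists; split; [|reflexivity].
destruct constructive_indefinite_description as [w [H K]]; exact H.
Qed.
End WithConditionals.
End Compositions.

Lemma MkX_irr {C : markov_category} (o1 o2 : arob C) (d : xdata o1 o2) h h' :
  MkX (X_d := d) h = MkX (X_d := d) h'.
Proof. f_equal; apply proof_irrelevance. Qed.

Lemma MkY_irr {C : markov_category} (o1 o2 : arob C) (l : ydata o1 o2) h h' :
  MkY (Y_d := l) h = MkY (Y_d := l) h'.
Proof. f_equal; apply proof_irrelevance. Qed.

Lemma MkZ_irr {C : markov_category} (o1 o2 : arob C) (z : zdata o1 o2) h h' :
  MkZ (Z_d := z) h = MkZ (Z_d := z) h'.
Proof. f_equal; apply proof_irrelevance. Qed.

(* Replace the term [t] by the cell it is equal to by [E], also in the proofs of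
   composability. *)
Ltac absorb t E :=
  lazymatch type of E with
  | _ = ?r => generalize dependent t; intros; match goal with e : ?v = r |- _ => subst v end
  end.

Ltac simpl_cells := cbn [
  xsX xtX ysY ytY zsZ ztZ xsXY xtXY ysXY ytXY xsXZ xtXZ zsXZ ztXZ ysYZ ytYZ zsYZ ztYZ
  X Y Z XY XZ YZ Ob arena_squares sqc arena_cells
  X_s X_t X_d Y_s Y_t Y_d Z_s Z_t Z_d
  XY_1 XY_2 XY_3 XY_4 XY_top XY_bot XY_left XY_right XY_d
  XZ_1 XZ_2 XZ_3 XZ_4 XZ_top XZ_bot XZ_left XZ_right XZ_d
  YZ_1 YZ_2 YZ_3 YZ_4 YZ_left YZ_right YZ_top YZ_bot] in *.

(** A redex is a composite of two explicit cells that share their boundary data syntactically, so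
    nested composites are evaluated from the inside out. A composite along [scompXYy] leaves behind
    a fresh square [w] with its characterization. *)
Ltac eval_comp :=
  match goal with
  | |- context [@scompX ?C (@MkX _ ?a ?b ?d ?hd) (@MkX _ ?b ?c ?e ?he) ?p] =>
      let h := fresh "h" in let E := fresh "E" in
      destruct (@scompXE C a b c d e hd he p) as (h & E);
      absorb (@scompX C (@MkX _ a b d hd) (@MkX _ b c e he) p) E
  | |- context [@scompY ?C (@MkY _ ?a ?b ?d ?hd) (@MkY _ ?b ?c ?e ?he) ?p] =>
      let h := fresh "h" in let E := fresh "E" in
      destruct (@scompYE C a b c d e hd he p) as (h & E);
      absorb (@scompY C (@MkY _ a b d hd) (@MkY _ b c e he) p) E
  | |- context [@scompZ ?C (@MkZ _ ?a ?b ?d ?hd) (@MkZ _ ?b ?c ?e ?he) ?p] =>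
      let h := fresh "h" in let E := fresh "E" in
      destruct (@scompZE C a b c d e hd he p) as (h & E);
      absorb (@scompZ C (@MkZ _ a b d hd) (@MkZ _ b c e he) p) E
  | |- context [@scompXYx ?C (@MkXY _ ?o1 ?o2 ?o4 ?o5 ?d12 ?h12 ?d45 ?h45 ?l14 ?h14 ?l25 ?h25 ?q ?hq)
       (@MkXY _ ?o2 ?o3 ?o5 ?o6 ?d23 ?h23 ?d56 ?h56 ?l25 ?h25' ?l36 ?h36 ?r ?hr) ?p] =>
      let h1 := fresh "h" in let h2 := fresh "h" in let h3 := fresh "h" in let E := fresh "E" in
      destruct (@scompXYxE C o1 o2 o3 o4 o5 o6 d12 d23 d45 d56 l14 l25 l36
        h12 h23 h45 h56 h14 h25 h25' h36 q r hq hr p) as (h1 & h2 & h3 & E);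
      absorb (@scompXYx C (@MkXY _ o1 o2 o4 o5 d12 h12 d45 h45 l14 h14 l25 h25 q hq)
       (@MkXY _ o2 o3 o5 o6 d23 h23 d56 h56 l25 h25' l36 h36 r hr) p) E
  | |- context [@scompXZx ?C (@MkXZ _ ?o1 ?o2 ?o4 ?o5 ?d12 ?h12 ?d45 ?h45 ?l14 ?h14 ?l25 ?h25 ?q ?hq)
       (@MkXZ _ ?o2 ?o3 ?o5 ?o6 ?d23 ?h23 ?d56 ?h56 ?l25 ?h25' ?l36 ?h36 ?r ?hr) ?p] =>
      let h1 := fresh "h" in let h2 := fresh "h" in let h3 := fresh "h" in let E := fresh "E" in
      destruct (@scompXZxE C o1 o2 o3 o4 o5 o6 d12 d23 d45 d56 l14 l25 l36
        h12 h23 h45 h56 h14 h25 h25' h36 q r hq hr p) as (h1 & h2 & h3 & E);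
      absorb (@scompXZx C (@MkXZ _ o1 o2 o4 o5 d12 h12 d45 h45 l14 h14 l25 h25 q hq)
       (@MkXZ _ o2 o3 o5 o6 d23 h23 d56 h56 l25 h25' l36 h36 r hr) p) E
  | |- context [@scompXZz ?C (@MkXZ _ ?o1 ?o2 ?o3 ?o4 ?d12 ?h12 ?d34 ?h34 ?l13 ?h13 ?l24 ?h24 ?q ?hq)
       (@MkXZ _ ?o3 ?o4 ?o5 ?o6 ?d34 ?h34' ?d56 ?h56 ?l35 ?h35 ?l46 ?h46 ?r ?hr) ?p] =>
      let h1 := fresh "h" in let h2 := fresh "h" in let h3 := fresh "h" in let E := fresh "E" in
      destruct (@scompXZzE C o1 o2 o3 o4 o5 o6 d12 d34 d56 l13 l24 l35 l46
        h12 h34 h34' h56 h13 h24 h35 h46 q r hq hr p) as (h1 & h2 & h3 & E);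
      absorb (@scompXZz C (@MkXZ _ o1 o2 o3 o4 d12 h12 d34 h34 l13 h13 l24 h24 q hq)
       (@MkXZ _ o3 o4 o5 o6 d34 h34' d56 h56 l35 h35 l46 h46 r hr) p) E
  | |- context [@scompYZy ?C (@MkYZ _ ?o1 ?o2 ?o3 ?o4 ?l13 ?h13 ?l24 ?h24 ?z12 ?h12 ?z34 ?h34 ?hq)
       (@MkYZ _ ?o3 ?o4 ?o5 ?o6 ?l35 ?h35 ?l46 ?h46 ?z34 ?h34' ?z56 ?h56 ?hr) ?p] =>
      let h1 := fresh "h" in let h2 := fresh "h" in let h3 := fresh "h" in let E := fresh "E" in
      destruct (@scompYZyE C o1 o2 o3 o4 o5 o6 l13 l24 l35 l46 z12 z34 z56
        h13 h24 h35 h46 h12 h34 h34' h56 hq hr p) as (h1 & h2 & h3 & E);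
      absorb (@scompYZy C (@MkYZ _ o1 o2 o3 o4 l13 h13 l24 h24 z12 h12 z34 h34 hq)
       (@MkYZ _ o3 o4 o5 o6 l35 h35 l46 h46 z34 h34' z56 h56 hr) p) E
  | |- context [@scompYZz ?C (@MkYZ _ ?o1 ?o2 ?o4 ?o5 ?l14 ?h14 ?l25 ?h25 ?z12 ?h12 ?z45 ?h45 ?hq)
       (@MkYZ _ ?o2 ?o3 ?o5 ?o6 ?l25 ?h25' ?l36 ?h36 ?z23 ?h23 ?z56 ?h56 ?hr) ?p] =>
      let h1 := fresh "h" in let h2 := fresh "h" in let h3 := fresh "h" in let E := fresh "E" in
      destruct (@scompYZzE C o1 o2 o3 o4 o5 o6 l14 l25 l36 z12 z23 z45 z56
        h14 h25 h25' h36 h12 h23 h45 h56 hq hr p) as (h1 & h2 & h3 & E);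
      absorb (@scompYZz C (@MkYZ _ o1 o2 o4 o5 l14 h14 l25 h25 z12 h12 z45 h45 hq)
       (@MkYZ _ o2 o3 o5 o6 l25 h25' l36 h36 z23 h23 z56 h56 hr) p) E
  | |- context [@scompXYy ?C ?HC (@MkXY _ ?o1 ?o2 ?o3 ?o4 ?d12 ?h12 ?d34 ?h34 ?l13 ?h13 ?l24 ?h24 ?q ?hq)
       (@MkXY _ ?o3 ?o4 ?o5 ?o6 ?d34 ?h34' ?d56 ?h56 ?l35 ?h35 ?l46 ?h46 ?r ?hr) ?p] =>
      let h1 := fresh "h" in let h2 := fresh "h" in let w := fresh "w" in
      let h3 := fresh "h" in let Hw := fresh "Hw" in let E := fresh "E" in
      destruct (@scompXYyE C HC o1 o2 o3 o4 o5 o6 d12 d34 d56 l13 l24 l35 l46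
        h12 h34 h34' h56 h13 h24 h35 h46 q r hq hr p) as (h1 & h2 & w & h3 & Hw & E);
      absorb (@scompXYy C HC (@MkXY _ o1 o2 o3 o4 d12 h12 d34 h34 l13 h13 l24 h24 q hq)
       (@MkXY _ o3 o4 o5 o6 d34 h34' d56 h56 l35 h35 l46 h46 r hr) p) E
  end; simpl_cells.

Ltac open_cells :=
  simpl_cells;
  repeat match goal with
  | f : ArX |- _ => destruct f
  | f : ArY |- _ => destruct f
  | f : ArZ |- _ => destruct f
  | f : ArXY |- _ => destruct f
  | f : ArXZ |- _ => destruct f
  | f : ArYZ |- _ => destruct f
  end; simpl_cells; glue.

Ltac ob_eq :=
  repeat match goal with o : arob _ |- _ => destruct o end;
  cbn [xpar xcomp xten xunit];
  repeat match goal with |- context [xpar ?d] => is_var d; generalize (xpar d); intros [] end;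
  unfold oten; cbn [ounit ar_a ar_c tens] in *;
  rewrite ?tenA, ?ten1l, ?ten1r; reflexivity.

(* Among the laws, only determinism is needed to compare composites. *)
Ltac det_only := repeat match goal with
  | H : _ = _ :> ArX |- _ => clear H
  | H : _ = _ :> ArY |- _ => clear H
  | H : _ = _ :> ArZ |- _ => clear H
  | H : xlaw _ |- _ => clear H
  | H : yzlaw _ _ _ _ |- _ => clear H
  | H : xylaw ?q |- _ => tryif is_var q then destruct H as [? _] else clear H
  | H : xzlaw _ _ ?q |- _ => tryif is_var q then destruct H as [? _] else clear H
  | H : ylaw ?l |- _ =>
      lazymatch l with
      | ycomp _ _ => clear H | yten _ _ => clear H | yid _ => clear H | _ => destruct H
      end
  | H : zlaw ?z |- _ =>
      lazymatch z with
      | zcomp _ _ => clear H | zten _ _ => clear H | zid _ => clear H | _ => destruct H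
      end
  end.

Ltac data_eq := intros; det_only; nf_arena; diagram.

Ltac cell_eq :=
  simpl_cells;
  lazymatch goal with
  | |- MkX ?h = MkX ?h' =>
      lazymatch type of h with xlaw ?d => lazymatch type of h' with xlaw ?d' =>
        tryif constr_eq d d' then apply MkX_irr
        else (apply MkX_eq; [ob_eq|ob_eq|ob_eq|data_eq|data_eq])
      end end
  | |- MkY ?h = MkY ?h' =>
      lazymatch type of h with ylaw ?d => lazymatch type of h' with ylaw ?d' =>
        tryif constr_eq d d' then apply MkY_irr
        else (apply MkY_eq; [ob_eq|ob_eq|data_eq|data_eq])
      end end
  | |- MkZ ?h = MkZ ?h' =>
      lazymatch type of h with zlaw ?d => lazymatch type of h' with zlaw ?d' =>
        tryif constr_eq d d' then apply MkZ_irr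
        else (apply MkZ_eq; [ob_eq|ob_eq|data_eq|data_eq])
      end end
  | |- @MkYZ _ _ _ _ _ _ _ _ _ _ _ _ _ _ = @MkYZ _ _ _ _ _ _ _ _ _ _ _ _ _ _ => apply YZ_eq; cell_eq
  | |- MkXZ _ _ _ _ _ = MkXZ _ _ _ _ _ =>
      apply XZ_eq; [cell_eq|cell_eq|cell_eq|cell_eq|simpl_cells; data_eq|simpl_cells; data_eq]
  | |- MkXY _ _ _ _ _ = MkXY _ _ _ _ _ =>
      apply XY_eq; [cell_eq|cell_eq|cell_eq|cell_eq|simpl_cells; data_eq..]
  | |- _ => reflexivity
  end.

Create HintDb cells.

Ltac cells := intros; cbn [scomp cid cat_semi] in *; autounfold with cells in *; cbn [scomp cid cat_semi] in *;
  open_cells; repeat (eval_comp; glue); cell_eq.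

(** * Categories of squares other than the y-composition of xy-squares *)

Section SquareStructure.
Context {C : markov_category}.
Notation sq := (arena_squares (C := C)).

Definition KX : semicat_on (@xsX sq) (@xtX sq).
Proof. refine (@Semicat _ _ _ _ (@scompX C) _ _ _); abstract cells. Defined.

Definition SY : semicat_on (@ysY sq) (@ytY sq).
Proof. refine (@Semicat _ _ _ _ (@scompY C) _ _ _); abstract cells. Defined.

Definition idY (o : Ob sq) : Y sq := MkY (ylaw_yid o).

Hint Unfold SY idY : cells.

Definition KY : cat_on (@ysY sq) (@ytY sq).
Proof. refine (@Cat _ _ _ _ SY idY _ _ _ _); abstract cells. Defined.

Definition SZ : semicat_on (@zsZ sq) (@ztZ sq).
Proof. refine (@Semicat _ _ _ _ (@scompZ C) _ _ _); abstract cells. Defined.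

Definition idZ (o : Ob sq) : Z sq := MkZ (zlaw_zid o).

Hint Unfold SZ idZ : cells.

Definition KZ : cat_on (@zsZ sq) (@ztZ sq).
Proof. refine (@Cat _ _ _ _ SZ idZ _ _ _ _); abstract cells. Defined.

Definition KXZx : semicat_on (@xsXZ sq) (@xtXZ sq).
Proof. refine (@Semicat _ _ _ _ (@scompXZx C) _ _ _); abstract cells. Defined.

Definition SXZz : semicat_on (@zsXZ sq) (@ztXZ sq).
Proof. refine (@Semicat _ _ _ _ (@scompXZz C) _ _ _); abstract cells. Defined.

Definition idXZz (f : X sq) : XZ sq :=
  MkXZ (X_ok f) (X_ok f) (zlaw_zid (X_s f)) (zlaw_zid (X_t f)) (xzlaw_zid (X_d f)).

Hint Unfold SXZz idXZz : cells.

Definition KXZz : cat_on (@zsXZ sq) (@ztXZ sq).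
Proof. refine (@Cat _ _ _ _ SXZz idXZz _ _ _ _); abstract cells. Defined.

Definition SYZy : semicat_on (@ysYZ sq) (@ytYZ sq).
Proof. refine (@Semicat _ _ _ _ (@scompYZy C) _ _ _); abstract cells. Defined.

Lemma yzlaw_yid (o1 o2 : arob C) (z : zdata o1 o2) : yzlaw (yid o1) (yid o2) z z.
Proof. nf_arena; diagram. Qed.

Definition idYZy (f : Z sq) : YZ sq :=
  MkYZ (ylaw_yid (Z_s f)) (ylaw_yid (Z_t f)) (Z_ok f) (Z_ok f) (yzlaw_yid (Z_d f)).

Hint Unfold SYZy idYZy : cells.

Definition KYZy : cat_on (@ysYZ sq) (@ytYZ sq).
Proof. refine (@Cat _ _ _ _ SYZy idYZy _ _ _ _); abstract cells. Defined.

Definition SYZz : semicat_on (@zsYZ sq) (@ztYZ sq).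
Proof. refine (@Semicat _ _ _ _ (@scompYZz C) _ _ _); abstract cells. Defined.

Lemma yzlaw_zid (o1 o2 : arob C) (l : ydata o1 o2) : yzlaw l l (zid o1) (zid o2).
Proof. nf_arena; diagram. Qed.

Definition idYZz (f : Y sq) : YZ sq :=
  MkYZ (Y_ok f) (Y_ok f) (zlaw_zid (Y_s f)) (zlaw_zid (Y_t f)) (yzlaw_zid (Y_d f)).

Hint Unfold SYZz idYZz : cells.

Definition KYZz : cat_on (@zsYZ sq) (@ztYZ sq).
Proof. refine (@Cat _ _ _ _ SYZz idYZz _ _ _ _); abstract cells. Defined.

Hint Unfold KX KY KZ KXZx KXZz KYZy KYZz : cells.

Definition KXYx : semicat_on (@xsXY sq) (@xtXY sq).
Proof.
refine (@Semicat _ _ _ _ (@scompXYx C) _ _ _); abstract cells.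
Defined.

Definition idXYy (f : X sq) : XY sq :=
  MkXY (X_ok f) (X_ok f) (ylaw_yid (X_s f)) (ylaw_yid (X_t f)) (xylaw_xyid (X_ok f)).

End SquareStructure.

#[global] Hint Unfold SY idY SZ idZ SXZz idXZz SYZy idYZy SYZz idYZz
  KX KY KZ KXZx KXZz KYZy KYZz KXYx idXYy : cells.

Ltac start_cells :=
  intros; cbn [scomp cid cat_semi] in *; autounfold with cells in *; cbn [scomp cid cat_semi] in *;
  open_cells; repeat (eval_comp; glue); simpl_cells.

(** Of a chosen composite, only the lens component is given by a formula; it is replaced by the
    composite lens before the diagrams are compared. *)
Ltac xyy_eq :=
  repeat match goal with
  | H : is_xy_ycomp _ _ ?w |- _ => rewrite ?(proj1 H); clear H
  end; data_eq.

(** * The category of xy-squares under y-composition *)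

Section XYy.
Context {C : markov_category} (HC : has_conditionals C).
Notation sq := (arena_squares (C := C)).

Lemma scompXYy_A (f g h : XY sq) p q p' q' :
  scompXYy HC (q := scompXYy HC (q := f) (r := g) p) (r := h) p'
  = scompXYy HC (q := f) (r := scompXYy HC (q := g) (r := h) q) q'.
Proof.
start_cells; apply XY_eq; [cell_eq|cell_eq|cell_eq|cell_eq|simpl_cells; xyy_eq|simpl_cells; xyy_eq|].
simpl_cells; f_equal; eapply (is_xy_ycompA HC);
  [| |eassumption|eassumption|eassumption|eassumption]; now apply is_ycomposable.
Qed.

Definition SXYy : semicat_on (@ysXY sq) (@ytXY sq).
Proof.
refine (@Semicat _ _ _ _ (@scompXYy C HC) _ _ scompXYy_A); abstract (start_cells; cell_eq).
Defined.

Lemma scompXYy_idl (f : XY sq) p : scompXYy HC (q := idXYy (ysXY f)) (r := f) p = f.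
Proof.
start_cells; apply XY_eq; [cell_eq|cell_eq|cell_eq|cell_eq|simpl_cells; xyy_eq|simpl_cells; xyy_eq|].
simpl_cells; f_equal; now eapply (is_xy_ycomp_idl HC); [| | | |eassumption].
Qed.

Lemma scompXYy_idr (f : XY sq) p : scompXYy HC (q := f) (r := idXYy (ytXY f)) p = f.
Proof.
start_cells; apply XY_eq; [cell_eq|cell_eq|cell_eq|cell_eq|simpl_cells; xyy_eq|simpl_cells; xyy_eq|].
simpl_cells; f_equal; now eapply (is_xy_ycomp_idr HC); [| | | |eassumption].
Qed.

Definition KXYy : cat_on (@ysXY sq) (@ytXY sq).
Proof.
refine (@Cat _ _ _ _ SXYy (@idXYy C) _ _ scompXYy_idl scompXYy_idr);
  abstract (start_cells; cell_eq).
Defined.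
End XYy.

#[global] Hint Unfold SXYy KXYy : cells.

(** * The three double categories of squares *)

Section DoubleLaws.
Context {C : markov_category} (HC : has_conditionals C).

Lemma double_XZ : semi_double_laws (@KX C) (@KXZx C) (@KZ C) (@KXZz C).
Proof. constructor; start_cells; cell_eq. Qed.

Lemma double_YZ : double_laws (@KY C) (@KYZy C) (@KZ C) (@KYZz C).
Proof. constructor; [constructor|..]; start_cells; cell_eq. Qed.

Lemma double_XY : semi_double_laws (@KX C) (@KXYx C) (@KY C) (KXYy HC).
Proof.
constructor.
1-11: start_cells; cell_eq.
start_cells; apply XY_eq;
  [cell_eq|cell_eq|cell_eq|cell_eq|simpl_cells; nf_arena; xyy_eq|simpl_cells; nf_arena; xyy_eq|].
simpl_cells; f_equal; eapply (is_xy_ycomp_interchange HC);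
  [| |eassumption|eassumption|eassumption]; now apply is_ycomposable.
Qed.
End DoubleLaws.

(** * Tensor products and symmetries of squares *)

Section Tensor.
Context {C : markov_category}.
Notation sq := (arena_squares (C := C)).

Definition tenZ (f g : Z sq) : Z sq := MkZ (zlaw_zten (Z_ok f) (Z_ok g)).
Definition tenY (f g : Y sq) : Y sq := MkY (ylaw_yten (Y_ok f) (Y_ok g)).
Definition tenX (f g : X sq) : X sq := MkX (xlaw_xten (X_ok f) (X_ok g)).
Definition tenXZ (f g : XZ sq) : XZ sq :=
  MkXZ (xlaw_xten (XZ_top_ok f) (XZ_top_ok g)) (xlaw_xten (XZ_bot_ok f) (XZ_bot_ok g))
    (zlaw_zten (XZ_left_ok f) (XZ_left_ok g)) (zlaw_zten (XZ_right_ok f) (XZ_right_ok g))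
    (xzlaw_xten (XZ_left_ok f) (XZ_right_ok f) (XZ_left_ok g) (XZ_right_ok g)
      (XZ_ok f) (XZ_ok g)).
Definition tenXY (f g : XY sq) : XY sq :=
  MkXY (xlaw_xten (XY_top_ok f) (XY_top_ok g)) (xlaw_xten (XY_bot_ok f) (XY_bot_ok g))
    (ylaw_yten (XY_left_ok f) (XY_left_ok g)) (ylaw_yten (XY_right_ok f) (XY_right_ok g))
    (xylaw_xy_ten (XY_left_ok f) (XY_right_ok f) (XY_left_ok g) (XY_right_ok g)
      (XY_ok f) (XY_ok g)).

Lemma yzlaw_yten (o1 o2 o3 o4 o1' o2' o3' o4' : arob C)
    (l13 : ydata o1 o3) (l24 : ydata o2 o4) (z12 : zdata o1 o2) (z34 : zdata o3 o4)
    (l13' : ydata o1' o3') (l24' : ydata o2' o4') (z12' : zdata o1' o2') (z34' : zdata o3' o4') :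
  yzlaw l13 l24 z12 z34 -> yzlaw l13' l24' z12' z34' ->
  yzlaw (yten l13 l13') (yten l24 l24') (zten z12 z12') (zten z34 z34').
Proof. intros H K; nf_arena; diagram using (H, K). Qed.

Definition tenYZ (f g : YZ sq) : YZ sq :=
  MkYZ (ylaw_yten (YZ_left_ok f) (YZ_left_ok g)) (ylaw_yten (YZ_right_ok f) (YZ_right_ok g))
    (zlaw_zten (YZ_top_ok f) (YZ_top_ok g)) (zlaw_zten (YZ_bot_ok f) (YZ_bot_ok g))
    (yzlaw_yten (YZ_ok f) (YZ_ok g)).

Definition swapZ (o o' : arob C) : Z sq := MkZ (zlaw_oswap o o').
Definition swapXZ (f g : X sq) : XZ sq :=
  MkXZ (xlaw_xten (X_ok f) (X_ok g)) (xlaw_xten (X_ok g) (X_ok f))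
    (zlaw_oswap (X_s f) (X_s g)) (zlaw_oswap (X_t f) (X_t g))
    (xzlaw_oswap (X_d f) (X_d g)).

Lemma yzlaw_oswap (o1 o2 o1' o2' : arob C) (l : ydata o1 o2) (l' : ydata o1' o2') :
  yzlaw (yten l l') (yten l' l) (oswap o1 o1') (oswap o2 o2').
Proof. nf_arena; diagram. Qed.

Definition swapYZ (f g : Y sq) : YZ sq :=
  MkYZ (ylaw_yten (Y_ok f) (Y_ok g)) (ylaw_yten (Y_ok g) (Y_ok f))
    (zlaw_oswap (Y_s f) (Y_s g)) (zlaw_oswap (Y_t f) (Y_t g))
    (yzlaw_oswap (Y_d f) (Y_d g)).

Definition unitX : X sq := MkX xlaw_xunit.
End Tensor.

#[global] Hint Unfold tenZ tenY tenX tenXZ tenXY tenYZ swapZ swapXZ swapYZ unitX : cells.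

Ltac ten_cells := start_cells; lazymatch goal with
  | |- _ = _ :> arob _ => ob_eq
  | |- _ => cell_eq
  end.

Section Permutative.
Context {C : markov_category}.
Notation sq := (arena_squares (C := C)).

Definition zassoc (a b c : arob C) : zdata (oten (oten a b) c) (oten a (oten b c)) :=
  @ZData _ (oten (oten a b) c) (oten a (oten b c))
    (ungroup [[tens [ar_c a; ar_c b]; ar_c c]] ;; ungroup [[ar_c a; ar_c b]; [ar_c c]]
     ;; group [[ar_c a]; [ar_c b; ar_c c]] ;; group [[ar_c a; tens [ar_c b; ar_c c]]])
    (ungroup [[tens [ar_a a; ar_a b]; ar_a c]] ;; ungroup [[ar_a a; ar_a b]; [ar_a c]]
     ;; group [[ar_a a]; [ar_a b; ar_a c]] ;; group [[ar_a a; tens [ar_a b; ar_a c]]]).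

Lemma zlaw_zassoc (a b c : arob C) : zlaw (zassoc a b c).
Proof. unfold zassoc; laws; diagram. Qed.

(* The two factors are composable only along an equality of objects, whence the
   detour through the associator. *)
Lemma swapZ_hexagon (a b c : arob C) p :
  swapZ a (oten b c) = scompZ (f := tenZ (swapZ a b) (idZ c)) (g := tenZ (idZ b) (swapZ a c)) p.
Proof.
pose (g := MkZ (zlaw_zcomp (zlaw_zassoc b a c) (zlaw_zten (zlaw_zid b) (zlaw_oswap a c))) : Z sq).
assert (e : tenZ (idZ b) (swapZ a c) = g) by (unfold g, zassoc; cells).
assert (p' : ztZ (tenZ (swapZ a b) (idZ c)) = zsZ g) by reflexivity.
transitivity (scompZ p'); [|now apply (scomp_eq SZ)].
subst g.
unfold zassoc; clear; ten_cells.
Qed.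

Definition permO : permutative (@KZ C).
Proof.
refine (@Permutative _ _ _ _ KZ (@oten C) (@tenZ C) (@ounit C) _ _ _ _ _ _ _ _ _ _
  (@swapZ C) _ _ _ _ swapZ_hexagon); abstract ten_cells.
Defined.

(** The parameter components of an xz-square form a z-morphism, and with the four sides they
    determine the square. The hexagon for x-morphisms thus reduces to the hexagon for objects, at
    both ends and at the parameters. *)
Definition parZ (q : XZ sq) : Z sq := MkZ (proj1 (XZ_ok q)).

Hint Unfold parZ : cells.

Lemma parZ_scomp (q r : XZ sq) p :
  exists p', parZ (scomp (@KXZz C) q r p) = scomp KZ (parZ q) (parZ r) p'.
Proof.
assert (p' : ztZ (s := sq) (parZ q) = zsZ (s := sq) (parZ r))
  by exact (f_equal (fun f : ArX => xpar (X_d f)) p).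
exists p'; revert p'; cells.
Qed.

Lemma XZ_par_eq (q r : XZ sq) :
  xsXZ q = xsXZ r -> xtXZ q = xtXZ r -> zsXZ q = zsXZ r -> ztXZ q = ztXZ r ->
  parZ q = parZ r -> q = r.
Proof.
intros E1 E2 E3 E4 E; apply XZ_eq; auto.
- exact (f_equal (fun z : Z sq => Arr (zf (Z_d z))) E).
- exact (f_equal (fun z : Z sq => Arr (zg (Z_d z))) E).
Qed.

Lemma swapXZ_hexagon (a b c : X sq) p :
  swapXZ a (tenX b c)
  = scomp KXZz (tenXZ (swapXZ a b) (cid KXZz c)) (tenXZ (cid KXZz b) (swapXZ a c)) p.
Proof.
apply XZ_par_eq.
- destruct (ex_s1_scomp double_XZ p) as [p' ->]; apply swapZ_hexagon.
- destruct (ex_t1_scomp double_XZ p) as [p' ->]; apply swapZ_hexagon.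
- rewrite s_scomp; clear; ten_cells.
- rewrite t_scomp; clear; ten_cells.
- destruct (parZ_scomp p) as [p' ->].
  transitivity (swapZ (xpar (X_d a)) (oten (xpar (X_d b)) (xpar (X_d c)))); [apply MkZ_irr|].
  unshelve erewrite swapZ_hexagon; [exact p'|].
  apply (scomp_eq KZ); apply MkZ_irr.
Qed.

Lemma swapYZ_hexagon (a b c : Y sq) p :
  swapYZ a (tenY b c)
  = scomp KYZz (tenYZ (swapYZ a b) (cid KYZz c)) (tenYZ (cid KYZz b) (swapYZ a c)) p.
Proof.
apply YZ_eq.
- destruct (ex_s1_scomp double_YZ p) as [p' ->]; apply swapZ_hexagon.
- destruct (ex_t1_scomp double_YZ p) as [p' ->]; apply swapZ_hexagon.
- rewrite s_scomp; clear; ten_cells.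
- rewrite t_scomp; clear; ten_cells.
Qed.

Definition permX : permutative (@KXZz C).
Proof.
refine (@Permutative _ _ _ _ KXZz (@tenX C) (@tenXZ C) (@unitX C) _ _ _ _ _ _ _ _ _ _
  (@swapXZ C) _ _ _ _ swapXZ_hexagon); abstract ten_cells.
Defined.

Definition permY : permutative (@KYZz C).
Proof.
refine (@Permutative _ _ _ _ KYZz (@tenY C) (@tenYZ C) (idY ounit) _ _ _ _ _ _ _ _ _ _
  (@swapYZ C) _ _ _ _ swapYZ_hexagon); abstract ten_cells.
Defined.

End Permutative.

#[global] Hint Unfold parZ permO permX permY : cells.

Section TensorFunctors.
Context {C : markov_category} (HC : has_conditionals C).
Notation sq := (arena_squares (C := C)).

Lemma arena_xsX_sm : strict_symmetric permX permO (@xsX sq) (@xsXZ sq).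
Proof. constructor; cbn [pt0 pt1 pu psw permO permX]; ten_cells. Qed.
Lemma arena_xtX_sm : strict_symmetric permX permO (@xtX sq) (@xtXZ sq).
Proof. constructor; cbn [pt0 pt1 pu psw permO permX]; ten_cells. Qed.
Lemma arena_ysY_sm : strict_symmetric permY permO (@ysY sq) (@ysYZ sq).
Proof. constructor; cbn [pt0 pt1 pu psw permO permY]; ten_cells. Qed.
Lemma arena_ytY_sm : strict_symmetric permY permO (@ytY sq) (@ytYZ sq).
Proof. constructor; cbn [pt0 pt1 pu psw permO permY]; ten_cells. Qed.

Lemma arena_idY_sm : strict_symmetric permO permY (cid (@KY C)) (cid (@KYZy C)).
Proof. constructor; cbn [pt0 pt1 pu psw permO permY]; ten_cells. Qed.

Lemma tenXY_A (a b c : XY sq) : tenXY (tenXY a b) c = tenXY a (tenXY b c).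
Proof. ten_cells. Qed.

Lemma tenXY_ul (a : XY sq) : tenXY (idXYy unitX) a = a.
Proof. ten_cells. Qed.

Lemma tenXY_ur (a : XY sq) : tenXY a (idXYy unitX) = a.
Proof. ten_cells. Qed.

Lemma cid_tenXY (f g : X sq) : idXYy (tenX f g) = tenXY (idXYy f) (idXYy g).
Proof. ten_cells. Qed.

Lemma arena_compY_sm : strict_composition (@KY C) (@KYZy C) permY.
Proof. constructor; cbn [pt0 pt1 pu psw permO permY]; ten_cells. Qed.

Lemma scomp_tenXY (f g f' g' : XY sq) p p' p'' :
  tenXY (scomp (KXYy HC) f g p) (scomp (KXYy HC) f' g' p')
  = scomp (KXYy HC) (tenXY f f') (tenXY g g') p''.
Proof.
start_cells; apply XY_eq;
  [cell_eq|cell_eq|cell_eq|cell_eq|simpl_cells; nf_arena; xyy_eq|simpl_cells; nf_arena; xyy_eq|].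
simpl_cells; f_equal; symmetry; eapply (is_xy_ycomp_ten HC);
  [| |eassumption|eassumption|eassumption]; now apply is_ycomposable.
Qed.
End TensorFunctors.

(** * Comparison isomorphisms for the x-composition *)

Section Comparison.
Context {C : markov_category}.
Notation sq := (arena_squares (C := C)).

Definition muXZ (f g f' g' : X sq) (p : xtX f = xsX g) (p' : xtX f' = xsX g') : XZ sq :=
  @glue_X C (fun _ _ => forall f' g' : X sq, xtX f' = xsX g' -> ArXZ)
    (fun _ _ _ d hd e he =>
      @glue_X C (fun _ _ => ArXZ)
        (fun _ _ _ d' hd' e' he' =>
          MkXZ (xlaw_xcomp (xlaw_xten hd hd') (xlaw_xten he he'))
            (xlaw_xten (xlaw_xcomp hd he) (xlaw_xcomp hd' he'))
            (zlaw_zid _) (zlaw_zid _) (xzlaw_xmu d e d' e'))) f g p f' g' p'.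

Lemma muXZE (o1 o2 o3 o1' o2' o3' : arob C) (d : xdata o1 o2) (e : xdata o2 o3)
    (d' : xdata o1' o2') (e' : xdata o2' o3') hd he hd' he' p p' :
  exists h1 h2 h3 h4 h,
    @muXZ (MkX (X_d := d) hd) (MkX (X_d := e) he) (MkX (X_d := d') hd') (MkX (X_d := e') he') p p'
    = @MkXZ _ _ _ _ _ (xcomp (xten d d') (xten e e')) h1 (xten (xcomp d e) (xcomp d' e')) h2
        (zid _) h3 (zid _) h4 (xmu d e d' e') h.
Proof. cbn in p, p'; rewrite (UIP_refl p), (UIP_refl p'); do 5 eexists; reflexivity. Qed.
End Comparison.

Ltac eval_mu :=
  match goal with
  | |- context [@muXZ ?C (@MkX _ ?o1 ?o2 ?d ?hd) (@MkX _ ?o2 ?o3 ?e ?he)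
      (@MkX _ ?o1' ?o2' ?d' ?hd') (@MkX _ ?o2' ?o3' ?e' ?he') ?p ?p'] =>
      let h1 := fresh "h" in let h2 := fresh "h" in let h3 := fresh "h" in
      let h4 := fresh "h" in let h := fresh "h" in let E := fresh "E" in
      destruct (@muXZE C o1 o2 o3 o1' o2' o3' d e d' e' hd he hd' he' p p')
        as (h1 & h2 & h3 & h4 & h & E);
      absorb (@muXZ C (@MkX _ o1 o2 d hd) (@MkX _ o2 o3 e he)
        (@MkX _ o1' o2' d' hd') (@MkX _ o2' o3' e' he') p p') E
  end; simpl_cells.

Ltac mu_cells :=
  intros; cbn [scomp cid cat_semi pt0 pt1 pu psw] in *; autounfold with cells in *;
  cbn [scomp cid cat_semi pt0 pt1 pu psw] in *;
  open_cells; repeat (first [eval_comp | eval_mu]; glue); simpl_cells.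

Section Strong.
Context {C : markov_category}.
Notation sq := (arena_squares (C := C)).

Lemma muXZ_iso (f g f' g' : X sq) (p : xtX f = xsX g) (p' : xtX f' = xsX g') :
  exists nu q q',
    scomp KXZz (muXZ p p') nu q = cid KXZz (zsXZ (muXZ p p')) /\
    scomp KXZz nu (muXZ p p') q' = cid KXZz (ztXZ (muXZ p p')).
Proof.
destruct f as [o1 o2 d hd], g as [o2o o3 e he], f' as [o1' o2' d' hd'], g' as [o2o' o3' e' he'].
cbn in p, p'; glue; mu_cells.
(* The inverse reorders the parameters back; [h] and [h0] are the equations of the source and target
   of the comparison, here in exchanged places. *)
exists (MkXZ h0 h (zlaw_zid _) (zlaw_zid _) (xzlaw_xmu_inv d e d' e')), eq_refl, eq_refl.
split; unfold xmu_inv, shuffle6_inv; mu_cells; cell_eq.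
Qed.

Definition strongX : strong_composition (@KX C) (@KXZx C) permO permX.
Proof.
unshelve refine (@StrongComposition _ _ _ _ _ _ _ _ _ _ _ _ KX KXZx KZ KXZz permO permX
  (@muXZ C) _ _ _ _ muXZ_iso _ _ _ _ _ _ _); abstract (mu_cells; cell_eq).
Defined.
End Strong.

Section Arena.
Context {C : markov_category} (HC : has_conditionals C).

Definition arena : x_semi_triple (arena_cells C) :=
  boundary_triple (double_XY HC) double_XZ double_YZ.

Definition arena_monoidal : symmetric_monoidal arena :=
  @boundary_monoidal _ _ _ _ _ _ _ _ _ _ (double_XY HC) double_XZ double_YZ permO permX permY
    arena_xsX_sm arena_xtX_sm arena_ysY_sm arena_ytY_sm (@tenXY C) (idXYy unitX)
    (fun _ _ => eq_refl) (fun _ _ => eq_refl) (fun _ _ => eq_refl) (fun _ _ => eq_refl)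
    eq_refl eq_refl eq_refl eq_refl
    (@tenXY_A C) (@tenXY_ul C) (@tenXY_ur C) arena_idY_sm (@cid_tenXY C) eq_refl
    arena_compY_sm (scomp_tenXY HC) strongX.

End Arena.

Theorem theorem4p6 (C : markov_category) (HC : has_conditionals C) :
  exists (T : x_semi_triple (arena_cells C)) (M : symmetric_monoidal T),
    arena_compositions T /\ arena_tensor M.
Proof.
exists (arena HC), (arena_monoidal HC); split; constructor; try reflexivity.
all: intros.
- apply scompZE.
- apply scompYE.
- apply scompXE.
- apply scompXYxE.
- apply scompXYyE.
- apply scompXZxE.
- apply scompXZzE.
- eexists; reflexivity.
- eexists; reflexivity.
- eexists; reflexivity.
- do 5 eexists; reflexivity.
- do 5 eexists; reflexivity.
- eexists; reflexivity.
- do 5 eexists; reflexivity.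
- destruct (muXZE p p') as (h1 & h2 & h3 & h4 & h & E).
  (* The comparison square only reorders parameters, so its two ends are identities. *)
  exists (zid (oten o1 o1')), (zid (oten o3 o3')), h1, h2, h3, h4, h; exact E.
Qed.
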